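(* Let $\mathcal A$ and $\mathcal B$ be von Neumann algebras acting on Hilbert spaces $K$ and $H$ respectively. If $\pi:\mathcal A'\to\mathcal B'$ is a $*$-isomorphism between their commutants and $I$ is an infinite cardinal greater than or equal to the cardinality of an orthonormal basis of $H$, then $$k(M_I^w(\mathcal B))\le k(M_I^w(\mathcal A)).$$ In the special case where $\mathcal A$ and $\mathcal B$ are separably acting (i.e. $K$ and $H$ are separable), $$k(M_\infty^w(\mathcal B))=k(M_\infty^w(\mathcal A)).$$
   Context: Matrices: for a weak* closed space $\mathcal X\subset B(H,K)$ and a cardinal $I$, $M_I^w(\mathcal X)$ is the space of $I\times I$ matrices with entries in $\mathcal X$ whose finite submatrices have uniformly bounded norm, regarded as a subspace of $B(H^I,K^I)$, where $H^I,K^I$ are the Hilbert space direct sums of $I$ copies. $M_\infty^w$ denotes $M_I^w$ with $I=\aleph_0$. Hyperreflexivity constant: for a subspace $\mathcal X\subset B(H,K)$ and $T\in B(H,K)$ put $d(T,\mathcal X)=\inf_{X\in\mathcal X}\|T-X\|$ and $r_{\mathcal X}(T)=\sup\{|\langle T\xi,\eta\rangle|:\|\xi\|=\|\eta\|=1,\ \langle X\xi,\eta\rangle=0\ \forall X\in\mathcal X\}$. $\mathcal X$ is hyperreflexive if there is $k>0$ with $d(T,\mathcal X)\le k\,r_{\mathcal X}(T)$ for all $T$; $k(\mathcal X)=\sup_{T\notin\mathcal X} d(T,\mathcal X)/r_{\mathcal X}(T)\in[1,\infty]$, with $k(\mathcal X)=\infty$ if $\mathcal X$ is not hyperreflexive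 and $k(\mathcal X)=1$ if $\mathcal X=B(H,K)$. Von Neumann algebras contain the identity operator of the Hilbert space on which they act. *)

(* Defs.v *)
From HB Require Import structures.
From mathcomp Require Import all_boot all_order all_algebra finmap.
From mathcomp Require Import all_classical all_reals all_analysis.
From mathcomp Require Import complex sesquilinear.
From mathcomp Require summability.
From mathcomp Require Import ring lra.
Set Implicit Arguments. Unset Strict Implicit. Unset Printing Implicit Defensive.
Import Order.TTheory GRing.Theory Num.Theory numFieldNormedType.Exports.
Local Open Scope classical_set_scope.
Local Open Scope ring_scope.
Local Open Scope complex_scope.

HB.mixin Record isHilbert (R : realType) H & CompleteNormedModule R[i] H := {
  hdot : {dot H for (@conjc R)} ;
  hdotE : forall x : H, hdot x x = `|x| ^+ 2 }.

#[short(type="hilbertType")]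
HB.structure Definition Hilbert (R : realType) :=
  {H of CompleteNormedModule R[i] H & isHilbert R H}.

(* The norm of a module over R[i] takes its values in R[i]; [hnorm] is the same
   number in R. *)
Definition hnorm (R : realType) (V : normedZmodType R[i]) (x : V) : R :=
  complex.Re `|x|.

Section hnorm_lemmas.
Context {R : realType} {V : normedModType R[i]}.
Implicit Types x y : V.

Lemma normE x : `|x| = (hnorm x)%:C.
Proof.
by rewrite [LHS]complexE -/(hnorm x) (ger0_Im (normr_ge0 x)) rmorph0 mulr0 addr0.
Qed.

Lemma hnorm_ge0 x : 0 <= hnorm x.
Proof. by rewrite -ler0c -normE. Qed.

Lemma ler_hnormD x y : hnorm (x + y) <= hnorm x + hnorm y.
Proof. by rewrite -lecR rmorphD /= -!normE ler_normD. Qed.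

Lemma hnormZ (a : R[i]) x : hnorm (a *: x) = hnorm (a : R[i]^o) * hnorm x.
Proof. by apply: complexI; rewrite rmorphM /= -!normE normrZ. Qed.

Lemma hnorm0_eq0 x : hnorm x = 0 -> x = 0.
Proof. by move=> x0; apply/normr0_eq0; rewrite normE x0. Qed.

Lemma hnorm0 : hnorm (0 : V) = 0.
Proof. by rewrite /hnorm normr0. Qed.

Lemma hnormN x : hnorm (- x) = hnorm x.
Proof. by rewrite /hnorm normrN. Qed.

End hnorm_lemmas.

Section hdot_lemmas.
Context {R : realType} {H : hilbertType R}.
Implicit Types x y : H.

Lemma hdot_hnorm x : hdot x x = (hnorm x ^+ 2)%:C.
Proof. by rewrite hdotE normE rmorphXn. Qed.

Lemma hdotC x y : hdot y x = (hdot x y)^*.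
Proof. by rewrite hermitian_subproof expr0 mul1r. Qed.

Lemma hnormD_sqr x y :
  hnorm (x + y) ^+ 2 = hnorm x ^+ 2 + hnorm y ^+ 2 + 2 * complex.Re (hdot x y).
Proof.
apply: complexI; rewrite -hdot_hnorm linearDl /= !linearDr /= !hdot_hnorm.
rewrite (hdotC x y); case: (hdot x y) => a b; simpc.
by congr (_ +i* _) => /=; ring.
Qed.

(* Polarization, used to sum inner products termwise. *)
Lemma hdot_polar x y : hdot x y =
  2^-1 * ((hnorm (x + y) ^+ 2 - hnorm x ^+ 2 - hnorm y ^+ 2)%:C
  + 'i%C * (hnorm (- 'i%C *: x + y) ^+ 2 - hnorm x ^+ 2 - hnorm y ^+ 2)%:C).
Proof.
have hi : hnorm (- 'i%C *: x) = hnorm x.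
  rewrite hnormZ hnormN /hnorm /=.
  by rewrite !expr0n /= expr1n add0r sqrtr1 mul1r.
have E (p q r : R) : p + q + 2 * r - p - q = 2 * r by ring.
rewrite !hnormD_sqr hi !E linearZl_LR /=.
rewrite !rmorphM !rmorph_nat mulrCA -mulrDr mulKf ?pnatr_eq0//.
by case: (hdot x y) => a b; simpc.
Qed.

End hdot_lemmas.

#[export] Existing Instance summability.totally_filter.

Section sums.
Context {R : realType} {I : choiceType}.
Local Notation psum u A := (\sum_(i <- A) u i).
Implicit Types (u v : I -> R) (A : {fset I}).

Lemma partial_sumE (V : zmodType) (f : I -> V) A :
  summability.partial_sum f A = \sum_(i <- A) f i.
Proof. by rewrite /summability.partial_sum big_seq_fsetE. Qed.

Lemma fset_fsbig u A : (\sum_(i \in [set` A]) (u i)%:E)%E = (\sum_(i <- A) u i)%:E.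
Proof. by rewrite fsbig_finite//= set_fsetK sumEFin. Qed.

Lemma esum_leP u (M : R) : (\esum_(i in [set: I]) (u i)%:E <= M%:E)%E <->
  (forall A, \sum_(i <- A) u i <= M).
Proof.
split=> [h A|h].
  rewrite -lee_fin -fset_fsbig; apply: le_trans h.
  by apply: ereal_sup_ubound; exists [set` A] => //; split.
apply: ge_ereal_sup => _ [X [finX _] <-].
by rewrite -(fset_setK finX) fset_fsbig lee_fin.
Qed.

Lemma esum_fineK u : (forall i, 0 <= u i) -> (\esum_(i in [set: I]) (u i)%:E < +oo)%E ->
  (fine (\esum_(i in [set: I]) (u i)%:E))%:E = (\esum_(i in [set: I]) (u i)%:E)%E.
Proof. by move=> u0 uoo; rewrite fineK// ge0_fin_numE// esum_ge0// => i _; rewrite lee_fin. Qed.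

Lemma psum_cvg u : (forall i, 0 <= u i) -> (\esum_(i in [set: I]) (u i)%:E < +oo)%E ->
  summability.partial_sum u @ summability.totally -->
  fine (\esum_(i in [set: I]) (u i)%:E).
Proof.
move=> u0 uoo; have SE := esum_fineK u0 uoo; set S := fine _ in SE *.
have ub A : \sum_(i <- A) u i <= S by apply/(esum_leP u S).1; rewrite SE.
apply/cvgrPdist_le => e e0.
have : ((S - e)%:E < \esum_(i in [set: I]) (u i)%:E)%E by rewrite -SE lte_fin ltrBlDr ltrDl.
move=> /ereal_sup_gt[_ [X [finX _] <-]]; rewrite -(fset_setK finX) fset_fsbig lte_fin => hX.
exists (fset_set X) => //= B XB; rewrite partial_sumE ger0_norm ?subr_ge0//.
rewrite lerBlDr addrC -lerBlDr (le_trans (ltW hX))//.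
rewrite [leRHS](big_fsetID _ (mem (fset_set X)))/=.
have -> : [fset i in B | i \in fset_set X]%fset = fset_set X.
  apply/fsetP => i; rewrite !inE andbC; case: (boolP (i \in _)) => //= iX.
  exact: (fsubsetP XB).
by rewrite lerDl sumr_ge0.
Qed.

End sums.

Section hnorm_cvg.
Context {R : realType} {V : normedModType R[i]} {T : Type} {F : set_system T}.
Context {FF : Filter F}.
Implicit Types (f : T -> V) (l : V).

Lemma hcvgP f l : f @ F --> l <->
  forall e : R, 0 < e -> F [set t | hnorm (l - f t) < e].
Proof.
split=> [/cvgrPdist_lt h e e0|h].
  have := h e%:C; rewrite ltcR => /(_ e0); apply: filterS => t.
  by rewrite normE ltcR.
apply/cvgrPdist_lt => e e0.
have eE : e = (complex.Re e)%:C by rewrite [LHS]complexE (ger0_Im (ltW e0)) rmorph0 mulr0 addr0.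
have := h (complex.Re e); rewrite -ltcR -eE => /(_ e0); apply: filterS => t /=.
by rewrite normE [in X in _ -> X]eE ltcR.
Qed.

Lemma ler_hnormB (x y : V) : `|hnorm x - hnorm y| <= hnorm (x - y).
Proof.
rewrite ler_norml; have := ler_hnormD (x - y) y; have := ler_hnormD (y - x) x.
rewrite !subrK -(opprB x y) hnormN => h1 h2; apply/andP; split; lra.
Qed.

Lemma hnorm_cvg f l : f @ F --> l -> (hnorm (f t) @[t --> F]) --> (hnorm l : R).
Proof.
move=> /hcvgP h; apply/cvgrPdist_lt => e /h; apply: filterS => t.
exact/le_lt_trans/ler_hnormB.
Qed.

End hnorm_cvg.

Lemma cvg_bigsum (K : numFieldType) (V : normedModType K) (T J : Type)
    (F : set_system T) {FF : Filter F} (r : seq J) (f : J -> T -> V) (l : J -> V) :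
  (forall j, f j @ F --> l j) ->
  (\sum_(j <- r) f j t @[t --> F]) --> \sum_(j <- r) l j.
Proof.
move=> h; elim: r => [|j r ih].
  under eq_fun do rewrite big_nil; rewrite big_nil; exact: cvg_cst.
under eq_fun do rewrite big_cons; rewrite big_cons; apply: cvgD => //; exact: h.
Qed.

Section hilbert_sum.
Context {R : realType} (I : choiceType) (H : hilbertType R).
Implicit Types x y : I -> H.

Definition sqsum x : \bar R := (\esum_(i in [set: I]) (hnorm (x i) ^+ 2)%:E)%E.

Definition l2 : {pred I -> H} := [pred x | `[< (sqsum x < +oo)%E >]].

Lemma l2P x : reflect (exists M, forall A : {fset I},
  \sum_(i <- A) hnorm (x i) ^+ 2 <= M) (x \in l2).
Proof.
apply: (iffP (asboolP _)) => [h|[M hM]].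
  exists (fine (sqsum x)); apply/(esum_leP _ _).1.
  by rewrite esum_fineK// => i; exact: sqr_ge0.
by apply: le_lt_trans (ltry M); apply/esum_leP.
Qed.

Lemma sqsumK x : x \in l2 -> (fine (sqsum x))%:E = sqsum x.
Proof. by move=> /asboolP xl; apply: esum_fineK => // i; exact: sqr_ge0. Qed.

Lemma sqsum_ge0 x : 0 <= fine (sqsum x).
Proof. by rewrite fine_ge0// esum_ge0// => i _; rewrite lee_fin sqr_ge0. Qed.

Lemma sqsum_leP x M : x \in l2 ->
  fine (sqsum x) <= M <-> forall A : {fset I}, \sum_(i <- A) hnorm (x i) ^+ 2 <= M.
Proof. by move=> xl; rewrite -esum_leP -lee_fin sqsumK. Qed.

Lemma psum_le_sqsum x (A : {fset I}) : x \in l2 ->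
  \sum_(i <- A) hnorm (x i) ^+ 2 <= fine (sqsum x).
Proof. by move=> xl; move: A; apply/sqsum_leP. Qed.

Lemma l2_submod_closed : submod_closed l2.
Proof.
split=> [|a x y /l2P[M hM] /l2P[N hN]].
  apply/l2P; exists 0 => A; rewrite big1// => i _.
  by rewrite hnorm0 expr0n.
apply/l2P; exists (2 * hnorm (a : R[i]^o) ^+ 2 * M + 2 * N) => A.
have c0 : 0 <= 2 * hnorm (a : R[i]^o) ^+ 2 by rewrite mulr_ge0// sqr_ge0.
apply: le_trans (lerD (ler_wpM2l c0 (hM A)) (ler_wpM2l (ler0n _ 2) (hN A))).
rewrite !mulr_sumr -big_split/=; apply: ler_sum => i _.
rewrite -mulrA -exprMn -hnormZ.
have : hnorm (a *: x i + y i) ^+ 2 <= (hnorm (a *: x i) + hnorm (y i)) ^+ 2.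
  by rewrite lerXn2r ?nnegrE ?addr_ge0 ?hnorm_ge0// ler_hnormD.
move=> /le_trans; apply.
have := sqr_ge0 (hnorm (a *: x i) - hnorm (y i)).
rewrite sqrrB sqrrD; lra.
Qed.

HB.instance Definition _ := GRing.isSubmodClosed.Build _ _ l2 l2_submod_closed.

(* The Hilbert space direct sum H^I of I copies of H. *)
Record hsum := HSum { hsum_val :> I -> H ; hsumP : hsum_val \in l2 }.

HB.instance Definition _ := [isSub for hsum_val].
HB.instance Definition _ := [Choice of hsum by <:].
HB.instance Definition _ := [SubChoice_isSubLmodule of hsum by <:].

Definition hsum_norm (x : hsum) : R[i] := (Num.sqrt (fine (sqsum x)))%:C.

Lemma hsumDE (x y : hsum) i : (x + y) i = x i + y i. Proof. by []. Qed.
Lemma hsumZE a (x : hsum) i : (a *: x) i = a *: x i. Proof. by []. Qed.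
Lemma hsumBE (x y : hsum) i : (x - y) i = x i - y i. Proof. by []. Qed.

Lemma sqsum0 (x : hsum) : fine (sqsum x) = 0 -> x = 0.
Proof.
move=> x0; apply/val_inj/funext => i /=; apply: hnorm0_eq0; apply/eqP.
rewrite -sqrf_eq0 eq_le sqr_ge0 andbT.
by have := psum_le_sqsum [fset i]%fset (hsumP x); rewrite big_seq_fset1 x0.
Qed.

Lemma ler_hsum_normD (x y : hsum) : hsum_norm (x + y) <= hsum_norm x + hsum_norm y.
Proof.
rewrite /hsum_norm -rmorphD lecR.
set p := Num.sqrt (fine (sqsum x)); set q := Num.sqrt (fine (sqsum y)).
have p0 : 0 <= p by exact: sqrtr_ge0.
have q0 : 0 <= q by exact: sqrtr_ge0.
have pE : p ^+ 2 = fine (sqsum x) by rewrite sqr_sqrtr// sqsum_ge0.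
have qE : q ^+ 2 = fine (sqsum y) by rewrite sqr_sqrtr// sqsum_ge0.
have [p1|p1] := eqVneq p 0.
  have -> : x = 0 by apply: sqsum0; rewrite -pE p1 expr0n.
  by rewrite add0r -/q p1 add0r.
have [q1|q1] := eqVneq q 0.
  have -> : y = 0 by apply: sqsum0; rewrite -qE q1 expr0n.
  by rewrite addr0 -/p q1 addr0.
have {p1}p1 : 0 < p by rewrite lt_neqAle eq_sym p1.
have {q1}q1 : 0 < q by rewrite lt_neqAle eq_sym q1.
have pq0 : 0 <= p + q by rewrite addr_ge0.
rewrite -[leRHS]ger0_norm// -sqrtr_sqr ler_wsqrtr//.
apply/sqsum_leP => [|A]; first exact: hsumP.
have cp : 0 <= (p + q) / p by rewrite divr_ge0.
have cq : 0 <= (p + q) / q by rewrite divr_ge0.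
have -> : (p + q) ^+ 2 = (p + q) / p * fine (sqsum x) + (p + q) / q * fine (sqsum y).
  rewrite -pE -qE !expr2 !mulrA !divfK ?gt_eqF//; ring.
apply: le_trans (lerD (ler_wpM2l cp (psum_le_sqsum A (hsumP x)))
  (ler_wpM2l cq (psum_le_sqsum A (hsumP y)))).
rewrite !mulr_sumr -big_split/=; apply: ler_sum => i _.
set a := hnorm (x i); set b := hnorm (y i).
have : hnorm (x i + y i) ^+ 2 <= (a + b) ^+ 2.
  by rewrite lerXn2r ?nnegrE ?addr_ge0 ?hnorm_ge0// ler_hnormD.
move=> /le_trans; apply; rewrite -subr_ge0.
have -> : (p + q) / p * a ^+ 2 + (p + q) / q * b ^+ 2 - (a + b) ^+ 2 =
  (q * a - p * b) ^+ 2 / (p * q) by field; rewrite ?gt_eqF.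
by rewrite divr_ge0 ?sqr_ge0// mulr_ge0.
Qed.

Lemma hnormV (a : R[i]) : hnorm (a^-1 : R[i]^o) = (hnorm (a : R[i]^o))^-1.
Proof. by apply: complexI; rewrite fmorphV -!normE normfV. Qed.

Lemma sqsumZ (a : R[i]) (x : hsum) :
  fine (sqsum (a *: x)) <= hnorm (a : R[i]^o) ^+ 2 * fine (sqsum x).
Proof.
apply/sqsum_leP => [|A]; first exact: hsumP (a *: x).
have := ler_wpM2l (sqr_ge0 (hnorm (a : R[i]^o))) (psum_le_sqsum A (hsumP x)).
apply: le_trans; rewrite mulr_sumr; apply: ler_sum => i _.
by rewrite hnormZ exprMn.
Qed.

Lemma hsum_normZ (a : R[i]) (x : hsum) : hsum_norm (a *: x) = `|a| * hsum_norm x.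
Proof.
rewrite (normE (a : R[i]^o)) /hsum_norm -rmorphM; congr (_%:C).
rewrite -[hnorm _]ger0_norm ?hnorm_ge0// -sqrtr_sqr -sqrtrM ?sqr_ge0//.
congr (Num.sqrt _); apply/eqP; rewrite eq_le sqsumZ/=.
have [->|a0] := eqVneq a 0.
  by rewrite hnorm0 expr0n mul0r sqsum_ge0.
have h0 : 0 < hnorm (a : R[i]^o) by rewrite -ltcR -normE normr_gt0.
rewrite mulrC -ler_pdivlMr ?exprn_gt0//.
have := sqsumZ a^-1 (a *: x); rewrite scalerA mulVf// scale1r.
by rewrite mulrC hnormV exprVn.
Qed.

Lemma hsum_norm_eq0 (x : hsum) : hsum_norm x = 0 -> x = 0.
Proof.
move=> /complexI/eqP; rewrite sqrtr_eq0 => h; apply: sqsum0.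
by apply/eqP; rewrite eq_le h sqsum_ge0.
Qed.

HB.instance Definition _ := Lmodule_isNormed.Build R[i] hsum
  ler_hsum_normD hsum_normZ hsum_norm_eq0.


Lemma hsum_hnorm (x : hsum) : hnorm x = Num.sqrt (fine (sqsum x)).
Proof. by []. Qed.

Lemma hsum_hnorm_sqr (x : hsum) : hnorm x ^+ 2 = fine (sqsum x).
Proof. by rewrite hsum_hnorm sqr_sqrtr// sqsum_ge0. Qed.

Lemma hnorm_coord (x : hsum) i : hnorm (x i) <= hnorm x.
Proof.
rewrite -(@ler_pXn2r _ 2) ?nnegrE ?hnorm_ge0// hsum_hnorm_sqr.
by have := psum_le_sqsum [fset i]%fset (hsumP x); rewrite big_seq_fset1.
Qed.

Lemma hsum_complete (F : set_system hsum) : ProperFilter F -> cauchy F -> cvg F.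
Proof.
move=> FF Fc.
have cB (e : R) : 0 < e -> exists z : hsum, F [set y | hnorm (z - y) < e].
  move=> e0; have /cauchyP/(_ e%:C) := Fc.
  rewrite ltcR => /(_ e0)[z zF]; exists z; apply: filterS zF => y.
  by rewrite -ball_normE /= normE ltcR.
pose G i := (fun x : hsum => x i) @ F.
have Gcvg i : cvg (G i).
  apply: cauchy_cvg; apply/cauchyP => e e0.
  have eE : e = (complex.Re e)%:C.
    by rewrite [LHS]complexE (ger0_Im (ltW e0)) rmorph0 mulr0 addr0.
  have [|z zF] := cB (complex.Re e); first by rewrite -ltcR -eE.
  exists (z i); rewrite /G; change (F [set y : hsum | ball (z i) e (y i)]).
  apply: filterS zF => y /= zy.
  rewrite -ball_normE /= normE eE ltcR -hsumBE.
  exact: le_lt_trans (hnorm_coord _ _) zy.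
pose l i := lim (G i).
have key (e : R) (z : hsum) : 0 < e -> F [set y | hnorm (z - y) < e] ->
    forall A : {fset I}, \sum_(i <- A) hnorm (((z : I -> H) - l) i) ^+ 2 <= e ^+ 2.
  move=> e0 zF A.
  apply: (@cvgr_to_le _ F _ _ (fun y : hsum => \sum_(i <- A) hnorm (z i - y i) ^+ 2)).
    apply: cvg_bigsum => i; rewrite expr2; under eq_fun do rewrite expr2.
    have c : (hnorm (z i - y i) @[y --> F]) --> hnorm (z i - l i).
      by apply: hnorm_cvg; apply: cvgB; [exact: cvg_cst|exact: Gcvg].
    exact: cvgM.
  apply: filterS zF => y zy.
  apply: le_trans (psum_le_sqsum A (hsumP (z - y))) _.
  by rewrite -hsum_hnorm_sqr lerXn2r ?nnegrE ?hnorm_ge0 ?ltW.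
have lP : l \in l2.
  have [z zF] := cB _ (@ltr01 R).
  have -> : l = (z : I -> H) - ((z : I -> H) - l) by rewrite opprB addrC subrK.
  rewrite rpredB// ?hsumP//; apply/l2P; exists (1 ^+ 2); exact: key.
apply/cvg_ex; exists (HSum lP); apply/hcvgP => e e0.
have e20 : 0 < e / 2 by rewrite divr_gt0.
have [z zF] := cB _ e20.
apply: filterS (zF) => y /= zy.
have -> : HSum lP - y = (z - y) + (HSum lP - z) by rewrite [RHS]addrC addrA subrK.
apply: le_lt_trans (ler_hnormD _ _) _; rewrite [ltRHS]splitr ltr_leD//.
rewrite -opprB hnormN.
rewrite -(@ler_pXn2r _ 2) ?nnegrE ?hnorm_ge0 ?(ltW e20)// hsum_hnorm_sqr.
by apply/sqsum_leP; [exact: hsumP|exact: key].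
Qed.

HB.instance Definition _ := Uniform_isComplete.Build hsum hsum_complete.

(* The sum over the net of finite subsets of I. *)
Definition hsum_dot (x y : hsum) : R[i] :=
  summability.sum (fun i => hdot (x i) (y i) : R[i]^o).

Lemma cvg_realC (T : Type) (F : set_system T) {FF : Filter F} (u : T -> R) (l : R) :
  u @ F --> l -> ((u t)%:C : R[i]^o) @[t --> F] --> (l%:C : R[i]^o).
Proof.
move=> /cvgrPdist_lt h; apply/hcvgP => e /h; apply: filterS => t.
by rewrite /= -rmorphB /hnorm /= expr0n /= addr0 sqrtr_sqr.
Qed.

Lemma hsum_dot_cvg (x y : hsum) :
  summability.partial_sum (fun i => hdot (x i) (y i) : R[i]^o) @ summability.totally
  --> (hsum_dot x y : R[i]^o).
Proof.
pose P (z : hsum) (A : {fset I}) : R := summability.partial_sum (fun i => hnorm (z i) ^+ 2) A.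
rewrite /hsum_dot /summability.sum.
have Pcvg (z : hsum) : P z @ summability.totally --> fine (sqsum z).
  by apply: psum_cvg => [i|]; [exact: sqr_ge0|exact/asboolP/hsumP].
pose g (z : hsum) A : R[i]^o := (P z A - P x A - P y A)%:C.
pose lg (z : hsum) : R[i]^o := (fine (sqsum z) - fine (sqsum x) - fine (sqsum y))%:C.
have gcvg (z : hsum) : g z @ summability.totally --> lg z.
  by apply: cvg_realC; apply: cvgB; [apply: cvgB|]; exact: Pcvg.
have -> : summability.partial_sum (fun i => hdot (x i) (y i) : R[i]^o) =
    (2^-1 : R[i]) \*: (g (x + y) \+ (('i%C : R[i]) \*: g (- 'i%C *: x + y))).
  apply/funext => A; rewrite /g /P /= !partial_sumE -!sumrB !rmorph_sum /=.
  rewrite !scaler_sumr -big_split/= scaler_sumr.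
  by apply: eq_bigr => i _; rewrite hdot_polar.
have c := @cvgZl_tmp _ _ _ _ _ (2^-1 : R[i]) _ _ (cvgD (gcvg (x + y))
   (@cvgZl_tmp _ _ _ _ _ ('i%C : R[i]) _ _ (gcvg (- 'i%C *: x + y)))).
exact: cvgP (c _ _ _).
Qed.

Lemma hsum_dot_lim (x y : hsum) (c : R[i]) :
  summability.partial_sum (fun i => hdot (x i) (y i) : R[i]^o) @ summability.totally
  --> (c : R[i]^o) -> hsum_dot x y = c.
Proof. by move=> h; apply: (cvg_lim _ h); exact: norm_hausdorff. Qed.

Lemma hsum_dotP (a : R[i]) (x x' y : hsum) :
  hsum_dot (a *: x + x') y = a * hsum_dot x y + hsum_dot x' y.
Proof.
apply: hsum_dot_lim.
have -> : summability.partial_sum (fun i => hdot ((a *: x + x') i) (y i) : R[i]^o) =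
    a \*: summability.partial_sum (fun i => hdot (x i) (y i) : R[i]^o) \+
    summability.partial_sum (fun i => hdot (x' i) (y i) : R[i]^o).
  apply/funext => A; rewrite /= !partial_sumE scaler_sumr -big_split/=.
  by apply: eq_bigr => i _; rewrite linearDl/= linearZl_LR.
have c := cvgD (@cvgZl_tmp _ _ _ _ _ a _ _ (@hsum_dot_cvg x y)) (@hsum_dot_cvg x' y).
exact: c.
Qed.

Lemma hnorm_conj (a : R[i]) : hnorm (a^* : R[i]^o) = hnorm (a : R[i]^o).
Proof. by case: a => a b; rewrite /hnorm /= sqrrN. Qed.

Lemma hsum_dotC (x y : hsum) : hsum_dot x y = (-1) ^+ false * (hsum_dot y x)^*.
Proof.
rewrite expr0 mul1r; apply: hsum_dot_lim; apply/hcvgP => e e0.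
have /hcvgP/(_ e e0) := @hsum_dot_cvg y x; apply: filterS => A /=.
rewrite -hnorm_conj rmorphB /= !partial_sumE rmorph_sum /=.
by under [in X in _ -> X]eq_bigr do rewrite hdotC.
Qed.

Lemma hsum_dotE (x : hsum) : hsum_dot x x = `|x| ^+ 2.
Proof.
apply: hsum_dot_lim; rewrite normE -rmorphXn /= hsum_hnorm_sqr.
have -> : summability.partial_sum (fun i => hdot (x i) (x i) : R[i]^o) =
   (fun A => (summability.partial_sum (fun i => hnorm (x i) ^+ 2) A)%:C).
  apply/funext => A; rewrite !partial_sumE rmorph_sum /=.
  by apply: eq_bigr => i _; rewrite hdot_hnorm.
apply: cvg_realC; apply: psum_cvg => [i|]; first exact: sqr_ge0.
exact/asboolP/hsumP.
Qed.

Lemma hsum_dot_bilinear : bilinear_for *%R (@conjc R \; *%R) hsum_dot.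
Proof.
split=> [y a x x'|x a y y'] /=; first exact: hsum_dotP.
rewrite hsum_dotC hsum_dotP rmorphD rmorphM expr0 mul1r /=.
by rewrite (hsum_dotC x y) (hsum_dotC x y') !expr0 !mul1r.
Qed.

Lemma hsum_dot_gt0 (x : hsum) : x != 0 -> 0 < hsum_dot x x.
Proof. by move=> x0; rewrite hsum_dotE exprn_gt0// normr_gt0. Qed.

HB.instance Definition _ := bilinear_isBilinear.Build R[i] hsum hsum R[i]
  *%R (@conjc R \; *%R) hsum_dot hsum_dot_bilinear.
HB.instance Definition _ := isHermitianSesquilinear.Build R[i] hsum false
  (@conjc R) hsum_dot hsum_dotC.
HB.instance Definition _ := isDotProduct.Build R[i] hsum hsum_dot hsum_dot_gt0.
HB.instance Definition _ := isHilbert.Build R hsum hsum_dotE.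

Lemma hsingle_l2 i (x : H) : (fun j => if j == i then x else 0) \in l2.
Proof.
apply/l2P; exists (hnorm x ^+ 2) => A.
have [iA|iA] := boolP (i \in A).
  rewrite (big_fsetD1 i)//= eqxx big1_fset ?addr0// => j.
  by rewrite !inE => /andP[/negPf->] _; rewrite hnorm0 expr0n.
rewrite big1_seq ?sqr_ge0// => j /= jA; case: eqP => [ji|_].
  by rewrite -ji jA in iA.
by rewrite hnorm0 expr0n.
Qed.

Definition hsingle i (x : H) : hsum := HSum (hsingle_l2 i x).

End hilbert_sum.

Section operators.
Context {R : realType}.
Implicit Types H K : hilbertType R.

(* B(H, K). *)
Definition bounded_ops {H K} : set (H -> K) := [set T | linear T /\ continuous T].

Definition opnorm {H K} (T : H -> K) : R :=
  sup [set hnorm (T x) | x in [set x | hnorm x <= 1]].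

Definition opdist {H K} (T : H -> K) (X : set (H -> K)) : R :=
  inf [set opnorm (T - S) | S in X].

(* [sup set0 = 0], so this is 0 when no pair of unit vectors annihilates X. *)
Definition annih_seminorm {H K} (X : set (H -> K)) (T : H -> K) : R :=
  sup [set hnorm (hdot (T p.1) p.2 : R[i]^o) | p in [set p : H * K |
    [/\ hnorm p.1 = 1, hnorm p.2 = 1 & forall S, X S -> hdot (S p.1) p.2 = 0]]].

Definition hyperreflexive {H K} (X : set (H -> K)) : Prop :=
  exists2 k : R, 0 < k &
    forall T, bounded_ops T -> opdist T X <= k * annih_seminorm X T.

(* For a hyperreflexive X the denominator vanishes only when the numerator
   does, that is, only for T in the norm closure of X. *)
Definition hyperreflexivity_constant {H K} (X : set (H -> K)) : \bar R :=
  if X == bounded_ops then 1%E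
  else if `[< hyperreflexive X >] then
    ereal_sup [set (opdist T X / annih_seminorm X T)%:E | T in bounded_ops `\` X]
  else +oo%E.

(* The weak operator topology is initial for the map wot_eval. *)
Definition wot_eval {H K} (T : H -> K) : prod_topology (fun _ : H * K => R[i]^o) :=
  fun p => hdot (T p.1) p.2.

Definition wot_closed {H K} (X : set (H -> K)) : Prop :=
  bounded_ops `&` closure (X : set (initial_topology (@wot_eval H K))) `<=` X.

Definition is_adjoint {H K} (S : H -> K) (T : K -> H) : Prop :=
  forall x y, hdot (S x) y = hdot x (T y).

Record von_neumann_algebra {H} (A : set (H -> H)) : Prop := {
  vna_bounded : A `<=` bounded_ops ;
  vna_id : A id ;
  vna_add : forall S T, A S -> A T -> A (S + T) ;
  vna_scale : forall (c : R[i]) S, A S -> A (c *: S) ;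
  vna_comp : forall S T, A S -> A T -> A (S \o T) ;
  vna_adjoint : forall S T, A S -> is_adjoint S T -> A T ;
  vna_closed : wot_closed A }.

Definition commutant {H} (A : set (H -> H)) : set (H -> H) :=
  [set T | bounded_ops T /\ forall S, A S -> T \o S = S \o T].

(* Only the values of pi on M matter. *)
Record star_isomorphism {K H} (M : set (K -> K)) (N : set (H -> H))
    (pi : (K -> K) -> (H -> H)) : Prop := {
  star_iso_bij : set_bij M N pi ;
  star_iso_add : forall S T, M S -> M T -> pi (S + T) = pi S + pi T ;
  star_iso_scale : forall (c : R[i]) S, M S -> pi (c *: S) = c *: pi S ;
  star_iso_comp : forall S T, M S -> M T -> pi (S \o T) = pi S \o pi T ;
  star_iso_adjoint : forall S T, M S -> M T ->
    is_adjoint S T -> is_adjoint (pi S) (pi T) }.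

Definition bounded_submatrices {H K} {I : choiceType} (a : I -> I -> H -> K) : Prop :=
  exists2 c : R, 0 <= c & forall (F G : {fset I}) (x : I -> H),
    \sum_(i <- F) hnorm (\sum_(j <- G) a i j (x j)) ^+ 2
      <= c ^+ 2 * \sum_(j <- G) hnorm (x j) ^+ 2.

(* The operators in B(H^I, K^I) whose matrix (a i j) has its entries in X and
   uniformly bounded finite submatrices. *)
Definition matrix_space {H K} (I : choiceType) (X : set (H -> K)) :
    set (hsum I H -> hsum I K) :=
  [set T : hsum I H -> hsum I K | bounded_ops T /\ exists a : I -> I -> H -> K,
    [/\ forall i j, X (a i j), bounded_submatrices a &
        forall i j x, T (hsingle j x) i = a i j x]].

Definition linear_span {H} (E : set H) : set H :=
  [set \sum_(p <- s) p.1 *: p.2 |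
    s in [set s : seq (R[i] * H) | forall p, p \in s -> E p.2]].

Definition orthonormal_basis {H} (E : set H) : Prop :=
  (forall x y, E x -> E y -> hdot x y = (x == y)%:R) /\ dense (linear_span E).

Definition separable_space H : Prop := exists2 D : set H, countable D & dense D.

End operators.

Arguments matrix_space {R H K} I X _.

(* Main.v *)
From mathcomp Require Import all_boot all_order all_algebra finmap.
From mathcomp Require Import all_classical all_reals all_analysis.
From mathcomp Require Import complex sesquilinear.
From mathcomp Require summability.
From mathcomp Require Import ring lra.
Require Import Defs.

(** Write M and N for the commutants of [A] and [B]. Matrices over [A] are exactly
the operators on the Hilbert sum that commute with the diagonal amplification of
M ([matrix_spaceP], from the bicommutant theorem), and likewise for [B]. Hence an
isometry [W] from [hsum I H] to [hsum I K] that intertwines pi(x), amplified, with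
x, amplified, for x in M, makes S |-> W S W^* and T |-> W^* T W map each matrix
space into the other. The space over [B] is then a compression of the space over
[A], and the hyperreflexivity constant does not increase under such compressions
([compression_constant]). In the separable case the same is applied to the inverse
isomorphism.

The isometry exists because star isomorphisms of von Neumann algebras are spatial
after amplification. The main step is local ([vector_state_exists]): for every nonzero vector xi of [H] some pi(h) xi is
nonzero and its vector state, transported to M, is the state of a vector eta' of
[K]. To find [h], compare on M the positive functionals <pi(x) xi, xi> and
<x eta, eta>, where eta is long enough for the second to be larger on the support
[e] of the first. Zorn's lemma gives a maximal q below [e] on which the first is
still at least the second; below h = e - q the second dominates, and since
h x^* x h is below a multiple of h, the map x h eta |-> pi(x) pi(h) xi is bounded.
Its extension [T] intertwines the actions, and eta' = sqrt(T^* T) h eta. Working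
with positive operators instead of projections avoids spectral theory: only square
roots and limits of monotone chains are needed ([effect_sqrt],
[chain_limit_effect]). Along a chain the isomorphism enters through its
monotonicity ([iso_le]), itself a consequence of the existence of square roots.

A second use of Zorn's lemma decomposes [H] into cyclic subspaces, each matched
with a cyclic subspace of [K] ([total_matched_family]). Bessel's inequality bounds
their number by the cardinality of [I], and I * I injects into [I]
([infinite_square]), so that the cyclic subspaces of [hsum I H] can be sent to
different coordinates of [hsum I K] ([amplified_intertwiner]). *)

Set Implicit Arguments. Unset Strict Implicit. Unset Printing Implicit Defensive.
Import Order.TTheory GRing.Theory Num.Theory numFieldNormedType.Exports.
Local Open Scope classical_set_scope.
Local Open Scope ring_scope.
Local Open Scope complex_scope.

(** * Inner products and norms *)

Section real_inner_product.
Context {R : realType} {H : hilbertType R}.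
Implicit Types (x y z : H) (a b : R[i]).

Lemma dotDl x y z : hdot (x + y) z = hdot x z + hdot y z.
Proof. exact: linearDl. Qed.
Lemma dotDr x y z : hdot x (y + z) = hdot x y + hdot x z.
Proof. exact: linearDr. Qed.
Lemma dotZl a x y : hdot (a *: x) y = a * hdot x y.
Proof. exact: linearZl_LR. Qed.
Lemma dotZr a x y : hdot x (a *: y) = conjc a * hdot x y.
Proof. exact: linearZr_LR. Qed.
Lemma dot0l x : hdot 0 x = 0. Proof. exact: linear0l. Qed.
Lemma dot0r x : hdot x 0 = 0. Proof. exact: linear0r. Qed.
Lemma dotNl x y : hdot (- x) y = - hdot x y. Proof. exact: linearNl. Qed.
Lemma dotNr x y : hdot x (- y) = - hdot x y. Proof. exact: linearNr. Qed.
Lemma dotBl x y z : hdot (x - y) z = hdot x z - hdot y z.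
Proof. by rewrite dotDl dotNl. Qed.
Lemma dotBr x y z : hdot x (y - z) = hdot x y - hdot x z.
Proof. by rewrite dotDr dotNr. Qed.
Lemma dot_suml (J : Type) (r : seq J) (P : pred J) (f : J -> H) y :
  hdot (\sum_(j <- r | P j) f j) y = \sum_(j <- r | P j) hdot (f j) y.
Proof. exact: (big_morph (hdot^~ y) (fun u v => dotDl u v y) (dot0l y)). Qed.
Lemma dot_sumr (J : Type) (r : seq J) (P : pred J) (f : J -> H) y :
  hdot y (\sum_(j <- r | P j) f j) = \sum_(j <- r | P j) hdot y (f j).
Proof. exact: (big_morph (hdot y) (dotDr y) (dot0r y)). Qed.

(** Most estimates only concern the real part of the inner product, a real
symmetric bilinear form with values in an ordered field; [hdot_rdot] recovers
the complex inner product from it. *)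
Definition rdot x y : R := complex.Re (hdot x y).

Lemma rdotC x y : rdot x y = rdot y x.
Proof. by rewrite /rdot (hdotC x y); case: (hdot x y). Qed.
Lemma rdotDl x y z : rdot (x + y) z = rdot x z + rdot y z.
Proof. by rewrite /rdot dotDl raddfD. Qed.
Lemma rdotDr x y z : rdot x (y + z) = rdot x y + rdot x z.
Proof. by rewrite /rdot dotDr raddfD. Qed.
Lemma rdotNl x y : rdot (- x) y = - rdot x y.
Proof. by rewrite /rdot dotNl raddfN. Qed.
Lemma rdotNr x y : rdot x (- y) = - rdot x y.
Proof. by rewrite /rdot dotNr raddfN. Qed.
Lemma rdotBl x y z : rdot (x - y) z = rdot x z - rdot y z.
Proof. by rewrite rdotDl rdotNl. Qed.
Lemma rdotBr x y z : rdot x (y - z) = rdot x y - rdot x z.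
Proof. by rewrite rdotDr rdotNr. Qed.
Lemma rdotZl (t : R) x y : rdot (t%:C *: x) y = t * rdot x y.
Proof. by rewrite /rdot dotZl; case: (hdot x y) => u v /=; rewrite mul0r subr0. Qed.
Lemma rdotZr (t : R) x y : rdot x (t%:C *: y) = t * rdot x y.
Proof. by rewrite rdotC rdotZl rdotC. Qed.
Lemma rdot0l x : rdot 0 x = 0. Proof. by rewrite /rdot dot0l. Qed.
Lemma rdot0r x : rdot x 0 = 0. Proof. by rewrite rdotC rdot0l. Qed.

Lemma hnorm_sqr x : hnorm x ^+ 2 = rdot x x.
Proof. by rewrite /rdot hdot_hnorm. Qed.

Lemma rdot_ge0 x : 0 <= rdot x x. Proof. by rewrite -hnorm_sqr sqr_ge0. Qed.

Lemma hdot_rdot x y : hdot x y = (rdot x y) +i* (rdot (- 'i%C *: x) y).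
Proof.
rewrite /rdot dotZl; case: (hdot x y) => u v /=; congr (_ +i* _).
by rewrite !(oppr0, mul0r, sub0r, mulN1r, opprK).
Qed.

Lemma rdot_eq0 x : rdot x x = 0 -> x = 0.
Proof. by rewrite -hnorm_sqr => /eqP; rewrite sqrf_eq0 => /eqP/hnorm0_eq0. Qed.

Lemma rdot_total_eq0 x : (forall y, rdot x y = 0) -> x = 0.
Proof. by move=> h; apply: rdot_eq0. Qed.

Lemma dot_inj x y : (forall z, hdot x z = hdot y z) -> x = y.
Proof.
move=> h; apply/eqP; rewrite -subr_eq0; apply/eqP/rdot_total_eq0 => z.
by rewrite /rdot dotBl h subrr.
Qed.

Lemma dot_injr x y : (forall z, hdot z x = hdot z y) -> x = y.
Proof. by move=> h; apply: dot_inj => z; rewrite hdotC h -hdotC. Qed.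

Lemma hdot_eq0C x y : hdot x y = 0 -> hdot y x = 0.
Proof. by move=> h; rewrite hdotC h conjc0. Qed.

End real_inner_product.

Lemma hdot_eq_rdot (R : realType) (H H' : hilbertType R) (u v : H) (u' v' : H') :
  (forall a : R[i], rdot (a *: u) v = rdot (a *: u') v') -> hdot u v = hdot u' v'.
Proof. by move=> h; rewrite !hdot_rdot h -(scale1r u) h scale1r. Qed.

(** The Cauchy-Schwarz inequality for every positive semidefinite form comes from
this bound on the discriminant; when [c] vanishes the linear polynomial that
remains is made equal to -1 at a suitable point unless [b] vanishes. *)
Lemma discr_le0 (R : realType) (a b c : R) : 0 <= c ->
  (forall t, 0 <= a + 2 * t * b + t ^+ 2 * c) -> b ^+ 2 <= a * c.
Proof.
move=> c0 h; have [c1|c1] := eqVneq c 0.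
  rewrite c1 mulr0; have [->|b0] := eqVneq b 0; first by rewrite expr0n.
  have := h (- (a + 1) / (2 * b)); rewrite c1 mulr0 addr0.
  have -> : a + 2 * (- (a + 1) / (2 * b)) * b = -1 by field.
  by rewrite ler0N1.
have {c1} c1 : 0 < c by rewrite lt_neqAle eq_sym c1.
have := h (- b / c).
have -> : a + 2 * (- b / c) * b + (- b / c) ^+ 2 * c = (a * c - b ^+ 2) / c.
  by field; rewrite gt_eqF.
by rewrite pmulr_lge0 ?invr_gt0// subr_ge0.
Qed.

Lemma eq0_small (R : realType) (r C : R) : (forall e, 0 < e -> `|r| <= C * e) -> r = 0.
Proof.
move=> h; apply/eqP; rewrite -normr_le0 leNgt; apply/negP => r0.
pose c := Num.max C 1; have c0 : 0 < c by rewrite lt_max ltr01 orbT.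
have := h (`|r| / (2 * c)); rewrite divr_gt0 ?mulr_gt0// => /(_ isT).
have -> : C * (`|r| / (2 * c)) = C / c * (`|r| / 2) by field; rewrite gt_eqF.
have : C / c <= 1 by rewrite ler_pdivrMr// mul1r le_max lexx.
move=> cc; have : C / c * (`|r| / 2) <= 1 * (`|r| / 2) by rewrite ler_wpM2r// divr_ge0.
lra.
Qed.

Lemma hnorm_small_eq0 (R : realType) (V : normedModType R[i]) (x : V) (C : R) :
  (forall e, 0 < e -> hnorm x <= C * e) -> x = 0.
Proof.
move=> h; apply/hnorm0_eq0/(@eq0_small _ _ C) => e /h.
by rewrite ger0_norm// hnorm_ge0.
Qed.

Lemma ler_hnormB_le (R : realType) (V : normedModType R[i]) (x y : V) :
  hnorm (x - y) <= hnorm x + hnorm y.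
Proof. by rewrite -(hnormN y) ler_hnormD. Qed.

Lemma hnormBC (R : realType) (V : normedModType R[i]) (x y : V) : hnorm (x - y) = hnorm (y - x).
Proof. by rewrite -opprB hnormN. Qed.

Lemma hnormC (R : realType) (t : R) : hnorm (t%:C : R[i]^o) = `|t|.
Proof. by rewrite /hnorm /= expr0n /= addr0 sqrtr_sqr. Qed.

Lemma hnormZr (R : realType) (V : normedModType R[i]) (t : R) (x : V) :
  hnorm (t%:C *: x) = `|t| * hnorm x.
Proof. by rewrite hnormZ hnormC. Qed.

Section cauchy_schwarz.
Context {R : realType} {H : hilbertType R}.
Implicit Types (x y z : H) (a b : R[i]).

Lemma rdot_le x y : rdot x y <= hnorm x * hnorm y.
Proof.
apply: le_trans (ler_norm _) _.
rewrite -(@ler_pXn2r _ 2) ?nnegrE ?mulr_ge0 ?hnorm_ge0// exprMn real_normK ?num_real//.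
rewrite !hnorm_sqr; apply: discr_le0 => [|t]; first exact: rdot_ge0.
have := rdot_ge0 (x + t%:C *: y).
rewrite rdotDl !rdotDr !rdotZl !rdotZr (rdotC y x) => /le_trans; apply.
by rewrite le_eqVlt; apply/orP; left; apply/eqP; ring.
Qed.

Lemma rdot_norm_le x y : `|rdot x y| <= hnorm x * hnorm y.
Proof.
rewrite ler_norml rdot_le andbT lerNl.
by have := rdot_le (- x) y; rewrite rdotNl hnormN.
Qed.

Lemma hdot_le x y : hnorm (hdot x y : R[i]^o) <= hnorm x * hnorm y.
Proof.
set z := hdot x y.
(* Rotating [x] by the phase of the inner product makes the latter real. *)
have zE : rdot (z^* *: x) y = hnorm (z : R[i]^o) ^+ 2.
  rewrite /rdot dotZl -/z; case: (z) => u v; rewrite /hnorm /= sqr_sqrtr ?addr_ge0 ?sqr_ge0//.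
  by ring.
have := rdot_le (z^* *: x) y; rewrite zE hnormZ hnorm_conj.
have [->|z0] := eqVneq (hnorm (z : R[i]^o)) 0; first by rewrite mulr_ge0 ?hnorm_ge0.
have zp : 0 < hnorm (z : R[i]^o) by rewrite lt_neqAle eq_sym z0 hnorm_ge0.
by rewrite -mulrA expr2 ler_pM2l.
Qed.

Lemma hnorm_eq0 x : (hnorm x == 0) = (x == 0).
Proof. by apply/eqP/eqP => [/hnorm0_eq0|->]; rewrite ?hnorm0. Qed.

Lemma hnorm_gt0 x : (0 < hnorm x) = (x != 0).
Proof. by rewrite lt_neqAle hnorm_ge0 andbT eq_sym hnorm_eq0. Qed.

(** All limits below are obtained from this form of completeness: the sets [P d],
shrinking with the real number [d], generate a Cauchy filter. Orthogonal
projections, extensions by continuity and monotone limits of operators differ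
only in the choice of [P]. *)
Lemma shrinking_limit (P : R -> set H) :
  (forall d, 0 < d -> P d !=set0) ->
  (forall d d' x, d <= d' -> P d x -> P d' x) ->
  (forall e, 0 < e -> exists2 d, 0 < d & forall x y, P d x -> P d y -> hnorm (x - y) <= e) ->
  exists l, forall e, 0 < e -> exists2 d, 0 < d & forall x, P d x -> hnorm (l - x) <= e.
Proof.
move=> P0 Pm Pc.
pose F : set_system H := [set X | exists2 d, 0 < d & P d `<=` X].
have FF : ProperFilter F.
  split; first by case=> d d0 sP; have [x /sP] := P0 _ d0.
  split.
  - by exists 1.
  - move=> X Y [d d0 dX] [d' d'0 dY]; exists (Num.min d d'); first by rewrite lt_min d0.
    move=> x Px; split; [apply: dX|apply: dY]; apply: Pm Px.
      by rewrite ge_min lexx.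
    by rewrite ge_min lexx orbT.
  - by move=> X Y XY [d d0 dX]; exists d => // x /dX/XY.
have Fc : cauchy F.
  apply/cauchyP => e e0.
  have eE : e = (complex.Re e)%:C.
    by rewrite [LHS]complexE (ger0_Im (ltW e0)) rmorph0 mulr0 addr0.
  have e1 : 0 < complex.Re e by rewrite -ltcR -eE.
  have [d d0 dP] : exists2 d, 0 < d &
      forall x y, P d x -> P d y -> hnorm (x - y) <= complex.Re e / 2.
    by apply: Pc; rewrite divr_gt0.
  have [x Px] := P0 _ d0; exists x, d => // y Py.
  rewrite -ball_normE /= normE eE ltcR; apply: le_lt_trans (dP _ _ Px Py) _.
  by rewrite ltr_pdivrMr// ltr_pMr// ltr1n.
have Fl : F --> lim F by apply: cauchy_cvg.
exists (lim F) => e e0.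
have e20 : 0 < e / 2 by rewrite divr_gt0.
have [d d0 dP] := Pc _ e20; exists d => // x Px.
have /hcvgP/(_ _ e20)[d' d'0 d'P] : (id : H -> H) @ F --> lim F by exact: Fl.
pose m := Num.min d d'.
have m0 : 0 < m by rewrite lt_min d0.
have [y Py] := P0 _ m0.
have -> : lim F - x = (lim F - y) + (y - x) by rewrite addrA subrK.
apply: le_trans (ler_hnormD _ _) _; rewrite [leRHS]splitr lerD//.
  by apply: ltW; apply: d'P; apply: Pm Py; rewrite ge_min lexx orbT.
by apply: dP => //; apply: Pm Py; rewrite ge_min lexx.
Qed.

End cauchy_schwarz.

Lemma le_sqr_hnorm (R : realType) (H H' : hilbertType R) (x : H) (y : H') :
  rdot x x <= rdot y y -> hnorm x <= hnorm y.
Proof. by rewrite -!hnorm_sqr ler_pXn2r ?nnegrE ?hnorm_ge0. Qed.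

(** * Bounded operators *)

Section linear_maps.
Context {R : realType} {V W : lmodType R[i]} (T : V -> W).
Hypothesis lT : linear T.
Implicit Types (a : R[i]) (x y : V).

Lemma linP a x y : T (a *: x + y) = a *: T x + T y. Proof. exact: lT. Qed.
Lemma linD x y : T (x + y) = T x + T y.
Proof. by have := linP 1 x y; rewrite !scale1r. Qed.
Lemma lin0 : T 0 = 0.
Proof. by have := linP (-1) 0 0; rewrite scaler0 addr0 scaleN1r addNr. Qed.
Lemma linZ a x : T (a *: x) = a *: T x.
Proof. by rewrite -[a *: x]addr0 linP lin0 addr0. Qed.
Lemma linN x : T (- x) = - T x.
Proof. by rewrite -scaleN1r linZ scaleN1r. Qed.
Lemma linB x y : T (x - y) = T x - T y.
Proof. by rewrite linD linN. Qed.
Lemma lin_sum (J : Type) (r : seq J) (f : J -> V) :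
  T (\sum_(j <- r) f j) = \sum_(j <- r) T (f j).
Proof. exact: (big_morph T linD lin0). Qed.

End linear_maps.

Section bounded_operators.
Context {R : realType}.
Implicit Types H K L : hilbertType R.

Lemma opDE H K (S T : H -> K) x : (S + T) x = S x + T x. Proof. by []. Qed.
Lemma opZE H K (a : R[i]) (T : H -> K) x : (a *: T) x = a *: T x. Proof. by []. Qed.
Lemma opNE H K (T : H -> K) x : (- T) x = - T x. Proof. by []. Qed.
Lemma op0E H K x : (0 : H -> K) x = 0. Proof. by []. Qed.
Definition opE := (opDE, opZE, opNE, op0E).

Lemma bounded_opsP H K (T : H -> K) : bounded_ops T <->
  linear T /\ exists2 C : R, 0 < C & forall x, hnorm (T x) <= C * hnorm x.
Proof.
split=> [[lT cT]|[lT [C C0 TC]]]; split=> //.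
  have /hcvgP/(_ 1 ltr01) := cT 0.
  rewrite (lin0 lT) => /nbhs_ballP[d /= d0 dP].
  have dE : d = (complex.Re d)%:C.
    by rewrite [LHS]complexE (ger0_Im (ltW d0)) rmorph0 mulr0 addr0.
  set r := complex.Re d in dE; have r0 : 0 < r by rewrite -ltcR -dE.
  exists (2 / r); first by rewrite divr_gt0.
  move=> x; have [->|x0] := eqVneq x 0; first by rewrite (lin0 lT) !hnorm0 mulr0.
  have n0 : 0 < hnorm x by rewrite hnorm_gt0.
  pose t : R := r / (2 * hnorm x).
  have t0 : 0 < t by rewrite divr_gt0// mulr_gt0.
  have : hnorm (0 - T (t%:C *: x)) < 1.
    apply: dP; rewrite -ball_normE /= sub0r normrN normE dE ltcR hnormZr gtr0_norm//.
    have -> : t * hnorm x = r / 2 by rewrite /t; field; rewrite gt_eqF.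
    by rewrite ltr_pdivrMr// ltr_pMr// ltr1n.
  rewrite sub0r hnormN (linZ lT) hnormZr gtr0_norm// mulrC -ltr_pdivlMr//.
  move=> /ltW/le_trans; apply; rewrite /t.
  by rewrite le_eqVlt; apply/orP; left; apply/eqP; field; rewrite !gt_eqF.
move=> x; apply/hcvgP => e e0; apply/nbhs_ballP.
exists (e / C)%:C; first by rewrite /= ltcR divr_gt0.
move=> y; rewrite -ball_normE /= normE ltcR ltr_pdivlMr// mulrC => h.
by rewrite -(linB lT); apply: le_lt_trans (TC _) h.
Qed.

Lemma bop_lin H K (T : H -> K) : bounded_ops T -> linear T.
Proof. by case. Qed.

Lemma bopW H K (T : H -> K) (C : R) : linear T ->
  (forall x, hnorm (T x) <= C * hnorm x) -> bounded_ops T.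
Proof.
move=> lT TC; apply/bounded_opsP; split=> //; exists (Num.max C 1).
  by rewrite lt_max ltr01 orbT.
by move=> x; apply: le_trans (TC x) _; rewrite ler_wpM2r ?hnorm_ge0// le_max lexx.
Qed.

Lemma bop_comp H K L (S : K -> L) (T : H -> K) :
  bounded_ops S -> bounded_ops T -> bounded_ops (S \o T).
Proof.
move=> /bounded_opsP[lS [C C0 SC]] /bounded_opsP[lT [D D0 TD]].
apply: (@bopW _ _ _ (C * D)) => [a x y|x] /=; first by rewrite (linP lT) (linP lS).
by apply: le_trans (SC _) _; rewrite -mulrA ler_pM2l.
Qed.

Lemma bop_lincomb H K (a : R[i]) (S T : H -> K) :
  bounded_ops S -> bounded_ops T -> bounded_ops (a *: S + T).
Proof.
move=> /bounded_opsP[lS [C C0 SC]] /bounded_opsP[lT [D D0 TD]].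
apply: (@bopW _ _ _ (hnorm (a : R[i]^o) * C + D)) => [b x y|x].
  rewrite !opE (linP lT) (linP lS) !scalerDr !scalerA.
  by rewrite (mulrC a b) addrACA.
rewrite !opE; apply: le_trans (ler_hnormD _ _) _; rewrite hnormZ mulrDl lerD//.
by rewrite -mulrA ler_wpM2l ?hnorm_ge0.
Qed.

Lemma bop0 H K : bounded_ops (0 : H -> K).
Proof.
apply: (@bopW _ _ _ 0) => [a x y|x]; first by rewrite !opE scaler0 addr0.
by rewrite !opE hnorm0 mul0r.
Qed.

Lemma bop_id H : bounded_ops (@id H).
Proof. by apply: (@bopW _ _ _ 1) => [a x y|x] //; rewrite mul1r. Qed.

Lemma bopD H K (S T : H -> K) : bounded_ops S -> bounded_ops T -> bounded_ops (S + T).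
Proof. by move=> hS hT; rewrite -[S]scale1r; exact: bop_lincomb. Qed.

Lemma bopZ H K (a : R[i]) (T : H -> K) : bounded_ops T -> bounded_ops (a *: T).
Proof. by move=> hT; rewrite -[_ *: _]addr0; apply: bop_lincomb => //; exact: bop0. Qed.

Lemma bopN H K (T : H -> K) : bounded_ops T -> bounded_ops (- T).
Proof. by move=> hT; rewrite -scaleN1r; exact: bopZ. Qed.

Lemma bopB H K (S T : H -> K) : bounded_ops S -> bounded_ops T -> bounded_ops (S - T).
Proof. by move=> hS hT; apply: bopD => //; exact: bopN. Qed.

End bounded_operators.

(** * Orthogonal projections *)

Section projection.
Context {R : realType} {H : hilbertType R}.
Implicit Types (D : set H) (x y z p : H).

Definition subsp D := D 0 /\ forall (a : R[i]) x y, D x -> D y -> D (a *: x + y).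

(** The norm closure of [D], spelled out so that it combines directly with norm
estimates. *)
Definition nearby D x := forall e : R, 0 < e -> exists2 d, D d & hnorm (x - d) <= e.

Lemma nearby_mem D x : D x -> nearby D x.
Proof. by move=> Dx e e0; exists x => //; rewrite subrr hnorm0 ltW. Qed.

Lemma hdot_eq0P x y : (forall a : R[i], rdot x (a *: y) = 0) -> hdot x y = 0.
Proof.
move=> h; apply: hdot_eq0C; rewrite -[RHS](dot0r y); apply: hdot_eq_rdot => a.
by rewrite rdotC h rdot0r.
Qed.

Lemma orth_nearby D z p : (forall d, D d -> hdot z d = 0) -> nearby D p -> hdot z p = 0.
Proof.
move=> zD Dp; have /(@hnorm_small_eq0 _ _ (hdot z p : R[i]^o)) -> // :
  forall e, 0 < e -> hnorm (hdot z p : R[i]^o) <= hnorm z * e.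
move=> e /Dp[d Dd pd]; rewrite -(subrK d p) dotDr (zD d)// addr0.
by apply: le_trans (hdot_le _ _) _; rewrite ler_wpM2l ?hnorm_ge0.
Qed.

Lemma nearby_lin D (a : R[i]) x y : subsp D -> nearby D x -> nearby D y ->
  nearby D (a *: x + y).
Proof.
move=> [D0 Da] Dx Dy e e0; pose c := hnorm (a : R[i]^o) + 1.
have c0 : 0 < c by rewrite ltr_wpDl// hnorm_ge0.
have [d Dd xd] := Dx (e / (2 * c)) (divr_gt0 e0 (mulr_gt0 (ltr0n _ 2) c0)).
have [f Df yf] := Dy (e / 2) (divr_gt0 e0 (ltr0n _ 2)).
exists (a *: d + f); first exact: Da.
rewrite opprD addrACA -scalerBr; apply: le_trans (ler_hnormD _ _) _.
rewrite [leRHS]splitr lerD// hnormZ.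
apply: (@le_trans _ _ (c * (e / (2 * c)))).
  by rewrite ler_pM ?hnorm_ge0// lerDl ler01.
by rewrite le_eqVlt; apply/orP; left; apply/eqP; field; rewrite gt_eqF.
Qed.

(** The parallelogram law makes the points of [D] that nearly minimise the distance
to [x] a Cauchy family. Such a point [f] already satisfies
<x - f, d>^2 <= t |d|^2, where [t] measures how far it is from minimising, so
orthogonality holds in the limit. *)
Lemma projection_exists D x : subsp D ->
  exists p, nearby D p /\ forall d, D d -> hdot (x - p) d = 0.
Proof.
move=> [D0 Da]; pose q d : R := rdot (x - d) (x - d).
have DZ (a : R[i]) d : D d -> D (a *: d) by move=> Dd; rewrite -[_ *: _]addr0; exact: Da.
have DD d d' : D d -> D d' -> D (d + d') by move=> Dd Dd'; rewrite -[d]scale1r; exact: Da.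
pose Q := [set q d | d in D]; pose m := inf Q.
have Qinf : has_inf Q.
  split; first by exists (q 0), 0.
  by exists 0 => _ [d _ <-]; exact: rdot_ge0.
have mq d : D d -> m <= q d.
  move=> Dd; have [_ lb] := Qinf; exact: (ge_inf lb) (ex_intro2 _ _ d Dd erefl).
pose P (t : R) : set H := [set d | D d /\ q d <= m + t].
have [|||p pP] := @shrinking_limit _ _ P.
- move=> t t0; have [_ [d Dd <-] dt] := inf_adherent t0 Qinf.
  by exists d; split=> //; exact: ltW.
- by move=> t t' d tt' [Dd dt]; split=> //; apply: le_trans dt _; rewrite lerD2l.
- move=> e e0; exists (e ^+ 2 / 4); first by rewrite divr_gt0// exprn_gt0.
  move=> d d' [Dd qd] [Dd' qd'].
  have Dm : D ((2^-1 : R)%:C *: (d + d')) by apply/DZ/DD.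
  have := mq _ Dm; have : rdot (d - d') (d - d') =
      2 * q d + 2 * q d' - 4 * q ((2^-1 : R)%:C *: (d + d')).
    rewrite /q !(rdotBl, rdotBr, rdotZl, rdotZr, rdotDl, rdotDr).
    by rewrite !(rdotC d' d) !(rdotC d x) !(rdotC d' x); field.
  move=> E mD; rewrite -(@ler_pXn2r _ 2) ?nnegrE ?hnorm_ge0 ?(ltW e0)// hnorm_sqr E.
  by move: qd qd' mD; set A := e ^+ 2; set B := q d; set C := q d'; set F := q _; lra.
exists p; split.
  move=> e /pP[t t0 tP].
  have [_ [d Dd <-] dt] := inf_adherent t0 Qinf.
  by exists d => //; apply: tP; split=> //; exact: ltW.
have orth d : D d -> rdot (x - p) d = 0.
  move=> Dd; apply: (@eq0_small _ _ (2 * hnorm d)) => e e0.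
  have [t t0 tP] := pP _ e0; pose s := Num.min t (e ^+ 2).
  have s0 : 0 < s by rewrite lt_min t0 exprn_gt0.
  have [_ [f Df <-] ft] := inf_adherent s0 Qinf.
  have pf : hnorm (p - f) <= e.
    by apply: tP; split=> //; apply: le_trans (ltW ft) _; rewrite lerD2l ge_min lexx.
  have : rdot (x - f) d ^+ 2 <= s * rdot d d.
    apply: discr_le0 => [|u]; first exact: rdot_ge0.
    have := mq _ (Da (- u%:C) _ _ Dd Df); rewrite /q.
    have -> : rdot (x - (- u%:C *: d + f)) (x - (- u%:C *: d + f)) =
       q f + 2 * u * rdot (x - f) d + u ^+ 2 * rdot d d.
      rewrite -rmorphN /q !(rdotBl, rdotBr, rdotDl, rdotDr, rdotZl, rdotZr).
      by rewrite !(rdotC d f) !(rdotC d x) !(rdotC f x); ring.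
    move: ft; rewrite -/m; set A := q f; set B := 2 * u * _; set C := u ^+ 2 * _; lra.
  move=> /le_trans/(_ (ler_wpM2r (rdot_ge0 d) (_ : s <= e ^+ 2))).
  rewrite ge_min lexx orbT => /(_ isT); rewrite -hnorm_sqr -exprMn -real_normK ?num_real//.
  rewrite ler_pXn2r ?nnegrE ?mulr_ge0 ?hnorm_ge0 ?(ltW e0)// => h.
  have -> : x - p = (x - f) - (p - f) by rewrite opprB addrA subrK.
  rewrite rdotBl; apply: le_trans (ler_normB _ _) _.
  have : `|rdot (p - f) d| <= e * hnorm d.
    by apply: le_trans (rdot_norm_le _ _) _; rewrite ler_wpM2r ?hnorm_ge0.
  by move: h; rewrite -mulrA (mulrC (hnorm d)); set X := e * hnorm d; lra.
by move=> d Dd; apply: hdot_eq0P => a; exact/orth/DZ.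
Qed.

Definition proj D x : H :=
  xget 0 [set p | nearby D p /\ forall d, D d -> hdot (x - p) d = 0].

Section fixed_subspace.
Context {D : set H} (sD : subsp D).

Lemma projP x : nearby D (proj D x) /\ forall d, D d -> hdot (x - proj D x) d = 0.
Proof.
rewrite /proj; case: xgetP => [p -> //|h].
by have [p pP] := projection_exists x sD; have := h p.
Qed.

Lemma proj_nearby x : nearby D (proj D x). Proof. exact: (projP x).1. Qed.

Lemma proj_orth x p : nearby D p -> hdot (x - proj D x) p = 0.
Proof. by apply: orth_nearby; exact: (projP x).2. Qed.

Lemma proj_uniq x p : nearby D p -> (forall d, D d -> hdot (x - p) d = 0) -> proj D x = p.
Proof.
move=> Dp xp; apply/eqP; rewrite -subr_eq0; apply/eqP/rdot_eq0.
have Dw : nearby D (proj D x - p).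
  by rewrite addrC -scaleN1r; apply: nearby_lin => //; exact: proj_nearby.
rewrite /rdot -[X in hdot X _](_ : (x - p) - (x - proj D x) = _); last first.
  by rewrite opprB addrC addrA subrK.
by rewrite dotBl proj_orth// (orth_nearby xp)// subrr.
Qed.

Lemma proj_id p : nearby D p -> proj D p = p.
Proof. by move=> Dp; apply: proj_uniq => // d _; rewrite subrr dot0l. Qed.

Lemma proj_idem x : proj D (proj D x) = proj D x.
Proof. exact/proj_id/proj_nearby. Qed.

Lemma proj_lin : linear (proj D).
Proof.
move=> a x y; apply: proj_uniq.
  by apply: nearby_lin => //; exact: proj_nearby.
move=> d Dd; rewrite opprD addrACA -scalerBr dotDl dotZl !proj_orth ?mulr0 ?addr0//;
by exact: nearby_mem.
Qed.

Lemma proj_sa : is_adjoint (proj D) (proj D).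
Proof.
move=> x y; have := proj_orth x (proj_nearby y); have := proj_orth y (proj_nearby x).
rewrite !dotBl => /eqP; rewrite subr_eq0 => /eqP h /eqP; rewrite subr_eq0 => /eqP ->.
by rewrite (hdotC y) h -hdotC.
Qed.

Lemma proj_le x : hnorm (proj D x) <= 1 * hnorm x.
Proof.
have [->|p0] := eqVneq (proj D x) 0; first by rewrite hnorm0 mul1r hnorm_ge0.
have n0 : 0 < hnorm (proj D x) by rewrite hnorm_gt0.
rewrite mul1r -(@ler_pM2r _ (hnorm (proj D x)))// -expr2 hnorm_sqr.
rewrite /rdot proj_sa proj_idem; exact: rdot_le.
Qed.

Lemma proj_bop : bounded_ops (proj D).
Proof. exact: bopW proj_lin proj_le. Qed.

(** Both the image T(Px) and the orthogonality of T(x - Px) are controlled as soon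
as [D] is invariant under the operator and its adjoint, so T(Px) is the
projection of T(x) by uniqueness. *)
Lemma proj_comm (T T' : H -> H) : bounded_ops T -> is_adjoint T T' ->
  (forall d, D d -> D (T d)) -> (forall d, D d -> D (T' d)) ->
  forall x, proj D (T x) = T (proj D x).
Proof.
move=> /bounded_opsP[lT [C C0 TC]] TT' DT DT' x; apply: proj_uniq.
  move=> e e0; have [d Dd xd] := proj_nearby x (divr_gt0 e0 C0).
  exists (T d); first exact: DT.
  by rewrite -(linB lT); apply: le_trans (TC _) _; rewrite mulrC -ler_pdivlMr.
by move=> d Dd; rewrite -(linB lT) TT' proj_orth//; exact/nearby_mem/DT'.
Qed.

End fixed_subspace.
End projection.

(** * Adjoints *)

Section adjoints.
Context {R : realType}.
Implicit Types H K L : hilbertType R.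

(** The representing vector is a multiple of the component [w] of some [x0],
outside the kernel, that is orthogonal to the kernel: each x - (f x / f w) w lies
in the kernel, hence is orthogonal to [w]. *)
Lemma riesz H (f : H -> R[i]) (C : R) :
  (forall (a : R[i]) x y, f (a *: x + y) = a * f x + f y) ->
  (forall x, hnorm (f x : R[i]^o) <= C * hnorm x) -> exists z, forall x, f x = hdot x z.
Proof.
move=> lf fC; have [f0|] := pselect (forall x, f x = 0).
  by exists 0 => x; rewrite f0 dot0r.
move=> /existsNP[x0 /eqP fx0].
have lf' : linear (f : H -> R[i]^o) by move=> a x y; rewrite lf.
pose D : set H := [set x | f x = 0].
have sD : subsp D.
  split; first exact: (lin0 lf').
  by move=> a x y Dx Dy; rewrite /D /= lf Dx Dy mulr0 addr0.
pose w := x0 - proj D x0.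
have fp : f (proj D x0) = 0.
  apply: (@hnorm_small_eq0 _ _ (f (proj D x0) : R[i]^o) (Num.max C 0)) => e e0.
  have [d Dd xd] := proj_nearby sD x0 e0.
  have -> : f (proj D x0) = f (proj D x0 - d).
    have -> : f (proj D x0 - d) = f (proj D x0) - f d := linB lf' _ _.
    by rewrite Dd subr0.
  apply: le_trans (fC _) _.
  apply: (@le_trans _ _ (Num.max C 0 * hnorm (proj D x0 - d))).
    by rewrite ler_wpM2r ?hnorm_ge0// le_max lexx.
  by rewrite ler_wpM2l// le_max lexx orbT.
have fw : f w = f x0.
  by have := linB lf' x0 (proj D x0) : f w = f x0 - f (proj D x0); rewrite fp subr0.
have w0 : hdot w w != 0.
  apply/eqP => ww; have w0 : w = 0 by apply: rdot_eq0; rewrite /rdot ww.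
  by move: fx0; rewrite -fw w0 (lin0 lf' : f 0 = 0) eqxx.
have fw0 : f w != 0 by rewrite fw.
exists (conjc (f w / hdot w w) *: w) => x; rewrite dotZr (conjcK (f w / hdot w w)).
have Dx : D (x - (f x / f w) *: w).
  rewrite /D /= (linB lf' _ _ : f _ = _ - _) (linZ lf' _ _ : f (_ *: w) = _ * f w).
  by rewrite divfK// subrr.
have := proj_orth sD x0 (nearby_mem Dx); rewrite -/w => /hdot_eq0C.
rewrite dotBl dotZl => /eqP; rewrite subr_eq0 => /eqP ->.
by field; rewrite w0 fw0.
Qed.

Definition adj H K (T : H -> K) (y : K) : H :=
  xget 0 [set z | forall x, hdot (T x) y = hdot x z].

Lemma adjP H K (T : H -> K) : bounded_ops T -> is_adjoint T (adj T).
Proof.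
move=> /bounded_opsP[lT [C C0 TC]] x y; rewrite /adj; case: xgetP => [z -> h|]; first exact: h.
have [|x'|z zP] := @riesz _ (fun x => hdot (T x) y) (C * hnorm y).
- by move=> a u v; rewrite (linP lT) dotDl dotZl.
- apply: le_trans (hdot_le _ _) _; rewrite mulrAC ler_wpM2r ?hnorm_ge0//.
by move=> /(_ z) [].
Qed.

Lemma adj_sym H K (S : H -> K) T : is_adjoint S T -> is_adjoint T S.
Proof. by move=> ST x y; rewrite hdotC -ST -hdotC. Qed.

Lemma adj_uniq H K (S : H -> K) T T' : is_adjoint S T -> is_adjoint S T' -> T = T'.
Proof. by move=> h h'; apply/funext => y; apply: dot_injr => z; rewrite -h h'. Qed.

Lemma adj_comp H K L (S : H -> K) S' (T : K -> L) T' :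
  is_adjoint S S' -> is_adjoint T T' -> is_adjoint (T \o S) (S' \o T').
Proof. by move=> hS hT x y /=; rewrite hT hS. Qed.

Lemma is_adjoint_bound H K (S : H -> K) T (C : R) : 0 <= C -> is_adjoint S T ->
  (forall x, hnorm (S x) <= C * hnorm x) -> forall y, hnorm (T y) <= C * hnorm y.
Proof.
move=> C0 ST SC y; have [->|T0] := eqVneq (T y) 0.
  by rewrite hnorm0 mulr_ge0 ?hnorm_ge0.
have n0 : 0 < hnorm (T y) by rewrite hnorm_gt0.
rewrite -(@ler_pM2r _ (hnorm (T y)))// -expr2 hnorm_sqr /rdot -ST.
apply: le_trans (rdot_le _ _) _.
by rewrite mulrAC ler_wpM2r ?hnorm_ge0.
Qed.

Lemma is_adjoint_lin H K (S : H -> K) T : is_adjoint S T -> linear T.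
Proof.
move=> ST a x y; apply: dot_injr => z.
by rewrite -ST dotDr !dotZr dotDr dotZr !ST.
Qed.

Lemma is_adjoint_bop H K (S : H -> K) T : bounded_ops S -> is_adjoint S T -> bounded_ops T.
Proof.
move=> /bounded_opsP[lS [C C0 SC]] ST.
exact: bopW (is_adjoint_lin ST) (is_adjoint_bound (ltW C0) ST SC).
Qed.

Lemma adj_bop H K (T : H -> K) : bounded_ops T -> bounded_ops (adj T).
Proof. by move=> bT; exact: is_adjoint_bop (adjP bT). Qed.

End adjoints.

(** * Positive operators, monotone limits and square roots *)

Section positive_operators.
Context {R : realType} {H : hilbertType R}.
Implicit Types (a b c q x y T : H -> H) (u v w : H).

Definition ople a b := forall v, rdot (a v) v <= rdot (b v) v.

(** The normalisation 0 <= a <= 1 keeps constants out of all estimates; a general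
positive operator is reduced to it by scaling. *)
Record effect a : Prop := Effect {
  effect_lin : linear a;
  effect_sa : is_adjoint a a;
  effect_ge0 : forall v, 0 <= rdot (a v) v;
  effect_le1 : forall v, rdot (a v) v <= rdot v v }.

Lemma pos_form_le a : linear a -> is_adjoint a a -> (forall v, 0 <= rdot (a v) v) ->
  forall u v, rdot (a u) v ^+ 2 <= rdot (a u) u * rdot (a v) v.
Proof.
move=> la sa a0 u v; apply: discr_le0 => // t; have := a0 (u + t%:C *: v).
rewrite (linD la) (linZ la) !(rdotDl, rdotDr, rdotZl, rdotZr).
have -> : rdot (a v) u = rdot (a u) v by rewrite /rdot sa -/(rdot v (a u)) rdotC.
by move=> /le_trans; apply; rewrite le_eqVlt; apply/orP; left; apply/eqP; ring.
Qed.

(** This is a^2 <= a: apply the Cauchy-Schwarz inequality for the form of [a] to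
the vectors [v] and [a v]. It turns convergence of the quadratic forms into
convergence in norm. *)
Lemma effect_sqr a v : effect a -> rdot (a v) (a v) <= rdot (a v) v.
Proof.
move=> [la sa a0 a1]; have := pos_form_le la sa a0 v (a v).
move=> /le_trans/(_ (ler_wpM2l (a0 v) (a1 (a v)))).
have [->|n0] := eqVneq (rdot (a v) (a v)) 0; first by rewrite a0.
have n1 : 0 < rdot (a v) (a v) by rewrite lt_neqAle eq_sym n0 rdot_ge0.
by rewrite expr2 ler_pM2r.
Qed.

Lemma effect_norm a v : effect a -> hnorm (a v) <= hnorm v.
Proof. by move=> ea; apply: le_sqr_hnorm; apply: le_trans (effect_sqr v ea) (effect_le1 ea v). Qed.

Lemma effect_bop a : effect a -> bounded_ops a.
Proof.
move=> ea; apply: (@bopW _ _ _ _ 1 (effect_lin ea)) => v.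
by rewrite mul1r; exact: effect_norm.
Qed.

Lemma is_adjointB a b : is_adjoint a a -> is_adjoint b b -> is_adjoint (a - b) (a - b).
Proof. by move=> sa sb x y; rewrite !opE dotBl dotBr sa sb. Qed.

Lemma linearB a b : linear a -> linear b -> linear (a - b).
Proof.
move=> la lb t x y; rewrite !opE (linP la) (linP lb) scalerBr.
by rewrite opprD addrACA.
Qed.

Lemma effectB a b : effect a -> effect b -> ople a b -> effect (b - a).
Proof.
move=> [la sa a0 a1] [lb sb b0 b1] ab; split.
- exact: linearB.
- exact: is_adjointB.
- by move=> v; rewrite !opE rdotBl subr_ge0.
- by move=> v; rewrite !opE rdotBl; have := b1 v; have := a0 v; lra.
Qed.

Lemma effect_id : effect id.
Proof. by split=> // v; exact: rdot_ge0. Qed.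

Lemma effect_eq0 a : effect a -> (forall v, rdot (a v) v <= 0) -> forall v, a v = 0.
Proof.
move=> ea h v; apply: rdot_eq0; apply/eqP; rewrite eq_le rdot_ge0 andbT.
exact: le_trans (effect_sqr v ea) (h v).
Qed.

Lemma ople_anti a b : effect a -> effect b -> ople a b -> ople b a -> a = b.
Proof.
move=> ea eb ab ba; apply/funext => v; apply/eqP; rewrite eq_sym -subr_eq0; apply/eqP.
apply: (effect_eq0 (effectB ea eb ab)) => w.
by rewrite !opE rdotBl subr_le0.
Qed.

Lemma le_small (r s C : R) : (forall e, 0 < e -> r <= s + C * e) -> r <= s.
Proof.
move=> h; have C0 : 0 < Num.max C 1 by rewrite lt_max ltr01 orbT.
apply/ler_addgt0Pr => e e0; have := h (e / Num.max C 1) (divr_gt0 e0 C0).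
move=> /le_trans; apply; rewrite lerD2l mulrCA ler_piMr ?(ltW e0)//.
by rewrite ler_pdivrMr// mul1r le_max lexx.
Qed.

Section monotone_limit.
Variable C : set (H -> H).
Hypotheses (C0 : C !=set0) (Ce : forall a, C a -> effect a).
Hypothesis (Ct : forall a b, C a -> C b -> ople a b \/ ople b a).

(** Strong convergence along the chain. *)
Definition chain_limit q := forall u e, 0 < e ->
  exists2 c, C c & forall c', C c' -> ople c c' -> hnorm (q u - c' u) <= e.

Let chain_cauchy u : exists l, forall e, 0 < e ->
  exists2 c, C c & forall c', C c' -> ople c c' -> hnorm (l - c' u) <= e.
Proof.
pose Q := [set rdot (c u) u | c in C]; pose m := sup Q.
have Qsup : has_sup Q.
  split; first by case: C0 => c Cc; exists (rdot (c u) u), c.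
  by exists (rdot u u) => _ [c Cc <-]; apply: effect_le1; exact: Ce.
have Qm c : C c -> rdot (c u) u <= m.
  by move=> Cc; apply: sup_upper_bound => //; exists c.
pose P (d : R) : set H := [set w | exists2 c, C c & c u = w /\ m - d <= rdot (c u) u].
have [|||l lP] := @shrinking_limit _ _ P.
- move=> d d0; have [_ [c Cc <-] cd] := sup_adherent d0 Qsup.
  by exists (c u), c => //; split=> //; exact: ltW.
- move=> d d' w dd' [c Cc [cw cd]]; exists c => //; split=> //.
  by apply: le_trans cd; rewrite lerD2l lerN2.
- move=> e e0; exists (e ^+ 2) => [|w w']; first by rewrite exprn_gt0.
  have key c c' : C c -> C c' -> ople c c' -> m - e ^+ 2 <= rdot (c u) u ->
      hnorm (c' u - c u) <= e.
    move=> Cc Cc' cc' mc; rewrite -(@ler_pXn2r _ 2) ?nnegrE ?hnorm_ge0 ?(ltW e0)//.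
    rewrite hnorm_sqr; apply: le_trans (effect_sqr u (effectB (Ce Cc) (Ce Cc') cc')) _.
    by rewrite !opE rdotBl; have := Qm _ Cc'; move: mc; set A := e ^+ 2; lra.
  move=> [c Cc [<- mc]] [c' Cc' [<- mc']]; have [cc'|cc'] := Ct Cc Cc'.
    by rewrite hnormBC; exact: key.
  exact: key.
exists l => e /lP[d d0 dP]; have [_ [c Cc <-] cd] := sup_adherent d0 Qsup.
exists c => // c' Cc' cc'; apply: dP; exists c' => //; split=> //.
exact: le_trans (ltW cd) (cc' u).
Qed.

Let lim_ex : exists q, chain_limit q.
Proof. by have [q qP] := choice chain_cauchy; exists q => u; exact: qP. Qed.

Lemma chain_limit2 q u v e : chain_limit q -> 0 < e -> exists2 c, C c &
  forall c', C c' -> ople c c' -> hnorm (q u - c' u) <= e /\ hnorm (q v - c' v) <= e.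
Proof.
move=> qP e0; have [c Cc cP] := qP u e e0; have [d Cd dP] := qP v e e0.
have tr a b a' : ople a b -> ople b a' -> ople a a'.
  by move=> ab ba' w; apply: le_trans (ab w) (ba' w).
have [cd|dc] := Ct Cc Cd.
  by exists d => // c' Cc' dc'; split; [apply: cP => //; exact: tr dc'|exact: dP].
by exists c => // c' Cc' cc'; split; [exact: cP|apply: dP => //; exact: tr cc'].
Qed.

Let ople_refl a : ople a a. Proof. by move=> v. Qed.

Lemma chain_limit_lin q : chain_limit q -> linear q.
Proof.
move=> qP t x y; apply/eqP; rewrite -subr_eq0; apply/eqP.
apply: (@hnorm_small_eq0 _ _ _ (2 + hnorm (t : R[i]^o))) => e e0.
have [c Cc cP] := chain_limit2 x y qP e0.
have [d Cd dP] := qP (t *: x + y) e e0.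
have [b Cb [cb db]] : exists2 b, C b & ople c b /\ ople d b.
  by have [h|h] := Ct Cc Cd; [exists d|exists c].
have [h1 h2] := cP b Cb cb; have h3 := dP b Cb db.
have lb := effect_lin (Ce Cb).
have -> : q (t *: x + y) - (t *: q x + q y) =
   (q (t *: x + y) - b (t *: x + y)) - (t *: (q x - b x) + (q y - b y)).
  rewrite (linP lb) scalerBr addrACA -opprD !opprB.
  by rewrite addrA subrK.
apply: le_trans (ler_hnormB_le _ _) _.
apply: (@le_trans _ _ (e + (hnorm (t : R[i]^o) * e + e))).
  apply: lerD => //; apply: le_trans (ler_hnormD _ _) _; apply: lerD => //.
  by rewrite hnormZ ler_wpM2l ?hnorm_ge0.
by rewrite le_eqVlt; apply/orP; left; apply/eqP; ring.
Qed.

Lemma chain_limit_sa q : chain_limit q -> is_adjoint q q.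
Proof.
move=> qP x y; apply/eqP; rewrite -subr_eq0; apply/eqP.
apply: (@hnorm_small_eq0 _ _ (hdot (q x) y - hdot x (q y) : R[i]^o) (hnorm x + hnorm y)) => e e0.
have [c Cc cP] := chain_limit2 x y qP e0; have [h1 h2] := cP _ Cc (ople_refl c).
have -> : hdot (q x) y - hdot x (q y) = hdot (q x - c x) y - hdot x (q y - c y).
  by rewrite dotBl dotBr opprB addrA (effect_sa (Ce Cc)) subrK.
apply: le_trans (ler_hnormB_le (hdot (q x - c x) y : R[i]^o) _) _.
rewrite mulrDl addrC; apply: lerD.
  by apply: le_trans (hdot_le _ _) _; rewrite ler_wpM2l ?hnorm_ge0.
by apply: le_trans (hdot_le _ _) _; rewrite mulrC ler_wpM2l ?hnorm_ge0.
Qed.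

Lemma chain_limit_dot q u e : chain_limit q -> 0 < e ->
  exists2 c, C c & forall c', C c' -> ople c c' ->
    `|rdot (q u) u - rdot (c' u) u| <= hnorm u * e.
Proof.
move=> qP /(qP u)[c Cc cP]; exists c => // c' Cc' cc'; rewrite -rdotBl.
apply: le_trans (rdot_norm_le _ _) _; rewrite mulrC ler_wpM2l ?hnorm_ge0//.
exact: cP.
Qed.

Lemma chain_limit_ub q a : chain_limit q -> C a -> ople a q.
Proof.
move=> qP Ca u; apply: (@le_small _ _ (hnorm u)) => e e0.
have [c Cc cP] := chain_limit_dot u qP e0.
have [b Cb [ab cb]] : exists2 b, C b & ople a b /\ ople c b.
  by have [h|h] := Ct Ca Cc; [exists c|exists a].
by apply: le_trans (ab u) _; have := cP _ Cb cb; rewrite ler_norml => /andP[? _]; lra.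
Qed.

Lemma chain_limit_least q u (M : R) : chain_limit q ->
  (forall c, C c -> rdot (c u) u <= M) -> rdot (q u) u <= M.
Proof.
move=> qP CM; apply: (@le_small _ _ (hnorm u)) => e e0.
have [c Cc cP] := chain_limit_dot u qP e0.
by have := cP _ Cc (ople_refl c); have := CM _ Cc; rewrite ler_norml => ? /andP[_ ?]; lra.
Qed.

(** Vigier's theorem. For c <= c' in the chain, |(c' - c) u|^2 <= <(c' - c) u, u>,
and the right hand side is small once <c u, u> is close to its supremum. *)
Lemma chain_limit_effect : exists2 q, effect q & chain_limit q.
Proof.
have [q qP] := lim_ex; exists q => //; split.
- exact: chain_limit_lin.
- exact: chain_limit_sa.
- move=> v; case: C0 => c Cc; apply: le_trans (chain_limit_ub qP Cc v).
  exact: effect_ge0 (Ce Cc) v.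
- by move=> v; apply: chain_limit_least => // c /Ce/effect_le1.
Qed.

Lemma chain_limit_comm q T : chain_limit q -> bounded_ops T ->
  (forall c, C c -> forall v, T (c v) = c (T v)) -> forall v, T (q v) = q (T v).
Proof.
move=> qP /bounded_opsP[lT [D D0 TD]] Tc v; apply/eqP; rewrite -subr_eq0; apply/eqP.
apply: (@hnorm_small_eq0 _ _ _ (D + 1)) => e e0.
have [c Cc cP] := chain_limit2 v (T v) qP e0; have [h1 h2] := cP _ Cc (ople_refl c).
have -> : T (q v) - q (T v) = T (q v - c v) - (q (T v) - c (T v)).
  by rewrite (linB lT) (Tc _ Cc) opprB addrA subrK.
apply: le_trans (ler_hnormB_le _ _) _; rewrite mulrDl mul1r; apply: lerD => //.
by apply: le_trans (TD _) _; rewrite ler_pM2l.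
Qed.

End monotone_limit.

Section square_root.
Variable a : H -> H.
Hypothesis ea : effect a.

(** Products of commuting positive operators are positive, but this is a consequence
of the existence of square roots. For polynomials in [a] with nonnegative
coefficients positivity can be seen directly, and the Horner form makes the
closure properties immediate inductions. *)
Inductive npoly : (H -> H) -> Prop :=
| npoly0 : npoly (fun=> 0)
| npolyS (c : R) x : 0 <= c -> npoly x -> npoly (fun v => c%:C *: v + a (x v)).

Let la := effect_lin ea.

Lemma npoly_lin x : npoly x -> linear x.
Proof.
elim=> [t u v|c y c0 _ ly t u v]; first by rewrite scaler0 addr0.
rewrite (linP ly) (linP la) !scalerDr !scalerA addrACA; congr (_ *: _ + _ + _).
by rewrite mulrC.
Qed.

Lemma npoly_comm x T : npoly x -> linear T -> (forall v, T (a v) = a (T v)) ->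
  forall v, T (x v) = x (T v).
Proof.
move=> nx lT Ta; elim: nx => [v|c y _ _ yT v]; first by rewrite (lin0 lT).
by rewrite (linD lT) (linZ lT) Ta yT.
Qed.

Lemma npolyD x y : npoly x -> npoly y -> npoly (fun v => x v + y v).
Proof.
move=> nx; elim: nx y => [y ny|c x' c0 nx' ih y ny].
  by under eq_fun do rewrite add0r.
case: ny => [|d y' d0 ny'].
  by under eq_fun do rewrite addr0; exact: npolyS.
have := npolyS (addr_ge0 c0 d0) (ih _ ny').
congr npoly; apply/funext => v.
by rewrite (linD la) rmorphD scalerDl addrACA.
Qed.

Lemma npolyZ (t : R) x : 0 <= t -> npoly x -> npoly (fun v => t%:C *: x v).
Proof.
move=> t0; elim=> [|c y c0 ny ih].
  by under eq_fun do rewrite scaler0; exact: npoly0.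
have := npolyS (mulr_ge0 t0 c0) ih; congr npoly; apply/funext => v.
by rewrite rmorphM -scalerA (linZ la) scalerDr.
Qed.

Lemma npoly_comp x y : npoly x -> npoly y -> npoly (fun v => x (y v)).
Proof.
move=> nx ny; elim: nx => [|c x' c0 nx' ih]; first exact: npoly0.
have := npolyD (npolyZ c0 ny) (npolyS (lexx 0) ih); congr npoly; apply/funext => v.
by rewrite scale0r add0r.
Qed.

Lemma npoly_self : npoly a.
Proof.
have := npolyS (lexx 0) (npolyS (@ler01 R) npoly0); congr npoly; apply/funext => v.
by rewrite (lin0 la) scale0r scale1r add0r addr0.
Qed.

Lemma npoly_sa x : npoly x -> is_adjoint x x.
Proof.
elim=> [u v|c y c0 ny sy u v]; first by rewrite dot0l dot0r.
rewrite dotDl dotDr dotZl dotZr conjc_real (effect_sa ea) sy.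
by rewrite (npoly_comm ny la).
Qed.

(** The induction carries the positivity of [a x] along with that of [x]: in the
Horner form of [a x] the term <a a y u, u> equals <y (a u), a u>. *)
Lemma npoly_ge0 x v : npoly x -> 0 <= rdot (x v) v.
Proof.
move=> nx; suff: forall u, 0 <= rdot (x u) u /\ 0 <= rdot (a (x u)) u by move=> /(_ v)[].
elim: nx => [u|c y c0 ny ih u]; first by rewrite (lin0 la) rdot0l.
rewrite (linD la) (linZ la) !rdotDl !rdotZl; split.
  by rewrite addr_ge0 ?mulr_ge0 ?rdot_ge0//; have [] := ih u.
rewrite addr_ge0 ?mulr_ge0 ?(effect_ge0 ea)//.
rewrite /rdot (effect_sa ea) (npoly_comm ny la)//.
by have [] := ih (a u).
Qed.

Fixpoint root_iter n : H -> H :=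
  if n is m.+1 then fun v => (2^-1 : R)%:C *: (a v + root_iter m (root_iter m v))
  else fun=> 0.

Let half_ge0 : 0 <= 2^-1 :> R. Proof. by rewrite invr_ge0 ler0n. Qed.

Let root_iter_npoly n : npoly (root_iter n).
Proof.
elim: n => [|n ih] /=; first exact: npoly0.
exact: npolyZ half_ge0 (npolyD npoly_self (npoly_comp ih ih)).
Qed.

Let root_iter_step n :
  exists2 d, npoly d & root_iter n.+1 = (fun v => root_iter n v + d v).
Proof.
elim: n => [|n [d nd dE]].
  exists (root_iter 1); first exact: root_iter_npoly.
  by apply/funext => v; rewrite add0r.
pose b := root_iter n; have lb : linear b := npoly_lin (root_iter_npoly n).
have ld := npoly_lin nd.
exists (fun v => (2^-1 : R)%:C *: (b (d v) + (d (b v) + d (d v)))).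
  have nb := root_iter_npoly n; apply: (npolyZ half_ge0).
  apply: npolyD (npoly_comp nb nd) _.
  exact: npolyD (npoly_comp nd nb) (npoly_comp nd nd).
apply/funext => v; rewrite -[root_iter n.+2 v]/(_ *: (a v + root_iter n.+1 (root_iter n.+1 v))).
rewrite -[X in _ = X + _]/(_ *: (a v + b (b v))) -scalerDr; congr (_ *: _).
by rewrite dE -/b (linD lb) (linD ld) -!addrA.
Qed.

Let root_iter_effect n : effect (root_iter n).
Proof.
elim: n => [|n en]; split.
- exact: npoly_lin (root_iter_npoly 0).
- exact: npoly_sa (root_iter_npoly 0).
- by move=> v; exact: npoly_ge0 (root_iter_npoly 0).
- by move=> v; rewrite rdot0l rdot_ge0.
- exact: npoly_lin (root_iter_npoly n.+1).
- exact: npoly_sa (root_iter_npoly n.+1).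
- by move=> v; exact: npoly_ge0 (root_iter_npoly n.+1).
- move=> v; rewrite -[root_iter n.+1 v]/(_ *: (a v + root_iter n (root_iter n v))).
  rewrite rdotZl rdotDl.
  have -> : rdot (root_iter n (root_iter n v)) v = rdot (root_iter n v) (root_iter n v).
    by rewrite /rdot (effect_sa en).
  have := effect_sqr v en; have := effect_le1 en v; have := effect_le1 ea v; lra.
Qed.

Let root_iter_homo n m : (n <= m)%N -> ople (root_iter n) (root_iter m).
Proof.
move=> /subnK <-; elim: (m - n)%N => [|k ih] v //; apply: le_trans (ih v) _.
have [d nd ->] := root_iter_step (k + n); rewrite rdotDl lerDl; exact: npoly_ge0.
Qed.

(** The iteration b := (a + b^2) / 2 starting at 0 increases, since both its terms
and their increments are polynomials in [a] with nonnegative coefficients, and it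
stays below 1. Its limit [q] satisfies q = (a + q^2) / 2, that is
(1 - q)^2 = 1 - a. *)
Lemma root_of_complement : exists s, [/\ bounded_ops s, is_adjoint s s,
  forall v, s (s v) = v - a v &
  forall T, bounded_ops T -> (forall v, T (a v) = a (T v)) -> forall v, T (s v) = s (T v)].
Proof.
pose C := range root_iter.
have C0 : C !=set0 by exists (root_iter 0), 0%N.
have Ce b : C b -> effect b by case=> n _ <-; exact: root_iter_effect.
have Ct b c : C b -> C c -> ople b c \/ ople c b.
  move=> [n _ <-] [m _ <-]; have [nm|/ltnW mn] := leqP n m.
    by left; exact: root_iter_homo.
  by right; exact: root_iter_homo.
have [q eq ql] := chain_limit_effect C0 Ce Ct.
have lq := effect_lin eq.
have qE v : q v = (2^-1 : R)%:C *: (a v + q (q v)).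
  apply/eqP; rewrite -subr_eq0; apply/eqP.
  apply: (@hnorm_small_eq0 _ _ _ 2) => e e0.
  have [_ [n _ <-] nP] := chain_limit2 Ct v (q v) ql e0.
  have [||h1 h2] := nP (root_iter n); [by exists n|by []|].
  have [||h3 _] := nP (root_iter n.+1); [by exists n.+1|exact: root_iter_homo|].
  set b := root_iter n in h1 h2 *.
  have lb : linear b := npoly_lin (root_iter_npoly n).
  have -> : q v - (2^-1 : R)%:C *: (a v + q (q v)) = (q v - root_iter n.+1 v) -
      (2^-1 : R)%:C *: (b (q v - b v) + (q (q v) - b (q v))).
    rewrite -[root_iter n.+1 v]/(_ *: (a v + b (b v))) (linB lb).
    rewrite [b (q v) - _ + _]addrC addrA subrK -[RHS]addrA -opprD -scalerDr.
    by rewrite -[a v + _ + _]addrA (addrC (b (b v))) subrK.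
  apply: le_trans (ler_hnormB_le _ _) _; rewrite hnormZr ger0_norm//.
  have : hnorm (b (q v - b v) + (q (q v) - b (q v))) <= e + e.
    apply: le_trans (ler_hnormD _ _) _; rewrite lerD//.
    exact: le_trans (effect_norm _ (root_iter_effect n)) h1.
  move: h3; lra.
exists (id - q); split.
- by apply: bopB; [exact: bop_id|exact: effect_bop].
- by apply: is_adjointB => //; exact: effect_sa.
- move=> v; rewrite !opE (linB lq); have := qE v.
  move=> /(congr1 (fun w => (2 : R)%:C *: w)); rewrite scalerA -rmorphM divff ?pnatr_eq0//.
  rewrite scale1r -[2]/(1 + 1) rmorphD scalerDl scale1r => E.
  have -> : a v = q v + q v - q (q v) by rewrite E addrK.
  by rewrite -[LHS]addrA -opprD addrA.
- move=> T bT Ta v; have lT := bop_lin bT; rewrite !opE (linB lT); congr (_ - _).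
  apply: (chain_limit_comm Ct ql bT) => c [n _ <-] w.
  exact: npoly_comm (root_iter_npoly n) lT Ta w.
Qed.

End square_root.

Lemma effect_sqrt a : effect a -> exists s, [/\ bounded_ops s, is_adjoint s s,
  forall v, s (s v) = a v &
  forall T, bounded_ops T -> (forall v, T (a v) = a (T v)) -> forall v, T (s v) = s (T v)].
Proof.
move=> ea; have ec : effect (id - a).
  by apply: effectB => //; [exact: effect_id|exact: effect_le1].
have [s [bs ss sE sT]] := root_of_complement ec; exists s; split=> //.
  by move=> v; rewrite sE !opE subKr.
move=> T bT Ta; apply: sT => // v; have lT := bop_lin bT.
by rewrite !opE (linB lT) Ta.
Qed.

End positive_operators.

(** * Extending operators from a linear subspace *)

Section linear_spans.
Context {R : realType} {V : lmodType R[i]}.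

Inductive span (E : set V) : set V :=
| span0 : span E 0
| spanS (a : R[i]) e x : E e -> span E x -> span E (a *: e + x).

Lemma span_mem (E : set V) e : E e -> span E e.
Proof. by move=> Ee; have := spanS 1 Ee (span0 E); rewrite scale1r addr0. Qed.

Lemma span_lincomb (E : set V) (a : R[i]) x y : span E x -> span E y -> span E (a *: x + y).
Proof.
move=> sx sy; elim: sx => [|b e x' Ee _ ih]; first by rewrite scaler0 add0r.
by rewrite scalerDr scalerA -addrA; exact: spanS.
Qed.

End linear_spans.

Section extension.
Context {R : realType} {K H : hilbertType R}.
Variable G : set (K * H).
Hypothesis G0 : G 0.
Hypothesis GP : forall (a : R[i]) p q, G p -> G q -> G (a *: p + q).
Hypothesis Gle : forall p, G p -> hnorm p.2 <= hnorm p.1.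

Let D : set K := [set p.1 | p in G].

Let sD : subsp D.
Proof.
split; first by exists 0.
by move=> a _ _ [p Gp <-] [q Gq <-]; exists (a *: p + q) => //; exact: GP.
Qed.

Let approx z w := forall e : R, 0 < e ->
  exists2 p, G p & hnorm (proj D z - p.1) <= e /\ hnorm (w - p.2) <= e.

Let Gdist p q : G p -> G q -> hnorm (p.2 - q.2) <= hnorm (p.1 - q.1).
Proof.
move=> Gp Gq; have := Gle (GP (-1) Gq Gp).
by rewrite /= !scaleN1r ![- _ + _]addrC.
Qed.

Let approx_uniq z w w' : approx z w -> approx z w' -> w = w'.
Proof.
move=> zw zw'; apply/eqP; rewrite -subr_eq0; apply/eqP.
apply: (@hnorm_small_eq0 _ _ _ 4) => e e0.
have [p Gp [zp wp]] := zw _ e0; have [q Gq [zq wq]] := zw' _ e0.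
have -> : w - w' = (w - p.2) + (p.2 - q.2) - (w' - q.2).
  by rewrite subrKA opprB subrKA.
apply: le_trans (ler_hnormB_le _ _) _.
have := ler_hnormD (w - p.2) (p.2 - q.2); have := Gdist Gp Gq.
have : hnorm (p.1 - q.1) <= e + e.
  have -> : p.1 - q.1 = (proj D z - q.1) - (proj D z - p.1) by rewrite opprB [RHS]addrC subrKA.
  by apply: le_trans (ler_hnormB_le _ _) _; rewrite lerD.
lra.
Qed.

Let approx_ex z : exists w, approx z w.
Proof.
pose P (d : R) : set H := [set v | exists2 p, G p & p.2 = v /\ hnorm (proj D z - p.1) <= d].
have [|||l lP] := @shrinking_limit _ _ P.
- move=> d d0; have [_ [p Gp <-] pd] := proj_nearby sD z d0.
  by exists p.2, p.
- by move=> d d' v dd' [p Gp [pv pd]]; exists p => //; split=> //; apply: le_trans dd'.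
- move=> e e0; exists (e / 2); first by rewrite divr_gt0.
  move=> _ _ [p Gp [<- pd]] [q Gq [<- qd]]; apply: le_trans (Gdist Gp Gq) _.
  have -> : p.1 - q.1 = (proj D z - q.1) - (proj D z - p.1) by rewrite opprB [RHS]addrC subrKA.
  by apply: le_trans (ler_hnormB_le _ _) _; rewrite [leRHS]splitr lerD.
exists l => e e0; have [d d0 dP] := lP _ e0.
pose m := Num.min d e; have m0 : 0 < m by rewrite lt_min d0.
have [_ [p Gp <-] pm] := proj_nearby sD z m0.
exists p => //; split; first by apply: le_trans pm _; rewrite ge_min lexx orbT.
by apply: dP; exists p => //; split=> //; apply: le_trans pm _; rewrite ge_min lexx.
Qed.

(** The data is a linear relation [G] whose members (u, v) satisfy |v| <= |u|. The
value at [z] is the limit of those [v] for which [u] tends to the projection of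
[z] on the closed domain; it is zero on the orthogonal complement. The last two
clauses say that equality of norms passes to the limit and that the extension
intertwines every pair of operators that preserves [G], provided that the first
one reduces the domain. *)
Lemma contraction_extension : exists T : K -> H, [/\ linear T,
  forall z, hnorm (T z) <= hnorm z,
  forall p, G p -> T p.1 = p.2,
  (forall p, G p -> hnorm p.2 = hnorm p.1) ->
    (forall z, nearby [set p.1 | p in G] z) -> forall z, hnorm (T z) = hnorm z &
  forall x x' y, bounded_ops x -> is_adjoint x x' -> bounded_ops y ->
    (forall p, G p -> G (x p.1, y p.2)) ->
    (forall p, G p -> exists2 q, G q & q.1 = x' p.1) ->
    forall z, T (x z) = y (T z)].
Proof.
have [T TP] := choice approx_ex.
have TE z w : approx z w -> T z = w by apply: approx_uniq; exact: TP.
exists T; split.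
- move=> a z z'; apply: TE => e e0; pose c := hnorm (a : R[i]^o) + 1.
  have c0 : 0 < c by rewrite ltr_wpDl// hnorm_ge0.
  have e1 : 0 < e / (2 * c) by rewrite divr_gt0// mulr_gt0.
  have e2 : 0 < e / 2 by rewrite divr_gt0.
  have [p Gp [zp Tp]] := TP z _ e1; have [q Gq [zq Tq]] := TP z' _ e2.
  have key (W : hilbertType R) (u u' v v' : W) : hnorm (u - v) <= e / (2 * c) ->
      hnorm (u' - v') <= e / 2 -> hnorm (a *: u + u' - (a *: v + v')) <= e.
    move=> h h'; rewrite opprD addrACA -scalerBr; apply: le_trans (ler_hnormD _ _) _.
    rewrite [leRHS]splitr lerD// hnormZ.
    apply: (@le_trans _ _ (c * (e / (2 * c)))).
      by rewrite ler_pM ?hnorm_ge0// lerDl ler01.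
    by rewrite le_eqVlt; apply/orP; left; apply/eqP; field; rewrite gt_eqF.
  exists (a *: p + q); first exact: GP.
  by rewrite (linP (proj_lin sD)) /=; split; exact: key.
- move=> z; apply: (@le_small _ _ _ 2) => e e0.
  have [p Gp [zp Tp]] := TP z _ e0.
  have := ler_hnormD (T z - p.2) p.2; rewrite subrK.
  have := ler_hnormB_le (proj D z) (proj D z - p.1); rewrite opprB addrC subrK.
  have := Gle Gp; have := proj_le sD z; lra.
- move=> p Gp; apply: TE => e e0; exists p => //.
  have -> : proj D p.1 = p.1 by apply: proj_id => //; apply: nearby_mem; exists p.
  by rewrite !subrr !hnorm0 ltW.
- move=> Geq Dd z; have Pz : proj D z = z by apply: proj_id.
  apply/eqP; rewrite -subr_eq0; apply/eqP; apply: (@eq0_small _ _ 2) => e e0.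
  have [p Gp [zp Tp]] := TP z _ e0; rewrite Pz in zp.
  have -> : hnorm (T z) - hnorm z =
      (hnorm (T z) - hnorm p.2) - (hnorm z - hnorm p.1) by rewrite (Geq _ Gp); ring.
  apply: le_trans (ler_normB _ _) _; have := ler_hnormB (T z) p.2.
  have := ler_hnormB z p.1; lra.
- move=> x x' y bx xx' /bounded_opsP[ly [C C0 yC]] Gxy Gx' z; apply: TE => e e0.
  have [_ [B B0 xB]] := (bounded_opsP x).1 bx.
  pose M := Num.max B C; have M0 : 0 < M by rewrite lt_max B0.
  have [p Gp [zp Tp]] := TP z _ (divr_gt0 e0 M0).
  exists (x p.1, y p.2); first exact: Gxy.
  rewrite (proj_comm sD bx xx'); first last.
  - by move=> _ [q Gq <-]; have [r Gr rE] := Gx' _ Gq; exists r.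
  - by move=> _ [q Gq <-]; exists (x q.1, y q.2) => //; exact: Gxy.
  rewrite -(linB (bop_lin bx)) -(linB ly) /=; split.
    apply: le_trans (xB _) _; apply: (@le_trans _ _ (M * hnorm (proj D z - p.1))).
      by rewrite ler_wpM2r ?hnorm_ge0// le_max lexx.
    by rewrite mulrC -ler_pdivlMr.
  apply: le_trans (yC _) _; apply: (@le_trans _ _ (M * hnorm (T z - p.2))).
    by rewrite ler_wpM2r ?hnorm_ge0// le_max lexx orbT.
  by rewrite mulrC -ler_pdivlMr.
Qed.

End extension.

Section gram.
Context {R : realType} {K H : hilbertType R}.
Variable E : set (K * H).
Hypothesis Egram : forall p q, E p -> E q -> hdot p.1 q.1 = hdot p.2 q.2.

Let span_gram p q : span E p -> span E q -> hdot p.1 q.1 = hdot p.2 q.2.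
Proof.
move=> sp sq; elim: sp => [|a u x Eu _ ih] /=; first by rewrite !dot0l.
rewrite !dotDl !dotZl ih; congr (_ * _ + _).
elim: sq => [|b v y Ev _ ih'] /=; first by rewrite !dot0r.
by rewrite !dotDr !dotZr ih' Egram.
Qed.

Let span_norm p : span E p -> hnorm p.2 = hnorm p.1.
Proof.
move=> sp; have := span_gram sp sp; rewrite !hdot_hnorm => /complexI h.
by apply/eqP; rewrite -(@eqrXn2 _ 2) ?hnorm_ge0// h.
Qed.

(** Equal Gram matrices give equal norms to corresponding linear combinations, so
that matching the generators is a well defined isometry on their linear span;
density of the span then makes it an isometry everywhere. *)
Lemma gram_isometry : (forall z, nearby (span [set p.1 | p in E]) z) ->
  exists W : K -> H, [/\ linear W,
  forall z, hnorm (W z) = hnorm z,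
  forall p, E p -> W p.1 = p.2 &
  forall x x' y, bounded_ops x -> is_adjoint x x' -> bounded_ops y ->
    (forall p, E p -> E (x p.1, y p.2)) ->
    (forall p, E p -> exists2 q, E q & q.1 = x' p.1) ->
    forall z, W (x z) = y (W z)].
Proof.
move=> Ed.
have [|||W [lW _ WE Wn Wc]] := @contraction_extension _ _ _ (span E).
- exact: span0.
- by move=> a p q; exact: span_lincomb.
- by move=> p /span_norm ->.
exists W; split=> //.
- apply: Wn; first exact: span_norm.
  move=> z e /(Ed z)[d sd zd]; exists d => //.
  elim: sd {zd} => [|a _ x [p Ep <-] _ [q sq <-]]; first by exists 0; [exact: span0|].
  by exists (a *: p + q) => //; exact: spanS.
- by move=> p Ep; apply: WE; exact: span_mem.
- move=> x x' y bx xx' by_ Exy Ex'; apply: Wc => //.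
  + move=> p; elim=> [|a q r Eq _ ih] /=.
      by rewrite (lin0 (bop_lin bx)) (lin0 (bop_lin by_)); exact: span0.
    rewrite (linP (bop_lin bx)) (linP (bop_lin by_)).
    exact: (spanS a (Exy _ Eq) ih).
  + have lx' := is_adjoint_lin xx'.
    move=> p; elim=> [|a q r Eq _ [s ss sE]] /=.
      by exists 0; [exact: span0|rewrite (lin0 lx')].
    have [t Et tE] := Ex' _ Eq; exists (a *: t + s); first exact: spanS.
    by rewrite /= tE sE (linP lx').
Qed.

End gram.

(** * Hilbert sums and amplifications *)

Section hilbert_sums.
Context {R : realType}.
Implicit Types (I : choiceType) (H K : hilbertType R).

Lemma dense_of_orth H (D : set H) : subsp D ->
  (forall z, (forall d, D d -> hdot z d = 0) -> z = 0) -> forall z, nearby D z.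
Proof.
move=> sD Dz z; have -> : z = proj D z; last exact: proj_nearby.
apply/eqP; rewrite -subr_eq0; apply/eqP/Dz => d Dd.
exact/(proj_orth sD)/nearby_mem.
Qed.

Lemma bop_eq_nearby H K (S T : H -> K) (D : set H) : bounded_ops S -> bounded_ops T ->
  (forall d, D d -> S d = T d) -> forall z, nearby D z -> S z = T z.
Proof.
move=> bS bT ST z Dz; apply/eqP; rewrite -subr_eq0; apply/eqP.
have /bounded_opsP[lU [C C0 UC]] := bopB bS bT.
apply: (@hnorm_small_eq0 _ _ _ C) => e /Dz[d Dd zd].
have -> : S z - T z = (S - T) (z - d) by rewrite (linB lU) !opE (ST _ Dd) subrr subr0.
by apply: le_trans (UC _) _; rewrite ler_pM2l.
Qed.

Lemma hsum_eq I H (x y : hsum I H) : (forall i, x i = y i) -> x = y.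
Proof. by move=> h; apply/val_inj/funext. Qed.

Lemma hsum_dot_eq I H K (x y : hsum I H) (x' y' : hsum I K) :
  (forall i, hdot (x i) (y i) = hdot (x' i) (y' i)) -> hdot x y = hdot x' y'.
Proof.
move=> h; rewrite -[LHS]/(hsum_dot x y) -[RHS]/(hsum_dot x' y') /hsum_dot.
by congr (summability.sum _); apply/funext.
Qed.

Lemma hsingleE I H (i j : I) (u : H) : hsingle i u j = if j == i then u else 0.
Proof. by []. Qed.

Lemma hsingle_lin I H (i : I) : linear (@hsingle R I H i).
Proof.
move=> a x y; apply: hsum_eq => j; rewrite hsumDE hsumZE !hsingleE.
by case: eqP => //; rewrite scaler0 addr0.
Qed.

Lemma dot_hsingle I H (i : I) (u : H) (z : hsum I H) : hdot (hsingle i u) z = hdot u (z i).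
Proof.
apply: hsum_dot_lim; apply/hcvgP => e e0; exists [fset i]%fset => //= B iB.
rewrite /= partial_sumE (big_fsetD1 i) /=; last exact/(fsubsetP iB)/fset11.
rewrite eqxx big1_fset ?addr0; first by rewrite subrr hnorm0.
by move=> j; rewrite !inE => /andP[ji _] _; rewrite (negPf ji) dot0l.
Qed.

Lemma hsingle_norm I H (i : I) (u : H) : hnorm (hsingle i u : hsum I H) = hnorm u.
Proof.
apply/eqP; rewrite -(@eqrXn2 _ 2) ?hnorm_ge0// !hnorm_sqr /rdot dot_hsingle.
by rewrite hsingleE eqxx.
Qed.

Lemma bop_hsingle I H (i : I) : bounded_ops (@hsingle R I H i).
Proof. by apply: (@bopW _ _ _ _ 1 (@hsingle_lin _ _ i)) => x; rewrite mul1r hsingle_norm. Qed.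

Lemma bop_coord I H (i : I) : bounded_ops (fun z : hsum I H => z i).
Proof. by apply: (@bopW _ _ _ _ 1) => // z; rewrite mul1r; exact: hnorm_coord. Qed.

Lemma dot_hsingle_single I H (i j : I) (u v : H) :
  hdot (hsingle i u : hsum I H) (hsingle j v) = if i == j then hdot u v else 0.
Proof. by rewrite dot_hsingle hsingleE; case: eqP => // _; rewrite dot0r. Qed.

Lemma hsingle_dense I H (z : hsum I H) :
  nearby (span [set w | exists i u, w = hsingle i u]) z.
Proof.
move: z; apply: dense_of_orth => [|z zD].
  by split; [exact: span0|move=> a x y; exact: span_lincomb].
apply: hsum_eq => i; apply: rdot_eq0; rewrite /rdot -(dot_hsingle i) hdot_eq0C ?rmorph0//.
by apply: zD; apply: span_mem; exists i, (z i).
Qed.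

Lemma hsum_op_ext I H K (S T : hsum I H -> K) : bounded_ops S -> bounded_ops T ->
  (forall i u, S (hsingle i u) = T (hsingle i u)) -> forall z, S z = T z.
Proof.
move=> bS bT ST z; apply: bop_eq_nearby (hsingle_dense z) => // d.
elim=> [|a _ x [i [u ->]] _ ih]; first by rewrite (lin0 (bop_lin bS)) (lin0 (bop_lin bT)).
by rewrite (linP (bop_lin bS)) (linP (bop_lin bT)) ST ih.
Qed.

(** The value 0 given by [insubd] to sequences that are not square summable never
occurs when [T] is bounded. *)
Definition dg I H K (T : H -> K) (z : hsum I H) : hsum I K := insubd 0 (fun i => T (z i)).
Arguments dg I {H K} T z.

Lemma dg_l2 I H K (T : H -> K) (z : hsum I H) : bounded_ops T -> (fun i => T (z i)) \in @l2 R I K.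
Proof.
move=> /bounded_opsP[lT [C C0 TC]]; apply/l2P; exists (C ^+ 2 * fine (sqsum z)) => A.
apply: le_trans (ler_wpM2l (sqr_ge0 C) (psum_le_sqsum A (hsumP z))).
rewrite mulr_sumr; apply: ler_sum => i _; rewrite -exprMn.
by rewrite ler_pXn2r ?nnegrE ?mulr_ge0 ?hnorm_ge0 ?(ltW C0).
Qed.

Lemma dgE I H K (T : H -> K) (z : hsum I H) i : bounded_ops T -> dg I T z i = T (z i).
Proof.
move=> bT; have E : \val (dg I T z) = (fun i => T (z i)) := insubdK 0 (dg_l2 z bT).
by rewrite -[LHS]/(\val (dg I T z) i) E.
Qed.

Lemma dg_hsingle I H K (T : H -> K) (i : I) u : bounded_ops T ->
  dg I T (hsingle i u) = hsingle i (T u).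
Proof.
move=> bT; apply: hsum_eq => j; rewrite dgE// !hsingleE.
by case: eqP => // _; rewrite (lin0 (bop_lin bT)).
Qed.

Lemma dg_bop I H K (T : H -> K) : bounded_ops T -> bounded_ops (dg I T).
Proof.
move=> bT; have /bounded_opsP[lT [C C0 TC]] := bT; apply: (@bopW _ _ _ _ C) => [a x y|z].
  by apply: hsum_eq => i; rewrite dgE// !hsumDE !hsumZE !dgE// (linP lT).
rewrite -(@ler_pXn2r _ 2) ?nnegrE ?mulr_ge0 ?hnorm_ge0 ?(ltW C0)//.
rewrite exprMn !hsum_hnorm_sqr; apply/sqsum_leP => [|A]; first exact: hsumP.
apply: le_trans (ler_wpM2l (sqr_ge0 C) (psum_le_sqsum A (hsumP z))).
rewrite mulr_sumr; apply: ler_sum => i _; rewrite dgE// -exprMn.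
by rewrite ler_pXn2r ?nnegrE ?mulr_ge0 ?hnorm_ge0 ?(ltW C0).
Qed.

Lemma dg_adj I H K (S : H -> K) T : bounded_ops S -> is_adjoint S T ->
  is_adjoint (dg I S) (dg I T).
Proof.
move=> bS ST x y; have bT := is_adjoint_bop bS ST.
by apply: hsum_dot_eq => i; rewrite !dgE.
Qed.

Definition entry I H K (X : hsum I H -> hsum I K) (i j : I) (u : H) : K := X (hsingle j u) i.

Lemma entry_bop I H K (X : hsum I H -> hsum I K) i j : bounded_ops X ->
  bounded_ops (entry X i j).
Proof. by move=> bX; have := bop_comp (@bop_coord _ _ i) (bop_comp bX (@bop_hsingle _ _ j)). Qed.

(** On the vectors [hsingle j u], which span a dense subspace, the coordinates of
the two sides are exactly the two sides of the condition on the entries. *)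
Lemma commute_dgP I H (X : hsum I H -> hsum I H) (y : H -> H) :
  bounded_ops X -> bounded_ops y ->
  (forall z, X (dg I y z) = dg I y (X z)) <->
  (forall i j u, entry X i j (y u) = y (entry X i j u)).
Proof.
move=> bX by_; split=> [h i j u|h].
  by rewrite /entry -dg_hsingle// h dgE.
apply: hsum_op_ext => [||j u].
- by have := bop_comp bX (dg_bop I by_).
- by have := bop_comp (dg_bop I by_) bX.
by apply: hsum_eq => i /=; rewrite dg_hsingle// dgE//; exact: h.
Qed.

End hilbert_sums.
Arguments dg {R} I {H K} T z.

(** * Commutants and the bicommutant theorem *)

Section commutants.
Context {R : realType} {H : hilbertType R}.
Variable A : set (H -> H).

Lemma commutant_bop T : commutant A T -> bounded_ops T. Proof. by case. Qed.

Lemma commutantE S T v : commutant A T -> A S -> T (S v) = S (T v).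
Proof. by move=> [_ h] /h/(congr1 (@^~ v)). Qed.

Lemma commutantI T : bounded_ops T -> (forall S v, A S -> T (S v) = S (T v)) ->
  commutant A T.
Proof. by move=> bT h; split=> // S AS; apply/funext => v; exact: h. Qed.

Hypothesis hA : von_neumann_algebra A.

Let Alin S : A S -> linear S. Proof. by move=> /(vna_bounded hA)/bop_lin. Qed.

Lemma commutant_id : commutant A id.
Proof. by apply: commutantI => //; exact: bop_id. Qed.

Lemma commutant_lincomb (a : R[i]) S T : commutant A S -> commutant A T -> commutant A (a *: S + T).
Proof.
move=> hS hT; apply: commutantI; first by apply: bop_lincomb; exact: commutant_bop.
move=> U v AU; rewrite !opE (linP (Alin AU)).
by rewrite (commutantE _ hS AU) (commutantE _ hT AU).
Qed.

Lemma commutant0 : commutant A 0.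
Proof.
apply: commutantI; first exact: bop0.
by move=> U v AU; rewrite !opE (lin0 (Alin AU)).
Qed.

Lemma commutantD S T : commutant A S -> commutant A T -> commutant A (S + T).
Proof. by move=> hS hT; rewrite -[S]scale1r; exact: commutant_lincomb. Qed.

Lemma commutantZ (a : R[i]) T : commutant A T -> commutant A (a *: T).
Proof. by move=> hT; rewrite -[_ *: _]addr0; exact: commutant_lincomb hT commutant0. Qed.

Lemma commutantB S T : commutant A S -> commutant A T -> commutant A (S - T).
Proof. by move=> hS hT; rewrite addrC -scaleN1r; exact: commutant_lincomb. Qed.

Lemma commutant_comp S T : commutant A S -> commutant A T -> commutant A (S \o T).
Proof.
move=> hS hT; apply: commutantI; first by apply: bop_comp; exact: commutant_bop.
by move=> U v AU /=; rewrite (commutantE _ hT AU) (commutantE _ hS AU).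
Qed.

Lemma commutant_is_adjoint T T' : commutant A T -> is_adjoint T T' -> commutant A T'.
Proof.
move=> hT TT'; apply: commutantI => [|S v AS].
  exact: is_adjoint_bop (commutant_bop hT) TT'.
have SS := adjP (vna_bounded hA AS).
have AS' : A (adj S) := vna_adjoint hA AS SS.
by apply: dot_injr => w; rewrite -TT' -(adj_sym SS) -(adj_sym SS) -TT' (commutantE _ hT AS').
Qed.

Lemma commutant_adj T : commutant A T -> commutant A (adj T).
Proof. by move=> hT; exact: commutant_is_adjoint hT (adjP (commutant_bop hT)). Qed.

(** The subspace of all [S x] is invariant under the algebra, hence under adjoints of
its elements, so that its projection lies in the commutant. *)
Lemma orbit_proj (x : H) (D := [set S x | S in A]) :
  [/\ subsp D, nearby D x & commutant A (proj D)].
Proof.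
have sD : subsp D.
  split.
    by exists (0 *: id); [exact/(vna_scale hA)/(vna_id hA)|rewrite !opE scale0r].
  move=> a _ _ [S AS <-] [T AT <-]; exists (a *: S + T) => //.
  by apply: (vna_add hA) => //; exact: (vna_scale hA).
split=> //; first by apply: nearby_mem; exists id => //; exact: (vna_id hA).
apply: commutantI; first exact: proj_bop.
move=> S v AS; have SS := adjP (vna_bounded hA AS).
apply: (proj_comm sD (vna_bounded hA AS) SS) => _ [T AT <-].
  by exists (S \o T) => //; exact: (vna_comp hA).
by exists (adj S \o T) => //; apply: (vna_comp hA) => //; exact: (vna_adjoint hA AS).
Qed.

End commutants.

Section bicommutant.
Context {R : realType} {H : hilbertType R}.
Variable A : set (H -> H).
Hypothesis hA : von_neumann_algebra A.

(** The orbit of [x] under the amplified algebra is reducing, so the entries of its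
projection lie in the commutant, and the projection commutes with the
amplification of [T]. As [x] lies in its own orbit, so does T x, up to closure. *)
Let strong_approx T n (x : hsum 'I_n H) (e : R) : commutant (commutant A) T -> 0 < e ->
  exists2 S, A S & forall i, hnorm (T (x i) - S (x i)) <= e.
Proof.
move=> hT e0; have bT := commutant_bop hT.
pose D : set (hsum 'I_n H) := [set dg 'I_n S x | S in A].
have AS S : A S -> bounded_ops S := fun h => vna_bounded hA h.
have A0 : A (0 *: id) by exact/(vna_scale hA)/(vna_id hA).
have sD : subsp D.
  split.
    exists (0 *: id) => //; apply: hsum_eq => i.
    by rewrite dgE ?opE ?scale0r//; exact: bop0.
  move=> a _ _ [S hS <-] [U hU <-].
  have hSU : A (a *: S + U) by apply: (vna_add hA) => //; exact: (vna_scale hA).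
  exists (a *: S + U) => //; apply: hsum_eq => i.
  by rewrite hsumDE hsumZE !dgE//; exact: AS.
have Dx : nearby D x.
  apply: nearby_mem; exists id; first exact: (vna_id hA).
  by apply: hsum_eq => i; rewrite dgE//; exact: bop_id.
have dgD S d : A S -> D d -> D (dg 'I_n S d).
  move=> hS [U hU <-]; have hSU := vna_comp hA hS hU; exists (S \o U) => //.
  by apply: hsum_eq => i; rewrite !dgE//; exact: AS.
have Pe i j : commutant A (entry (proj D) i j).
  apply: commutantI; first exact/entry_bop/proj_bop.
  move=> S v hS; move: i j v; apply/commute_dgP; [exact: proj_bop|exact: AS|].
  have SS := adjP (AS _ hS).
  apply: (proj_comm sD (dg_bop 'I_n (AS _ hS)) (dg_adj (AS _ hS) SS)) => d; first exact: dgD.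
  by apply: dgD; exact: (vna_adjoint hA hS).
have PT : forall z, proj D (dg 'I_n T z) = dg 'I_n T (proj D z).
  apply/commute_dgP => //; first exact: proj_bop.
  by move=> i j u; rewrite (commutantE _ hT (Pe i j)).
have : nearby D (dg 'I_n T x).
  by rewrite -(proj_id sD Dx) -PT; exact: proj_nearby.
move=> /(_ e e0)[_ [S hS <-] TS]; exists S => // i.
by have := le_trans (hnorm_coord _ i) TS; rewrite hsumBE !dgE//; exact: AS.
Qed.

Let cvg_initial (S : choiceType) (U : topologicalType) (f : S -> U) (F : set_system S)
    (s : S) : Filter F -> f @ F --> f s -> F --> (s : initial_topology f).
Proof.
move=> FF fF X; rewrite nbhsE => -[_ [[B oB <-] /= Bs] sBX].
by apply: filterS sBX _; apply: fF; exact: open_nbhs_nbhs.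
Qed.

(** A neighbourhood in the weak operator topology only tests finitely many vectors,
which are collected in a single vector of a finite Hilbert sum. *)
Let strong_wot T : (forall n (x : hsum 'I_n H) (e : R), 0 < e ->
    exists2 S, A S & forall i, hnorm (T (x i) - S (x i)) <= e) ->
  closure (A : set (initial_topology (@wot_eval R H H))) T.
Proof.
move=> hT; rewrite closureEcvg.
pose G : set_system (H -> H) := [set X | exists n (x : hsum 'I_n H) (e : R),
  0 < e /\ forall S, A S -> (forall i, hnorm (T (x i) - S (x i)) <= e) -> X S].
have xl n (x : 'I_n -> H) : x \in @l2 R _ H.
  apply/l2P; exists (\sum_(i < n) hnorm (x i) ^+ 2) => B.
  rewrite big_uniq ?fset_uniq// [leRHS](bigID (mem B)) /= lerDl sumr_ge0// => i _.
  exact: sqr_ge0.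
have GG : ProperFilter G.
  split.
    by move=> [n [x [e [e0 xe]]]]; have [S AS Sx] := hT n x e e0; exact: xe AS Sx.
  split.
  - by exists 0%N, 0, 1.
  - move=> X Y [n [x [e [e0 xX]]]] [m [y [d [d0 yY]]]].
    pose z : hsum 'I_(n + m) H := HSum (xl _ (fun k : 'I_(n + m) =>
      match fintype.split k with inl i => x i | inr j => y j end)).
    exists (n + m)%N, z, (Num.min e d); split; first by rewrite lt_min e0.
    move=> S AS Sz; split; [apply: xX|apply: yY] => // i.
      have := Sz (lshift m i); rewrite /= (unsplitK (inl i)) => /le_trans; apply.
      by rewrite ge_min lexx.
    have := Sz (rshift n i); rewrite /= (unsplitK (inr i)) => /le_trans; apply.
    by rewrite ge_min lexx orbT.
  - by move=> X Y XY [n [x [e [e0 xX]]]]; exists n, x, e; split=> // S AS /(xX S AS)/XY.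
exists G => //; split; last first.
  by move=> X AX; exists 0%N, 0, 1; split=> // S AS _; exact: AX.
apply: cvg_initial; apply/cvg_sup => -[u v]; apply: cvg_initial.
apply/hcvgP => e e0.
have d0 : 0 < e / (2 * (hnorm v + 1)).
  by rewrite divr_gt0// mulr_gt0// ltr_wpDl// hnorm_ge0.
exists 1%N, (HSum (xl 1%N (fun=> u))), (e / (2 * (hnorm v + 1))); split=> // S AS Su.
rewrite /= /wot_eval /= -dotBl; apply: le_lt_trans (hdot_le _ _) _.
have := Su ord0 => /= h.
apply: (@le_lt_trans _ _ (e / (2 * (hnorm v + 1)) * (hnorm v + 1))).
  by rewrite ler_pM ?hnorm_ge0// lerDl ler01.
rewrite invfM mulrA divfK ?gt_eqF ?ltr_wpDl ?hnorm_ge0//.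
by rewrite ltr_pdivrMr// ltr_pMr// ltr1n.
Qed.

Lemma bicommutant : commutant (commutant A) = A.
Proof.
apply/seteqP; split=> T hT.
  apply: (vna_closed hA); split; first exact: commutant_bop hT.
  by apply: strong_wot => n x e; exact: strong_approx.
apply: commutantI; first exact: (vna_bounded hA).
by move=> S v hS; rewrite (commutantE _ hS hT).
Qed.

End bicommutant.

(** * Vector states and star isomorphisms *)

Section star_isomorphisms.
Context {R : realType} {K H : hilbertType R}.
Variables (A : set (K -> K)) (B : set (H -> H)) (pi : (K -> K) -> (H -> H)).
Hypotheses (hA : von_neumann_algebra A) (hB : von_neumann_algebra B).
Hypothesis hpi : star_isomorphism (commutant A) (commutant B) pi.
Local Notation M := (commutant A).
Local Notation N := (commutant B).

Lemma iso_mem x : M x -> N (pi x).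
Proof. by have [[h _ _] _ _ _ _] := hpi; apply: h. Qed.

Lemma iso_bop x : M x -> bounded_ops (pi x).
Proof. by move=> /iso_mem/commutant_bop. Qed.

Lemma iso_inj x y : M x -> M y -> pi x = pi y -> x = y.
Proof. by have [[_ h _] _ _ _ _] := hpi; move=> Mx My; apply: h; rewrite inE. Qed.

Lemma iso_surj y : N y -> exists2 x, M x & pi x = y.
Proof. by have [[_ _ h] _ _ _ _] := hpi; move=> /h. Qed.

Lemma iso_id : pi id = id.
Proof.
have [x Mx xE] := iso_surj (commutant_id B).
have h := star_iso_comp hpi Mx (commutant_id A); rewrite [in RHS]xE in h.
exact: etrans (esym h) xE.
Qed.

Lemma iso0 : pi 0 = 0.
Proof.
rewrite -[X in pi X](scale0r (@id K)) (star_iso_scale hpi)//; last exact: commutant_id.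
by rewrite scale0r.
Qed.

Lemma isoB x y : M x -> M y -> pi (x - y) = pi x - pi y.
Proof.
move=> Mx My; rewrite -scaleN1r (star_iso_add hpi)//; last exact: commutantZ.
by rewrite (star_iso_scale hpi)// scaleN1r.
Qed.

(** After scaling, [y] has a self-adjoint square root; the latter commutes with
everything that commutes with [y], so it lies in the algebra, and the isomorphism
maps its square to a square of a self-adjoint operator. *)
Lemma iso_ge0 y : M y -> is_adjoint y y -> (forall v, 0 <= rdot (y v) v) ->
  forall v, 0 <= rdot (pi y v) v.
Proof.
move=> My sy y0; have /bounded_opsP[ly [C C0 yC]] := commutant_bop My.
pose a : K -> K := (C^-1 : R)%:C *: y.
have ea : effect a.
  split.
  - by move=> t u v; rewrite /a !opE (linP ly) !scalerDr !scalerA mulrC.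
  - by move=> u v; rewrite /a !opE dotZl dotZr conjc_real sy.
  - by move=> v; rewrite /a !opE rdotZl mulr_ge0// invr_ge0 ltW.
  - move=> v; rewrite /a !opE rdotZl mulrC ler_pdivrMr// mulrC.
    apply: le_trans (rdot_le _ _) _; rewrite -hnorm_sqr expr2 mulrA.
    by rewrite ler_wpM2r ?hnorm_ge0.
have [s [bs ss sE sT]] := effect_sqrt ea.
have Ms : M s.
  apply: commutantI => // S v AS; rewrite sT//; first exact: (vna_bounded hA).
  have lS := bop_lin (vna_bounded hA AS).
  by move=> w; rewrite /a !opE (linZ lS) (commutantE _ My AS).
have -> : y = C%:C *: (s \o s).
  apply/funext => v; rewrite opZE /= sE /a opZE scalerA -rmorphM divff ?gt_eqF//.
  by rewrite scale1r.
move=> v; rewrite (star_iso_scale hpi); last exact: commutant_comp.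
rewrite (star_iso_comp hpi)// opZE rdotZl mulr_ge0 ?(ltW C0)//.
by rewrite /rdot /= (star_iso_adjoint hpi Ms Ms ss); exact: rdot_ge0.
Qed.

Lemma iso_le x y : M x -> M y -> effect x -> effect y -> ople x y -> ople (pi x) (pi y).
Proof.
move=> Mx My ex ey xy v; have := iso_ge0 (commutantB hA My Mx) _ _ v.
rewrite isoB// opDE opNE rdotBl subr_ge0; apply.
  by apply: is_adjointB; exact: effect_sa.
by move=> w; rewrite !opE rdotBl subr_ge0.
Qed.

Lemma effect0 : effect (0 : K -> K).
Proof.
split; [exact: bop_lin (@bop0 _ K K)|by move=> u v; rewrite dot0l dot0r| |];
by move=> v; rewrite rdot0l ?rdot_ge0.
Qed.

Lemma effectD (a b c : K -> K) : effect a -> effect b -> effect c ->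
  ople b (c - a) -> effect (a + b) /\ ople (a + b) c.
Proof.
move=> ea eb ec bca.
have abc : ople (a + b) c.
  by move=> v; have := bca v; rewrite !opE rdotBl rdotDl; lra.
split=> //; split.
- exact: bop_lin (bopD (effect_bop ea) (effect_bop eb)).
- by move=> u v; rewrite !opE dotDl dotDr (effect_sa ea) (effect_sa eb).
- by move=> v; rewrite opDE rdotDl addr_ge0 ?effect_ge0.
- by move=> v; apply: le_trans (abc v) _; exact: effect_le1.
Qed.

Section locally_dominated.
Variables (e : K -> K) (xi : H) (eta : K).
Hypotheses (Me : M e) (ee : effect e).
Let phi x := rdot (pi x xi) xi.
Let om x := rdot (x eta) eta.

Let S x := [/\ M x, effect x, ople x e & om x <= phi x].

Let S0 : S 0.
Proof.
split; [exact: commutant0|exact: effect0| |by rewrite /om /phi iso0 !rdot0l].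
by move=> v; rewrite rdot0l; exact: effect_ge0.
Qed.

(** Along a chain the values <c eta, eta> converge to the value at the limit, and
those of [phi] are at most its value there, since the isomorphism is monotone; so
the inequality defining [S] passes to the limit. *)
Let S_chain (C : set (K -> K)) : C !=set0 -> C `<=` S ->
  (forall a b, C a -> C b -> ople a b \/ ople b a) -> exists2 q, S q & forall c, C c -> ople c q.
Proof.
move=> C0 CS Ct; have Ce a : C a -> effect a by move=> /CS[].
have [q eq ql] := chain_limit_effect C0 Ce Ct.
have Cq c : C c -> ople c q by exact: chain_limit_ub.
have Mq : M q.
  apply: commutantI; first exact: effect_bop.
  move=> T v AT; apply/esym; apply: (chain_limit_comm Ct ql); first exact: (vna_bounded hA).
  by move=> c /CS[Mc _ _ _] w; rewrite (commutantE _ Mc AT).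
exists q => //; split=> //.
  by move=> v; apply: (chain_limit_least ql) => c /CS[_ _ + _]; apply.
apply: (chain_limit_least ql) => c Cc; have [Mc _ _ cS] := CS _ Cc.
exact: le_trans cS (iso_le Mc Mq (Ce _ Cc) eq (Cq _ Cc) xi).
Qed.

Lemma maximal_undominated : exists2 q, S q &
  forall q', S q' -> ople q q' -> q' = q.
Proof.
pose T := {x : K -> K | S x}.
pose le (a b : T) := `[< ople (sval a) (sval b) >].
have [||||q qmax] := @Zorn T le.
- by move=> a; apply/asboolP => v.
- by move=> a b c /asboolP ab /asboolP bc; apply/asboolP => v; exact: le_trans (ab v) (bc v).
- move=> [a Sa] [b Sb] /asboolP ab /asboolP ba; apply/eq_exist => /=.
  by have [_ ea _ _] := Sa; have [_ eb _ _] := Sb; exact: ople_anti.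
- move=> C Ct; have [[c0 Cc0]|C0] := pselect (C !=set0); last first.
    by exists (exist _ _ S0) => s Cs; case: C0; exists s.
  have [|_ [c _ <-]||q Sq Cq] := S_chain (C := [set sval c | c in C]).
  + by exists (sval c0), c0.
  + exact: proj2_sig.
  + move=> _ _ [a Ca <-] [b Cb <-].
    by have [/asboolP h|/asboolP h] := Ct _ _ Ca Cb; [left|right].
  by exists (exist _ q Sq) => s Cs; apply/asboolP; apply: Cq; exists s.
exists (sval q) => [|q' Sq' qq']; first exact: proj2_sig.
by have := qmax (exist _ q' Sq') (asboolT qq') => <-.
Qed.

(** Let [q] be maximal among the elements below [e] on which the state of [xi] is at
least that of [eta], and h = e - q. If 0 <= y <= h then <pi(y) xi, xi> is at most
<y eta, eta>, as otherwise q + y would contradict maximality. Elements of the form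
h x^* x h are of this kind up to a factor, since h x^* x h <= |x|^2 h^2 <= |x|^2 h,
and for them the inequality compares the norms of pi(x) pi(h) xi and x h eta. *)
Lemma dominated_below : rdot xi xi < rdot (e eta) eta -> phi e = rdot xi xi ->
  exists h, [/\ M h, effect h, ople h e, h <> 0 &
    forall x, M x -> hnorm (pi x (pi h xi)) <= hnorm (x (h eta))].
Proof.
move=> xe pe; have [q [Mq eq qe qS] qmax] := maximal_undominated.
pose h := e - q; have Mh : M h by exact: commutantB.
have eh : effect h by exact: effectB.
exists h; split=> //.
- by move=> v; rewrite /h !opE rdotBl gerDl oppr_le0 effect_ge0.
- move=> h0; have eqq : e = q by rewrite -[e](subrK q) -/h h0 add0r.
  by move: qS; rewrite -eqq pe leNgt /om xe.
move=> x Mx; have /bounded_opsP[lx [C C0 xC]] := commutant_bop Mx.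
have xx := adjP (commutant_bop Mx); have Mx' := commutant_adj hA Mx.
have hx := adj_comp (effect_sa eh) xx.
pose w : K -> K := (h \o adj x) \o (x \o h).
have Mw : M w by apply: commutant_comp; exact: commutant_comp.
pose y : K -> K := (C ^- 2 : R)%:C *: w.
have C2 : 0 < C ^- 2 by rewrite invr_gt0 exprn_gt0.
have wE v : rdot (w v) v = rdot (x (h v)) (x (h v)).
  by rewrite /rdot /w /= (effect_sa eh) (adj_sym xx).
have My : M y by exact: commutantZ.
have yh : ople y h.
  move=> v; rewrite /y opZE rdotZl wE -hnorm_sqr mulrC ler_pdivrMr ?exprn_gt0//.
  apply: (@le_trans _ _ ((C * hnorm (h v)) ^+ 2)).
    by rewrite ler_pXn2r ?nnegrE ?mulr_ge0 ?hnorm_ge0 ?(ltW C0).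
  by rewrite exprMn mulrC ler_pM2r ?exprn_gt0// hnorm_sqr effect_sqr.
have ey : effect y.
  split.
  - exact: bop_lin (commutant_bop My).
  - move=> u v; rewrite /y !opZE dotZl dotZr conjc_real; congr (_ * _).
    by rewrite /w /= (effect_sa eh) (adj_sym xx) xx (effect_sa eh).
  - by move=> v; rewrite /y opZE rdotZl wE mulr_ge0 ?rdot_ge0 ?ltW.
  - by move=> v; apply: le_trans (yh v) _; exact: effect_le1.
have pw : phi w = rdot (pi x (pi h xi)) (pi x (pi h xi)).
  rewrite /phi /w; have Mhx := commutant_comp Mh Mx'; have Mxh := commutant_comp Mx Mh.
  rewrite (star_iso_comp hpi Mhx Mxh) (star_iso_comp hpi Mh Mx') (star_iso_comp hpi Mx Mh) /=.
  rewrite /rdot (star_iso_adjoint hpi Mh Mh (effect_sa eh)).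
  by rewrite (adj_sym (star_iso_adjoint hpi Mx Mx' xx)).
apply: le_sqr_hnorm; rewrite -pw -wE -(ler_pM2l C2).
have -> : C ^- 2 * phi w = phi y by rewrite /phi /y (star_iso_scale hpi)// opZE rdotZl.
have -> : C ^- 2 * rdot (w eta) eta = om y by rewrite /om /y opZE rdotZl.
rewrite leNgt; apply/negP => py.
have [eqy qye] := effectD eq ey ee yh.
have qy : q + y = q.
  apply: qmax; last by move=> v; rewrite opDE rdotDl lerDl effect_ge0.
  split=> //; first exact: commutantD.
  rewrite /om /phi (star_iso_add hpi)// opDE opDE !rdotDl lerD// ltW//.
have y0 : y = 0 by rewrite -[y](addKr q) qy addNr.
move: py.
by rewrite y0 /phi /om iso0 !rdot0l ltxx.
Qed.

End locally_dominated.

(** The domination of the previous lemma gives a contraction [T] with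
T (x h eta) = pi(x) pi(h) xi, which intertwines the two actions. Then a = T^* T
lies in the commutant of the first algebra, and the state of pi(h) xi is that of
sqrt(a) (h eta). For pi(h) xi to be nonzero, the domination is carried out below
the inverse image [e] of the projection on the closed orbit of [xi] under [B]: if
pi(h) annihilates [xi], it annihilates this orbit, so that h = h e = 0. *)
Lemma vector_state_exists xi : xi <> 0 -> exists h eta, [/\ M h, pi h xi <> 0 &
  forall x, M x -> hdot (pi x (pi h xi)) (pi h xi) = hdot (x eta) eta].
Proof.
move=> xi0; pose D := [set b xi | b in B]; pose P := proj D.
have [sD Dxi NP] := orbit_proj hB xi.
have [e Me eP] := iso_surj NP; rewrite -/D -/P in eP.
have idem : e \o e = e.
  apply: iso_inj => //; first exact: commutant_comp.
  by rewrite (star_iso_comp hpi)// eP; apply/funext => v /=; exact: proj_idem.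
have Me' := commutant_adj hA Me; have ae := adjP (commutant_bop Me).
have sa : is_adjoint e e.
  have := star_iso_adjoint hpi Me Me' ae; rewrite eP => /(adj_uniq (proj_sa sD)) PE.
  by rewrite [X in is_adjoint _ X](iso_inj Me Me') // eP.
have ee v : rdot (e v) v = rdot (e v) (e v).
  by rewrite -[in LHS]idem /rdot /= sa.
have eff : effect e.
  split=> [||v|v]; [exact: bop_lin (commutant_bop Me)|by []|by rewrite ee rdot_ge0|].
  have [e0|e0] := eqVneq (e v) 0; first by rewrite e0 rdot0l rdot_ge0.
  have n0 : 0 < hnorm (e v) by rewrite hnorm_gt0.
  have : hnorm (e v) <= hnorm v.
    by rewrite -(@ler_pM2r _ (hnorm (e v)))// -expr2 hnorm_sqr -ee mulrC rdot_le.
  by rewrite ee -!hnorm_sqr ler_pXn2r ?nnegrE ?hnorm_ge0.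
have Pxi : P xi = xi by exact: proj_id.
have [w ew] : exists w, e w <> 0.
  apply/existsNP => h; apply: xi0; rewrite -Pxi -eP.
  by have -> : e = 0 by [apply/funext]; rewrite iso0.
have ew0 : 0 < hnorm (e w) by rewrite hnorm_gt0; apply/eqP.
(* Any vector in the range of [e] that is longer than [xi] will do. *)
pose eta := ((hnorm xi + 1) / hnorm (e w))%:C *: e w.
have le_ : linear e := effect_lin eff.
have eeta : e eta = eta by rewrite /eta (linZ le_) -[e (e w)]/((e \o e) w) idem.
have [||h [Mh eh he h0 hx]] := dominated_below Me eff (xi := xi) (eta := eta).
- rewrite eeta -!hnorm_sqr /eta hnormZr ger0_norm ?divr_ge0 ?addr_ge0 ?hnorm_ge0//.
  by rewrite divfK ?gt_eqF// ltr_pXn2r ?nnegrE ?addr_ge0 ?hnorm_ge0// ltrDl.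
- by rewrite eP Pxi.
pose zeta := pi h xi; pose eta0 := h eta.
have zeta0 : zeta <> 0.
  move=> z0; apply: h0; have hE : h \o e = 0.
    apply: iso_inj; [exact: commutant_comp|exact: commutant0|].
    rewrite (star_iso_comp hpi)// eP iso0; apply/funext => v /=.
    apply: (bop_eq_nearby (iso_bop Mh) (@bop0 _ H H)) (proj_nearby sD v) => _ [b Bb <-].
    by rewrite (commutantE _ (iso_mem Mh) Bb) -/zeta z0 (lin0 (bop_lin (vna_bounded hB Bb))).
  apply/funext => v; rewrite -[v](subrK (e v)) (linD (effect_lin eh)).
  rewrite -[h (e v)]/((h \o e) v) hE addr0; apply: rdot_eq0; apply/eqP.
  rewrite eq_le rdot_ge0 andbT; apply: le_trans (effect_sqr _ eh) _.
  apply: le_trans (he _) _; rewrite ee (linB le_) -[e (e v)]/((e \o e) v) idem.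
  by rewrite subrr rdot0l.
pose G : set (K * H) := [set (x eta0, pi x zeta) | x in M].
have [||_ [x Mx <-]|T [lT T1 TG _ Tc]] := @contraction_extension _ _ _ G.
- exists 0; first exact: commutant0.
  by rewrite iso0.
- move=> a _ _ [x Mx <-] [y My <-]; exists (a *: x + y); first exact: commutant_lincomb.
  by rewrite (star_iso_add hpi) ?(star_iso_scale hpi)//; exact: commutantZ.
- exact: hx.
have Tx x : M x -> forall z, T (x z) = pi x (T z).
  move=> Mx; have xx := adjP (commutant_bop Mx); have Mx' := commutant_adj hA Mx.
  apply: (Tc _ _ _ (commutant_bop Mx) xx (iso_bop Mx)) => _ [y My <-].
    by exists (x \o y); [exact: commutant_comp|rewrite (star_iso_comp hpi)].
  by exists (adj x (y eta0), pi (adj x) (pi y zeta)) => //; exists (adj x \o y);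
    [exact: commutant_comp|rewrite (star_iso_comp hpi)].
have bT : bounded_ops T by apply: (@bopW _ _ _ _ 1) => // z; rewrite mul1r.
have TT := adjP bT; have TT' := adj_sym TT.
have Tx' x : M x -> forall z, adj T (pi x z) = x (adj T z).
  move=> Mx z; have xx := adjP (commutant_bop Mx); have Mx' := commutant_adj hA Mx.
  apply: dot_inj => u; rewrite TT' (star_iso_adjoint hpi Mx Mx' xx) -Tx//.
  by rewrite -TT' xx.
pose a := adj T \o T.
have aE v : rdot (a v) v = rdot (T v) (T v) by rewrite /rdot /a /= TT'.
have ea : effect a.
  split.
  - exact: bop_lin (bop_comp (adj_bop bT) bT).
  - by move=> u v; rewrite /a /= TT' TT.
  - by move=> v; rewrite aE; exact: rdot_ge0.
  - move=> v; rewrite aE -!hnorm_sqr.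
    by rewrite ler_pXn2r ?nnegrE ?hnorm_ge0.
have [s [bs ss sE sT]] := effect_sqrt ea.
exists h, (s eta0); split=> // x Mx.
have Tz y : M y -> T (y eta0) = pi y zeta.
  by move=> My; apply: (TG (y eta0, pi y zeta)); exists y.
rewrite -/zeta -Tz// -[X in hdot _ X]/(id zeta) -iso_id -(Tz _ (commutant_id A)).
rewrite -TT' -[adj T _]/(a (x eta0)) -sE ss -(sT _ (commutant_bop Mx))//.
by move=> v; rewrite /a /= Tx// Tx'.
Qed.

End star_isomorphisms.

(** * The square of an infinite cardinal *)

Section cardinal_square.
Variable I : choiceType.

Definition inj_into (X Y : set I) (f : I -> I) :=
  (forall a, X a -> Y (f a)) /\ (forall a b, X a -> X b -> f a = f b -> a = b).

(** Comparability of cardinals: a maximal partial injection is total or onto. *)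
Lemma inj_into_total (X Y : set I) : exists f, inj_into X Y f \/ inj_into Y X f.
Proof.
pose P (G : set (I * I)) := (forall p, G p -> X p.1 /\ Y p.2) /\
  (forall p q, G p -> G q -> (p.1 = q.1 <-> p.2 = q.2)).
have [F FP Ft|G [[GXY Gi] Gmax]] := @Zorn_bigcup _ P.
  split=> [p [G FG Gp]|p q [G FG Gp] [G' FG' Gq]]; first by have [h _] := FP _ FG; exact: h.
  have [GG'|G'G] := Ft _ _ FG FG'.
    by have [_ h] := FP _ FG'; apply: h => //; exact: GG'.
  by have [_ h] := FP _ FG; apply: h => //; exact: G'G.
have [XG|/existsNP[a /not_implyP[Xa aG]]] := pselect (forall a, X a -> exists b, G (a, b)).
  have [f fP] : {f : I -> I & forall a, X a -> G (a, f a)}.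
    apply: (@choice _ _ (fun a b => X a -> G (a, b))) => a.
    by have [/XG[b Gb]|nX] := pselect (X a); [exists b|exists a].
  exists f; left; split=> [a /fP/GXY[]//|a b Xa Xb fab].
  exact: (Gi _ _ (fP _ Xa) (fP _ Xb)).2.
have [YG|/existsNP[b /not_implyP[Yb bG]]] := pselect (forall b, Y b -> exists a, G (a, b)).
  have [f fP] : {f : I -> I & forall b, Y b -> G (f b, b)}.
    apply: (@choice _ _ (fun b a => Y b -> G (a, b))) => b.
    by have [/YG[c Gc]|nY] := pselect (Y b); [exists c|exists b].
  exists f; right; split=> [c /fP/GXY[]//|c d Yc Yd fcd].
  exact: (Gi _ _ (fP _ Yc) (fP _ Yd)).1.
case: (Gmax (G `|` [set (a, b)])).
  split; first by move=> p Gp; left.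
  by move=> /(_ (a, b) (or_intror erefl)) Gab; apply: aG; exists b.
split=> [p [/GXY//|-> //]|p q [Gp|->] [Gq|->]] //; first exact: Gi.
  by split=> /= h; [exfalso; apply: aG; exists p.2|exfalso; apply: bG; exists p.1];
    rewrite -h -surjective_pairing.
by split=> /= h; [exfalso; apply: aG; exists q.2|exfalso; apply: bG; exists q.1];
  rewrite h -surjective_pairing.
Qed.

(** Injections from [D * D] to [D] are handled through their graphs, so that
the union of a chain is available; [D] is recovered from the diagonal. *)
Let dom (G : set (I * I * I)) : set I := [set x | exists z, G (x, x, z)].

Let sq_graph G := [/\ forall p, G p -> [/\ dom G p.1.1, dom G p.1.2 & dom G p.2],
  forall x y, dom G x -> dom G y -> exists z, G (x, y, z) &
  forall p q, G p -> G q -> (p.1 = q.1 <-> p.2 = q.2)].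

Let dom_sub G G' : G `<=` G' -> dom G `<=` dom G'.
Proof. by move=> GG' x [z /GG' h]; exists z. Qed.

(** Zorn's lemma is applied to the graphs that contain a fixed [G0], added to every
member of the chain so that the empty chain is not an exception. *)
Let sq_graph_bigcup (G0 : set (I * I * I)) (F : set (set (I * I * I))) :
  sq_graph G0 -> (forall G, F G -> sq_graph (G `|` G0)) -> total_on F subset ->
  sq_graph (\bigcup_(G in F) G `|` G0).
Proof.
move=> G0P FP Ft; set U := _ `|` G0.
have dir p q : U p -> U q -> exists G, [/\ sq_graph G, G `<=` U, G p & G q].
  have FU G : F G -> G `|` G0 `<=` U.
    by move=> FG r [Gr|?]; [left; exists G|right].
  move=> [[G FG Gp]|Gp] [[G' FG' Gq]|Gq].
  - have [GG'|G'G] := Ft _ _ FG FG'.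
      by exists (G' `|` G0); split; [exact: FP|exact: FU|left; exact: GG'|left].
    by exists (G `|` G0); split; [exact: FP|exact: FU|left|left; exact: G'G].
  - by exists (G `|` G0); split; [exact: FP|exact: FU|left|right].
  - by exists (G' `|` G0); split; [exact: FP|exact: FU|right|left].
  - by exists G0; split=> // r ?; right.
split=> [p Up|x y [z Uz] [w Uw]|p q Up Uq].
- have [G [[h _ _] GU Gp _]] := dir _ _ Up Up.
  by have [? ? ?] := h _ Gp; split; exact: (dom_sub GU).
- have [G [[_ h _] GU Gz Gw]] := dir _ _ Uz Uw.
  have [||z' ?] := h x y; [by exists z|by exists w|].
  by exists z'; exact: GU.
- by have [G [[_ _ h] _ Gp Gq]] := dir _ _ Up Uq; exact: h.
Qed.

Section extend.
Variables (X : set I) (f : I -> I -> I) (t : bool -> bool -> I) (g : I -> I).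
Hypothesis fX : forall x y, X x -> X y -> X (f x y).
Hypothesis fi : forall x y x' y', X x -> X y -> X x' -> X y' ->
  f x y = f x' y' -> x = x' /\ y = y'.
Hypothesis tX : forall a b, X (t a b).
Hypothesis ti : forall a b a' b', a || b -> a' || b' -> t a b = t a' b' -> a = a' /\ b = b'.
Hypothesis gX : inj_into X (~` X) g.

Let e (s : bool) x := if s then g x else x.

Let e_inj s s' x x' : X x -> X x' -> e s x = e s' x' -> s = s' /\ x = x'.
Proof.
move=> Xx Xx'; have [gn gi] := gX; case: s s' => -[] /= h; split=> //.
- exact: gi.
- by have := gn _ Xx; rewrite h.
- by have := gn _ Xx; rewrite h.
- by have := gn _ Xx'; rewrite -h.
- by have := gn _ Xx'; rewrite -h.
Qed.

Let G2 : set (I * I * I) := [set p | exists s s' x y, [/\ X x, X y,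
  p.1 = (e s x, e s' y) & p.2 = if s || s' then g (f (t s s') (f x y)) else f x y]].

Let domG2 w : dom G2 w <-> exists2 x, X x & exists s, w = e s x.
Proof.
split=> [[z [s [s' [x [y [Xx _ /= [-> _] _]]]]]]|[x Xx [s ->]]].
  by exists x => //; exists s.
eexists; exists s, s, x, x; split=> //.
Qed.

(** The square of the union of [X] with a disjoint copy [g X] consists of X * X and
of three further blocks. Three copies of X * X embed in [X], the tags [t s s']
telling them apart, and are sent from there into the copy. *)
Lemma sq_graph_extend : sq_graph G2 /\ (exists2 w, dom G2 w & ~ X w).
Proof.
split; last first.
  exists (g (t true true)); last exact: gX.1.
  by apply/domG2; exists (t true true) => //; exists true.
split.
- move=> [[a b] c] [s [s' [x [y [Xx Xy /= [-> ->] ->]]]]]; split; apply/domG2.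
  + by exists x => //; exists s.
  + by exists y => //; exists s'.
  + exists (if s || s' then f (t s s') (f x y) else f x y).
      by case: ifP => _; repeat apply: fX => //.
    by exists (s || s'); case: ifP.
- move=> _ _ /domG2[x Xx [s ->]] /domG2[y Xy [s' ->]].
  by eexists; exists s, s', x, y; split.
- move=> [ab c] [ab' c'] [s [s' [x [y [Xx Xy /= -> ->]]]]] [r [r' [x' [y' [Xx' Xy' /= -> ->]]]]].
  split=> [[/(e_inj Xx Xx')[-> ->] /(e_inj Xy Xy')[-> ->]] //|].
  have [Xf Xf'] : X (f x y) /\ X (f x' y') by split; exact: fX.
  have Xh u v : X (f (t u v) (f x y)) by exact: fX.
  have Xh' u v : X (f (t u v) (f x' y')) by exact: fX.
  case: ifP => h; case: ifP => h' E.
  + have /(fi (tX _ _) Xf (tX _ _) Xf')[] := gX.2 _ _ (Xh _ _) (Xh' _ _) E.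
    by move=> /(ti h h')[-> ->] /(fi Xx Xy Xx' Xy')[-> ->].
  + by have := gX.1 _ (Xh s s'); rewrite E => /(_ Xf').
  + by have := gX.1 _ (Xh' r r'); rewrite -E => /(_ Xf).
  + have [-> ->] := fi Xx Xy Xx' Xy' E.
    by move: h h'; case: s s' r r' => -[] [] [].
Qed.

Lemma sq_graph_extend_sub (G : set (I * I * I)) : X = dom G ->
  (forall x y, X x -> X y -> G (x, y, f x y)) -> sq_graph G -> G `<=` G2.
Proof.
move=> XE Gf [G1 _ G3] [[x y] z] Gp; have [/= Xx Xy _] := G1 _ Gp; rewrite -XE in Xx Xy.
exists false, false, x, y; split=> //=.
exact: (G3 _ _ Gp (Gf _ _ Xx Xy)).1.
Qed.

End extend.

(** Starting from a copy of the natural numbers, take a maximal graph, with domain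
[X]. By maximality [X] does not embed in its complement, so that the complement
embeds in [X]; hence the whole type embeds in two copies of [X], thus in [X]. *)
Theorem infinite_square : infinite_set [set: I] -> exists f : I * I -> I, injective f.
Proof.
move=> /infiniteP/card_leP[u0]; pose u (n : nat) : I := val (u0 (to_setT n)).
have ui : injective u.
  move=> n m /val_inj /(inj (mem_set Logic.I) (mem_set Logic.I)) E.
  exact: (congr1 val E).
pose G0 : set (I * I * I) := [set p | exists i j, p = (u i, u j, u (choice.pickle (i, j)))].
have domG0 x : dom G0 x <-> exists i, x = u i.
  split=> [[z [i [j [-> _ _]]]]|[i ->]]; first by exists i.
  by exists (u (choice.pickle (i, i))), i, i.
have G0P : sq_graph G0.
  split.
  - by move=> _ [i [j ->]] /=; split; apply/domG0; eexists.
  - by move=> _ _ /domG0[i ->] /domG0[j ->]; exists (u (choice.pickle (i, j))), i, j.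
  - move=> _ _ [i [j ->]] [i' [j' ->]] /=; split=> [[/ui -> /ui ->] //|].
    by move=> /ui/(pcan_inj choice.pickleK)[-> ->].
have [F FP Ft|G' [GP Gmax]] := @Zorn_bigcup _ (fun G => sq_graph (G `|` G0)).
  exact: sq_graph_bigcup.
set G := G' `|` G0 in GP; pose X := dom G; have [G1 G2 G3] := GP.
have [f0 f0P] : {f : I * I -> I & forall p, X p.1 -> X p.2 -> G (p, f p)}.
  apply: (@choice _ _ (fun p z => X p.1 -> X p.2 -> G (p, z))) => -[x y] /=.
  have [[Xx Xy]|nX] := pselect (X x /\ X y); last by exists x => ? ?; case: nX.
  by have [z Gz] := G2 _ _ Xx Xy; exists z.
pose f x y := f0 (x, y).
have Gf x y : X x -> X y -> G (x, y, f x y) by exact: (f0P (x, y)).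
have fX x y : X x -> X y -> X (f x y) by move=> Xx Xy; have [] := G1 _ (Gf _ _ Xx Xy).
have fi x y x' y' : X x -> X y -> X x' -> X y' -> f x y = f x' y' -> x = x' /\ y = y'.
  by move=> Xx Xy Xx' Xy' /(G3 _ _ (Gf _ _ Xx Xy) (Gf _ _ Xx' Xy')).2 [].
have uX i : X (u i).
  by apply: (@dom_sub G0) => [p ?|]; [right|apply/domG0; exists i].
(* The copy of the natural numbers provides the tags. *)
pose t (a b : bool) := u (a + b.*2)%N.
have tX a b : X (t a b) by exact: uX.
have ti a b a' b' : t a b = t a' b' -> a = a' /\ b = b'.
  by move=> /ui; case: a b a' b' => -[] [] [].
have [g [gX|gX]] := inj_into_total X (~` X).
  have [GP2 [w Gw Xw]] := sq_graph_extend fX fi tX (fun a b a' b' _ _ => @ti a b a' b') gX.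
  have GG2 := sq_graph_extend_sub t g (erefl : X = dom G) Gf GP.
  set G2' := (X in sq_graph X) in GP2 Gw GG2 *.
  case: (Gmax G2').
    split; first by move=> p G'p; apply: GG2; left.
    move=> G2G'; apply: Xw; apply: (dom_sub _ Gw) => p /G2G' ?; by left.
  by have -> : G2' `|` G0 = G2' by apply/setUidPl => p ?; apply: GG2; right.
pose j i := if pselect (X i) then f (t false false) i else f (t true false) (g i).
have jX i : X (j i) by rewrite /j; case: pselect => ?; apply: fX => //; exact: gX.1.
have ji : injective j.
  move=> a b; rewrite /j; case: pselect => Xa; case: pselect => Xb E.
  - by have [] := fi _ _ _ _ (tX _ _) Xa (tX _ _) Xb E.
  - by have [/ti[]] := fi _ _ _ _ (tX _ _) Xa (tX _ _) (gX.1 _ Xb) E.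
  - by have [/ti[]] := fi _ _ _ _ (tX _ _) (gX.1 _ Xa) (tX _ _) Xb E.
  - have [_] := fi _ _ _ _ (tX _ _) (gX.1 _ Xa) (tX _ _) (gX.1 _ Xb) E.
    exact: gX.2.
exists (fun p => f (j p.1) (j p.2)) => -[a b] [a' b'] /=.
by move=> /(fi _ _ _ _ (jX _) (jX _) (jX _) (jX _))[/ji -> /ji ->].
Qed.

End cardinal_square.

(** * Orthogonal families and the intertwining isometry *)

Section bessel.
Context {R : realType} {H : hilbertType R} {T : choiceType}.
Variables (X : set T) (v : T -> H).
Hypothesis v1 : forall i, X i -> hnorm (v i) = 1.
Hypothesis vo : forall i j, X i -> X j -> i <> j -> hdot (v i) (v j) = 0.

(** Subtracting from [e] its component along one member of the family does not
change the components along the others. *)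
Lemma bessel (r : seq T) (e : H) : uniq r -> (forall i, i \in r -> X i) ->
  \sum_(i <- r) hnorm (hdot e (v i) : R[i]^o) ^+ 2 <= hnorm e ^+ 2.
Proof.
elim: r e => [e _ _|i r ih e /= /andP[ir ur] rX]; first by rewrite big_nil sqr_ge0.
have Xi : X i by apply: rX; rewrite mem_head.
have rX' j : j \in r -> X j by move=> jr; apply: rX; rewrite inE jr orbT.
pose c := hdot e (v i); pose e' := e - c *: v i.
have e'v : hdot e' (v i) = 0.
  by rewrite /e' dotBl dotZl hdot_hnorm v1// expr1n mulr1 subrr.
have eE : hnorm e ^+ 2 = hnorm e' ^+ 2 + hnorm (c : R[i]^o) ^+ 2.
  rewrite -[in LHS](subrK (c *: v i) e) -/e' hnormD_sqr dotZr e'v mulr0 mulr0 addr0.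
  by rewrite hnormZ v1// mulr1.
rewrite big_cons eE addrC lerD2r.
apply: le_trans (ih e' ur rX').
rewrite le_eqVlt; apply/orP; left; apply/eqP; apply: eq_big_seq => j jr.
rewrite /e' dotBl dotZl vo ?mulr0 ?subr0//; first exact: rX'.
by move=> ij; rewrite ij jr in ir.
Qed.

(** By Bessel's inequality, each of the sets where |<e, v i>|^2 >= 1 / (n + 1) is
finite. *)
Lemma bessel_countable (e : H) : countable [set i | X i /\ hdot e (v i) <> 0].
Proof.
pose F (n : nat) : set T := [set i | X i /\ n.+1%:R^-1 <= hnorm (hdot e (v i) : R[i]^o) ^+ 2].
apply: (@sub_countable _ _ _ (\bigcup_(n in [set: nat]) F n)); last first.
  apply: bigcup_countable => // n _; apply: finite_set_countable.
  have [//|/infinite_set_fsetP Finf] := pselect (finite_set (F n)).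
  have [N Nlt] : exists N : nat, hnorm e ^+ 2 * n.+1%:R < N%:R.
    by exists (Num.bound (hnorm e ^+ 2 * n.+1%:R)); apply: archi_boundP; rewrite mulr_ge0 ?sqr_ge0.
  have [B BF BN] := Finf N.
  have BX i : i \in B -> X i by move=> /BF[].
  have := bessel e (fset_uniq B) BX; rewrite leNgt => /negP; case.
  apply: (@lt_le_trans _ _ (\sum_(i <- B) n.+1%:R^-1)); last first.
    by rewrite big_seq [leRHS]big_seq; apply: ler_sum => i /BF[].
  rewrite big_const_seq count_predT iter_addr_0 -[ltRHS]mulr_natr mulrC ltr_pdivlMr ?ltr0n//.
  by apply: lt_le_trans Nlt _; rewrite ler_nat.
apply: subset_card_le => i [Xi ei].
have e0 : 0 < hnorm (hdot e (v i) : R[i]^o) ^+ 2.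
  by rewrite exprn_gt0// lt_neqAle hnorm_ge0 andbT eq_sym; apply/eqP => /hnorm0_eq0.
set a : R := _ ^+ 2 in e0; have [n nP] : exists n : nat, a^-1 < n.+1%:R.
  exists (Num.bound a^-1); apply: (@lt_trans _ _ (Num.bound a^-1)%:R).
    by apply: archi_boundP; rewrite invr_ge0 ltW.
  by rewrite ltr_nat.
exists n => //; split=> //; rewrite -/a -[leRHS]invrK lef_pV2 ?posrE ?invr_gt0 ?ltr0n//.
exact: ltW.
Qed.

End bessel.

Section intertwiner.
Context {R : realType} {K H : hilbertType R}.
Variables (A : set (K -> K)) (B : set (H -> H)) (pi : (K -> K) -> (H -> H)).
Hypotheses (hA : von_neumann_algebra A) (hB : von_neumann_algebra B).
Hypothesis hpi : star_isomorphism (commutant A) (commutant B) pi.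
Local Notation M := (commutant A).

(** The pairs (zeta, eta) are the building blocks of the isometry: when the states
agree, pi(x) zeta |-> x eta is well defined and isometric on a cyclic subspace. *)
Definition matched_family (X : set (H * K)) :=
  (forall p, X p -> p.1 <> 0 /\ forall x, M x -> hdot (pi x p.1) p.1 = hdot (x p.2) p.2) /\
  (forall p q, X p -> X q -> p <> q -> forall x, M x -> hdot (pi x p.1) q.1 = 0).

(** Maximality suffices: a nonzero vector orthogonal to all the cyclic subspaces has
an image pi(h) z, still orthogonal to them, that can be matched. *)
Lemma total_matched_family : exists X, matched_family X /\
  forall z, (forall p x, X p -> M x -> hdot z (pi x p.1) = 0) -> z = 0.
Proof.
have [F FP Ft|X [XP Xmax]] := @Zorn_bigcup _ matched_family.
  split=> [p [G FG Gp]|p q [G FG Gp] [G' FG' Gq]].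
    by have [h _] := FP _ FG; exact: h.
  have [GG'|G'G] := Ft _ _ FG FG'.
    by have [_ h] := FP _ FG'; apply: h => //; exact: GG'.
  by have [_ h] := FP _ FG; apply: h => //; exact: G'G.
exists X; split=> // z zX; have [//|z0] := pselect (z = 0).
have [h [eta [Mh hz hE]]] := vector_state_exists hA hB hpi z0.
have [X1 X2] := XP; pose zeta := pi h z.
have zX' p x : X p -> M x -> hdot zeta (pi x p.1) = 0.
  move=> Xp Mx; have hh := adjP (commutant_bop Mh); have Mh' := commutant_adj hA Mh.
  rewrite /zeta (star_iso_adjoint hpi Mh Mh' hh).
  by rewrite -[pi _ (pi _ _)]/((pi (adj h) \o pi x) p.1) -(star_iso_comp hpi)// zX//;
    exact: commutant_comp.
have zX'' p x : X p -> M x -> hdot (pi x zeta) p.1 = 0.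
  move=> Xp Mx; have xx := adjP (commutant_bop Mx); have Mx' := commutant_adj hA Mx.
  by rewrite (star_iso_adjoint hpi Mx Mx' xx) zX'.
case: (Xmax (X `|` [set (zeta, eta)])).
  split; first by move=> p Xp; left.
  move=> /(_ (zeta, eta) (or_intror erefl)) Xz; apply: hz; apply: rdot_eq0.
  have := zX' _ id Xz (commutant_id A); rewrite (iso_id hpi) /= => h0.
  by rewrite /rdot -/zeta h0.
split=> [p [/X1//|-> //]|p q [Xp|->] [Xq|->] pq x Mx] /=.
- exact: X2.
- have xx := adjP (commutant_bop Mx); have Mx' := commutant_adj hA Mx.
  by rewrite (star_iso_adjoint hpi Mx Mx' xx); apply: hdot_eq0C; exact: zX''.
- exact: zX''.
- by [].
Qed.

Variables (I : choiceType) (E : set H).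
Hypotheses (infI : infinite_set [set: I]) (basisE : orthonormal_basis E).
Hypothesis (EI : (E #<= [set: I])%card).

Lemma dense_nearby (D : set H) z : dense D -> nearby D z.
Proof.
move=> dD e e0; have [] := dD (ball z e%:C).
- by exists z; apply: ballxx; rewrite ltcR.
- by apply: ball_open; rewrite ltcR.
move=> d [zd Dd]; exists d => //; move: zd; rewrite -ball_normE /= normE ltcR.
exact: ltW.
Qed.

Lemma basis_orth z : (forall e, E e -> hdot z e = 0) -> z = 0.
Proof.
move=> zE; apply: rdot_eq0; rewrite /rdot; have [_ /dense_nearby Ed] := basisE.
rewrite (orth_nearby _ (Ed z))// => _ [s sE <-].
by rewrite dot_sumr big_seq big1// => p /sE Ep; rewrite dotZr zE// mulr0.
Qed.

(** A vector of the orthonormal basis is orthogonal to all but countably many members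
of the family, and no member is orthogonal to the whole basis; so the family has
at most as many members as [I * nat], hence as [I]. *)
Lemma index_orthogonal (T : choiceType) (X : set T) (v : T -> H) :
  (forall i, X i -> v i <> 0) ->
  (forall i j, X i -> X j -> i <> j -> hdot (v i) (v j) = 0) ->
  exists g : T -> I, forall i j, X i -> X j -> g i = g j -> i = j.
Proof.
move=> v0 vo; have [F Fi] := infinite_square infI.
have /infiniteP/card_leP[u0] := infI; pose u (n : nat) : I := val (u0 (to_setT n)).
have ui : injective u.
  move=> n m /val_inj /(inj (mem_set Logic.I) (mem_set Logic.I)) uE.
  exact: (congr1 val uE).
have [c0] := card_leP EI.
pose c x : I := if pselect (E x) is left Ex then val (c0 (SigSub (mem_set Ex))) else u 0%N.
have ci x y : E x -> E y -> c x = c y -> x = y.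
  move=> Ex Ey; rewrite /c; case: pselect => // Ex'; case: pselect => // Ey'.
  move=> /val_inj /(inj (mem_set Logic.I) (mem_set Logic.I)) cE.
  exact: (congr1 val cE).
pose w i := ((hnorm (v i))^-1)%:C *: v i.
have w1 i : X i -> hnorm (w i) = 1.
  move=> Xi; have n0 : 0 < hnorm (v i) by rewrite hnorm_gt0; apply/eqP/v0.
  by rewrite hnormZr ger0_norm ?invr_ge0 ?hnorm_ge0// mulVf// gt_eqF.
have wo i j : X i -> X j -> i <> j -> hdot (w i) (w j) = 0.
  by move=> Xi Xj ij; rewrite dotZl dotZr vo// !mulr0.
have [e eP] : {e : T -> H & forall i, X i -> E (e i) /\ hdot (e i) (w i) <> 0}.
  apply: (@choice _ _ (fun i e => X i -> E e /\ hdot e (w i) <> 0)) => i.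
  have [Xi|nX] := pselect (X i); last by exists 0.
  have [//|/existsNP[e /not_implyP[Ee ew]]] :=
    pselect (forall e, E e -> hdot e (w i) = 0); last by exists e.
  move=> wE; have w0 : w i = 0 by apply: basis_orth => e /wE/hdot_eq0C.
  by have := w1 _ Xi; rewrite w0 hnorm0 => /eqP; rewrite eq_sym oner_eq0.
have [k kP] : {k : H -> T -> nat & forall e,
    {in [set i | X i /\ hdot e (w i) <> 0] &, injective (k e)}}.
  apply: (@choice _ _ (fun e k => {in [set i | X i /\ hdot e (w i) <> 0] &, injective k})) => x.
  exact/countable_injP/bessel_countable.
exists (fun i => F (c (e i), u (k (e i) i))) => i j Xi Xj /Fi[].
have [Ei ei] := eP i Xi; have [Ej ej] := eP j Xj.
move=> /(ci _ _ Ei Ej) eij /ui; rewrite -eij => kij.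
by apply: (kP (e i)) kij; rewrite inE; split=> //; rewrite eij.
Qed.

(** Take the cyclic subspaces of a total matched family once for each index: they
fill [hsum I H]. Sending each to its partner, placed in a coordinate of its own,
preserves inner products. There are enough coordinates because the pairs made of
an index and a member of the family inject into [I]. *)
Lemma amplified_intertwiner : exists W : hsum I H -> hsum I K, [/\ linear W,
  forall z, hnorm (W z) = hnorm z &
  forall x, M x -> forall z, W (dg I (pi x) z) = dg I x (W z)].
Proof.
have [X [[X1 X2] Xtot]] := total_matched_family.
have [F Fi] := infinite_square infI.
have [|i j Xi Xj ij|g gP] := @index_orthogonal _ X (fun p => p.1).
- by move=> p /X1[].
- by have := X2 _ _ Xi Xj ij id (commutant_id A); rewrite (iso_id hpi).
pose G : set (hsum I H * hsum I K) := [set q | exists i p x, [/\ X p, M x &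
  q = (hsingle i (pi x p.1), hsingle (F (i, g p)) (x p.2))]].
have iso_move x y (a b : H) : M x -> M y ->
    hdot (pi x a) (pi y b) = hdot (pi (adj y \o x) a) b.
  move=> Mx My; have My' := commutant_adj hA My; have yy := adjP (commutant_bop My).
  by rewrite (star_iso_comp hpi)// -(adj_sym (star_iso_adjoint hpi My My' yy)).
have [|z|W [lW W1 _ Wc]] := @gram_isometry _ _ _ G.
- move=> _ _ [i [p [x [Xp Mx ->]]]] [j [q [y [Xq My ->]]]] /=.
  have Myx : M (adj y \o x) by apply: commutant_comp => //; exact: commutant_adj.
  rewrite !dot_hsingle_single; have [<-|ij] := eqVneq i j; last first.
    by case: eqP => // /Fi[/eqP]; rewrite (negPf ij).
  have [<-|pq] := pselect (p = q).
    rewrite eqxx iso_move// (X1 _ Xp).2// /=.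
    by rewrite -(adj_sym (adjP (commutant_bop My))).
  case: eqP => [/Fi[/(gP _ _ Xp Xq)]//|_].
  by rewrite iso_move// X2.
- move: z; apply: dense_of_orth => [|z zG].
    by split; [exact: span0|move=> a x y; exact: span_lincomb].
  apply: hsum_eq => i; apply: Xtot => p x Xp Mx.
  apply: hdot_eq0C; rewrite -dot_hsingle; apply: hdot_eq0C; apply: zG.
  by apply: span_mem; eexists; first by exists i, p, x.
exists W; split=> // x Mx; have xx := adjP (commutant_bop Mx).
have Mx' := commutant_adj hA Mx; have bx := commutant_bop Mx; have bpx := iso_bop hpi Mx.
apply: (Wc _ _ _ (dg_bop I bpx) (dg_adj bpx (star_iso_adjoint hpi Mx Mx' xx)) (dg_bop I bx)).
  move=> _ [i [p [y [Xp My ->]]]] /=; exists i, p, (x \o y); split=> //.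
    exact: commutant_comp.
  by rewrite !dg_hsingle// (star_iso_comp hpi).
move=> _ [i [p [y [Xp My ->]]]] /=.
exists (hsingle i (pi (adj x \o y) p.1), hsingle (F (i, g p)) ((adj x \o y) p.2)).
  by exists i, p, (adj x \o y); split=> //; exact: commutant_comp.
by rewrite /= (dg_hsingle _ _ (iso_bop hpi Mx')) (star_iso_comp hpi).
Qed.

End intertwiner.

(** * Hyperreflexivity constants and compressions *)

Section operator_seminorms.
Context {R : realType}.
Implicit Types H K : hilbertType R.

Lemma opnorm_has_sup H K (T : H -> K) : bounded_ops T ->
  has_sup [set hnorm (T x) | x in [set x | hnorm x <= 1]].
Proof.
move=> /bounded_opsP[_ [C C0 TC]]; split.
  by exists (hnorm (T 0)), 0 => //=; rewrite hnorm0.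
exists C => _ [x /= x1 <-]; apply: le_trans (TC x) _.
by rewrite ler_piMr ?(ltW C0).
Qed.

Lemma opnorm_ub H K (T : H -> K) x : bounded_ops T -> hnorm x <= 1 ->
  hnorm (T x) <= opnorm T.
Proof. by move=> /opnorm_has_sup sT x1; apply: sup_upper_bound => //; exists x. Qed.

Lemma opnorm_le H K (T : H -> K) (c : R) :
  (forall x, hnorm x <= 1 -> hnorm (T x) <= c) -> opnorm T <= c.
Proof.
move=> Tc; apply: ge_sup; first by exists (hnorm (T 0)), 0 => //=; rewrite hnorm0.
by move=> _ [x x1 <-]; exact: Tc.
Qed.

Lemma opnorm_ge0 H K (T : H -> K) : bounded_ops T -> 0 <= opnorm T.
Proof.
move=> bT; apply: le_trans (hnorm_ge0 (T 0)) _; apply: opnorm_ub => //.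
by rewrite hnorm0.
Qed.

Lemma opdist_le H K (T : H -> K) (X : set (H -> K)) S : X `<=` bounded_ops ->
  bounded_ops T -> X S -> opdist T X <= opnorm (T - S).
Proof.
move=> Xb bT XS; apply: ge_inf; last by exists S.
by exists 0 => _ [U XU <-]; apply/opnorm_ge0/bopB => //; exact: Xb.
Qed.

Lemma opdist_ge H K (T : H -> K) (X : set (H -> K)) (c : R) : X !=set0 ->
  (forall S, X S -> c <= opnorm (T - S)) -> c <= opdist T X.
Proof.
move=> [S XS] Xc; apply: lb_le_inf; first by exists (opnorm (T - S)), S.
by move=> _ [U XU <-]; exact: Xc.
Qed.

Lemma annih_ub H K (X : set (H -> K)) (T : H -> K) x y : bounded_ops T ->
  hnorm x = 1 -> hnorm y = 1 -> (forall S, X S -> hdot (S x) y = 0) ->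
  hnorm (hdot (T x) y : R[i]^o) <= annih_seminorm X T.
Proof.
move=> /bounded_opsP[_ [C C0 TC]] x1 y1 Xxy; apply: sup_upper_bound; last by exists (x, y).
split; first by exists (hnorm (hdot (T x) y : R[i]^o)), (x, y).
exists C => _ [[u v] [/= u1 v1 _] <-]; apply: le_trans (hdot_le _ _) _.
by rewrite v1 mulr1; apply: le_trans (TC u) _; rewrite u1 mulr1.
Qed.

Lemma annih_le H K (X : set (H -> K)) (T : H -> K) (c : R) : 0 <= c ->
  (forall x y, hnorm x = 1 -> hnorm y = 1 -> (forall S, X S -> hdot (S x) y = 0) ->
    hnorm (hdot (T x) y : R[i]^o) <= c) -> annih_seminorm X T <= c.
Proof.
move=> c0 Tc; rewrite /annih_seminorm; set Q := (X in sup X).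
have [->|/set0P Q0] := eqVneq Q set0; first by rewrite sup0.
by apply: ge_sup => // _ [[x y] [/= x1 y1 xy] <-]; exact: Tc.
Qed.

Lemma annih_ge0 H K (X : set (H -> K)) (T : H -> K) : bounded_ops T ->
  0 <= annih_seminorm X T.
Proof.
move=> bT; rewrite /annih_seminorm; set Q := (X in sup X).
have [->|/set0P[_ [[x y] [/= x1 y1 xy] _]]] := eqVneq Q set0; first by rewrite sup0.
exact: le_trans (hnorm_ge0 _) (annih_ub bT x1 y1 xy).
Qed.

End operator_seminorms.

Section compression.
Context {R : realType} {H L : hilbertType R}.
Variables (W : H -> L) (X : set (H -> H)) (Y : set (L -> L)).
Hypotheses (lW : linear W) (W1 : forall z, hnorm (W z) = hnorm z).
Hypotheses (Xb : X `<=` bounded_ops) (Yb : Y `<=` bounded_ops) (Y0 : Y 0).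
Hypothesis down : forall T, Y T -> X (adj W \o T \o W).
Hypothesis up : forall S, X S -> Y (W \o S \o adj W).

Let bW : bounded_ops W.
Proof. by apply: (@bopW _ _ _ _ 1) => // z; rewrite mul1r W1. Qed.

Let aW := adjP bW.
Let aW' := adj_sym aW.

Let adjW1 z : hnorm (adj W z) <= hnorm z.
Proof.
by rewrite -[leRHS]mul1r; apply: is_adjoint_bound aW _ z => // u; rewrite W1 mul1r.
Qed.

Lemma isometry_adjK z : adj W (W z) = z.
Proof.
by apply: dot_inj => u; rewrite aW' !hdot_polar -!(linZ lW) -!(linD lW) !W1.
Qed.

Let lift (T : H -> H) := W \o T \o adj W.

Let lift_bop T : bounded_ops T -> bounded_ops (lift T).
Proof. by move=> bT; apply: bop_comp (adj_bop bW); exact: bop_comp. Qed.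

Let liftK T : adj W \o lift T \o W = T.
Proof. by apply/funext => z; rewrite /lift /= !isometry_adjK. Qed.

Let opdist_lift T : bounded_ops T -> opdist T X <= opdist (lift T) Y.
Proof.
move=> bT; apply: opdist_ge => [|S YS]; first by exists 0.
apply: le_trans (opdist_le Xb bT (down YS)) _; apply: opnorm_le => x x1.
have -> : (T - (adj W \o S \o W)) x = adj W ((lift T - S) (W x)).
  have lW' := bop_lin (adj_bop bW).
  by rewrite !opE (linB lW') -[in LHS](liftK T).
apply: le_trans (adjW1 _) _; apply: opnorm_ub; last by rewrite W1.
by apply: bopB; [exact: lift_bop|exact: Yb].
Qed.

Let annih_lift T : bounded_ops T -> annih_seminorm Y (lift T) <= annih_seminorm X T.
Proof.
move=> bT; have lT := bop_lin bT; have a0 := annih_ge0 X bT; apply: annih_le => // x y x1 y1 xy.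
rewrite /lift /= aW; set u := adj W x; set v := adj W y.
have [->|u0] := eqVneq u 0; first by rewrite (lin0 lT) dot0l hnorm0.
have [->|v0] := eqVneq v 0; first by rewrite dot0r hnorm0.
have nu : 0 < hnorm u by rewrite hnorm_gt0.
have nv : 0 < hnorm v by rewrite hnorm_gt0.
have u1 : hnorm u <= 1 by rewrite -x1; exact: adjW1.
have v1 : hnorm v <= 1 by rewrite -y1; exact: adjW1.
pose u' := ((hnorm u)^-1)%:C *: u; pose v' := ((hnorm v)^-1)%:C *: v.
have uE : u = (hnorm u)%:C *: u'.
  by rewrite /u' scalerA -rmorphM divff ?gt_eqF// scale1r.
have vE : v = (hnorm v)%:C *: v'.
  by rewrite /v' scalerA -rmorphM divff ?gt_eqF// scale1r.
have u'1 : hnorm u' = 1 by rewrite hnormZr ger0_norm ?invr_ge0 ?hnorm_ge0// mulVf// gt_eqF.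
have v'1 : hnorm v' = 1 by rewrite hnormZr ger0_norm ?invr_ge0 ?hnorm_ge0// mulVf// gt_eqF.
have : hnorm (hdot (T u') v' : R[i]^o) <= annih_seminorm X T.
  apply: annih_ub => // S XS; have lS := bop_lin (Xb XS).
  by rewrite (linZ lS) dotZl dotZr -aW -[W _]/((W \o S \o adj W) x) xy ?mulr0//; exact: up.
have -> : hnorm (hdot (T u) v : R[i]^o) = hnorm u * hnorm v * hnorm (hdot (T u') v' : R[i]^o).
  rewrite [in LHS]uE [in LHS]vE (linZ lT) dotZl dotZr conjc_real.
  rewrite -[X in hnorm X = _]/((hnorm u)%:C *: ((hnorm v)%:C *: (hdot (T u') v' : R[i]^o))).
  by rewrite !hnormZr !ger0_norm ?hnorm_ge0// mulrA.
apply: le_trans; rewrite ler_piMl ?hnorm_ge0// mulr_ile1 ?hnorm_ge0//.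
Qed.

(** For [T] on [H], the lift W T W^* is at least as far from [Y] as [T] is from [X],
since compressing an element of [Y] does not increase the distance. A pair of
vectors that annihilates [Y] is mapped by W^* to a pair that annihilates [X],
with norms at most 1, so that the annihilator seminorm of the lift is at most that
of [T]. The hypothesis on the full spaces is needed because the constant of a full
space is 1 by convention. *)
Lemma compression_constant : (X = bounded_ops -> Y = bounded_ops) ->
  (hyperreflexivity_constant X <= hyperreflexivity_constant Y)%E.
Proof.
move=> XY; rewrite /hyperreflexivity_constant.
case: eqP => [/XY ->|X1]; first by rewrite eqxx.
case: eqP => [Y1|_].
  case: X1; apply/seteqP; split=> // T bT.
  by rewrite -(liftK T); apply: down; rewrite Y1; exact: lift_bop.
have [hY|_] := asboolP (hyperreflexive Y); last by rewrite leey.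
have [k k0 kP] := hY.
rewrite asboolT; last first.
  exists k => // T bT; apply: le_trans (opdist_lift bT) _.
  by apply: le_trans (kP _ (lift_bop bT)) _; rewrite ler_pM2l//; exact: annih_lift.
apply: ge_ereal_sup => _ [T [bT XT] <-].
have YT : ~ Y (lift T) by move=> /down; rewrite liftK.
apply: (@le_trans _ _ (opdist (lift T) Y / annih_seminorm Y (lift T))%:E); last first.
  by apply: ereal_sup_ubound; exists (lift T) => //; split=> //; exact: lift_bop.
rewrite lee_fin; have := opdist_lift bT; have := annih_lift bT.
have := kP _ (lift_bop bT); have := annih_ge0 Y (lift_bop bT).
have d0 : 0 <= opdist T X.
  apply: opdist_ge => [|S XS]; first by exists (adj W \o 0 \o W); exact: down.
  by apply/opnorm_ge0/bopB => //; exact: Xb.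
rewrite le_eqVlt => /orP[/eqP <- +  _ d1|r0 _ r1 d1].
  rewrite mulr0 => d2; have -> : opdist T X = 0.
    by apply/eqP; rewrite eq_le d0 (le_trans d1 d2).
  by rewrite mul0r invr0 mulr0.
by rewrite ler_pM ?invr_ge0 ?annih_ge0// lef_pV2 ?posrE// (lt_le_trans r0 r1).
Qed.

End compression.

(** * Matrix spaces over a von Neumann algebra *)

Section matrix_spaces.
Context {R : realType} {H : hilbertType R}.
Variables (I : choiceType) (A : set (H -> H)).
Hypothesis hA : von_neumann_algebra A.

(** Commuting with the amplifications is a condition on the entries, by
[commute_dgP], and the bicommutant theorem turns it into membership in [A]. The
bound on the finite submatrices is the operator norm bound applied to finitely
supported vectors. *)
Lemma matrix_spaceP (T : hsum I H -> hsum I H) : matrix_space I A T <->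
  bounded_ops T /\ forall x, commutant A x -> forall z, T (dg I x z) = dg I x (T z).
Proof.
split=> [[bT [a [Aa _ Ta]]]|[bT Tx]]; split=> //.
  move=> x Mx; apply/commute_dgP => //; first exact: commutant_bop Mx.
  by move=> i j u; rewrite /entry !Ta -(commutantE _ Mx (Aa i j)).
exists (entry T); split=> //.
- move=> i j; rewrite -(bicommutant hA); apply: commutantI; first exact: entry_bop.
  by move=> x u Mx; have /commute_dgP-> := Tx _ Mx; [|by []|exact: commutant_bop Mx].
have /bounded_opsP[lT [C C0 TC]] := bT; exists C; first exact: ltW.
move=> F G x; pose z : hsum I H := \sum_(j <- G) hsingle j (x j).
have zE i : \sum_(j <- G) entry T i j (x j) = T z i.
  rewrite /z (lin_sum lT); elim: (enum_fset G) => [|j r ih]; first by rewrite !big_nil.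
  by rewrite !big_cons ih hsumDE.
under eq_bigr do rewrite zE.
apply: le_trans (psum_le_sqsum F (hsumP (T z))) _; rewrite -hsum_hnorm_sqr.
apply: (@le_trans _ _ ((C * hnorm z) ^+ 2)).
  by rewrite ler_pXn2r ?nnegrE ?mulr_ge0 ?hnorm_ge0 ?(ltW C0).
rewrite exprMn ler_pM2l ?exprn_gt0//.
rewrite hnorm_sqr /rdot {1}/z dot_suml le_eqVlt; apply/orP; left; apply/eqP.
rewrite raddf_sum big_seq [RHS]big_seq; apply: eq_bigr => j jG /=.
rewrite dot_hsingle hnorm_sqr; congr (complex.Re (hdot _ _)).
have -> : z j = \sum_(i <- G) (hsingle i (x i) : hsum I H) j.
  by apply: (big_morph (fun w : hsum I H => w j)).
rewrite (big_fsetD1 j)//= eqxx big1_fset ?addr0// => i.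
by rewrite !inE eq_sym => /andP[/negPf -> _].
Qed.

End matrix_spaces.

Section comparison.
Context {R : realType} {K H : hilbertType R}.
Variables (A : set (K -> K)) (B : set (H -> H)) (pi : (K -> K) -> (H -> H)).
Hypotheses (hA : von_neumann_algebra A) (hB : von_neumann_algebra B).
Hypothesis hpi : star_isomorphism (commutant A) (commutant B) pi.

(** An operator commuting with all rank one operators is scalar: the rank one
operator built from [a] and [b] gives <y c, b> a = <c, b> y a, and it remains to
take b = c nonzero. *)
Lemma scalar_commutant (I : choiceType) (i0 : I) : matrix_space I B = bounded_ops ->
  forall y, commutant B y -> exists k : R[i], y = k *: id.
Proof.
move=> BT y Ny; have by_ := commutant_bop Ny.
have key a b c : hdot (y c) b *: a = hdot c b *: y a.
  pose T (z : hsum I H) : hsum I H := hdot (z i0) b *: hsingle i0 a.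
  have bT : bounded_ops T.
    apply: (@bopW _ _ _ _ (hnorm b * hnorm a)) => [t u v|z].
      by rewrite /T hsumDE hsumZE dotDl dotZl scalerDl scalerA.
    rewrite /T hnormZ hsingle_norm mulrAC ler_wpM2r ?hnorm_ge0//.
    apply: le_trans (hdot_le _ _) _; rewrite mulrC ler_wpM2l ?hnorm_ge0//.
    exact: hnorm_coord.
  have : matrix_space I B T by rewrite BT.
  move=> /(matrix_spaceP hB)[_ /(_ _ Ny (hsingle i0 c))].
  move=> /(congr1 (fun z : hsum I H => z i0)).
  rewrite dg_hsingle// dgE// /T !hsumZE !hsingleE !eqxx.
  by rewrite (linZ (bop_lin by_)).
have [H0|/existsNP[c c0]] := pselect (forall c : H, c = 0).
  by exists 0; apply/funext => v; rewrite opZE [LHS]H0 [RHS]H0.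
exists (hdot (y c) c / hdot c c); apply/funext => a; rewrite opZE.
have cc : hdot c c != 0.
  by apply/eqP => cc; apply: c0; apply: rdot_eq0; rewrite /rdot cc.
by rewrite mulrC -scalerA key scalerA mulVf// scale1r.
Qed.

Lemma matrix_space_full (I : choiceType) (i0 : I) :
  matrix_space I B = bounded_ops -> matrix_space I A = bounded_ops.
Proof.
move=> BT; apply/seteqP; split=> [T []//|T bT].
apply/(matrix_spaceP hA); split=> // x Mx z.
have [k kE] := scalar_commutant i0 BT (iso_mem hpi Mx).
have Mk : commutant A (k *: id) by apply: commutantZ => //; exact: commutant_id.
have -> : x = k *: id.
  apply: (iso_inj hpi) => //; rewrite kE (star_iso_scale hpi); last exact: commutant_id.
  by rewrite (iso_id hpi).
have dgk w : dg I (k *: id : K -> K) w = k *: w.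
  by apply: hsum_eq => i; rewrite dgE//; exact: commutant_bop Mk.
by rewrite !dgk (linZ (bop_lin bT)).
Qed.

(** The isometry [W] of [amplified_intertwiner] intertwines the amplified commutants,
so conjugation by it and by its adjoint maps each matrix space into the other. *)
Lemma matrix_constant_le (I : choiceType) (E : set H) :
  infinite_set [set: I] -> orthonormal_basis E -> (E #<= [set: I])%card ->
  (hyperreflexivity_constant (matrix_space I B) <= hyperreflexivity_constant (matrix_space I A))%E.
Proof.
move=> infI basisE EI; have [i0 _] := infinite_setN0 infI.
have [W [lW W1 Wx]] := amplified_intertwiner hA hB hpi infI basisE EI.
have bW : bounded_ops W by apply: (@bopW _ _ _ _ 1) => // z; rewrite mul1r W1.
have aW := adjP bW; have aW' := adj_sym aW.
have Wx' x : commutant A x -> forall z, adj W (dg I x z) = dg I (pi x) (adj W z).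
  move=> Mx z; have bx := commutant_bop Mx; have xx := adjP bx.
  have Mx' := commutant_adj hA Mx; have pxx := star_iso_adjoint hpi Mx Mx' xx.
  apply: dot_inj => u.
  by rewrite aW' (dg_adj bx xx) -Wx// -aW' (dg_adj (iso_bop hpi Mx) pxx).
apply: (compression_constant lW W1).
- by move=> T [].
- by move=> T [].
- apply/(matrix_spaceP hA); split=> [|x Mx z]; first exact: bop0.
  by rewrite (lin0 (bop_lin (dg_bop I (commutant_bop Mx)))).
- move=> T /(matrix_spaceP hA)[bT Tx]; apply/(matrix_spaceP hB); split.
    exact: bop_comp (bop_comp (adj_bop bW) bT) bW.
  by move=> y /(iso_surj hpi)[x Mx <-] z; rewrite /= (Wx _ Mx) (Tx _ Mx) (Wx' _ Mx).
- move=> S /(matrix_spaceP hB)[bS Sy]; apply/(matrix_spaceP hA); split.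
    exact: bop_comp (bop_comp bW bS) (adj_bop bW).
  by move=> x Mx z; rewrite /= (Wx' _ Mx) (Sy _ (iso_mem hpi Mx)) (Wx _ Mx).
- exact: matrix_space_full.
Qed.

Lemma star_isomorphism_inverse : exists rho, star_isomorphism (commutant B) (commutant A) rho.
Proof.
have [rho rhoP] : {rho : (H -> H) -> (K -> K) & forall y, commutant B y ->
    commutant A (rho y) /\ pi (rho y) = y}.
  apply: (@choice _ _ (fun y x => commutant B y -> commutant A x /\ pi x = y)) => y.
  have [/(iso_surj hpi)[x Mx xE]|nN] := pselect (commutant B y); first by exists x.
  by exists id.
have uniq y x : commutant B y -> commutant A x -> pi x = y -> rho y = x.
  by move=> Ny Mx xE; have [Mx' xE'] := rhoP _ Ny; apply: (iso_inj hpi) => //; rewrite xE'.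
exists rho; split.
- split=> [y /rhoP[]//|y z|x Mx].
    rewrite !inE => Ny Nz yz; have [_ <-] := rhoP _ Ny; have [_ <-] := rhoP _ Nz.
    by rewrite yz.
  by exists (pi x); [exact: iso_mem hpi _ Mx|apply: uniq => //; exact: iso_mem hpi _ Mx].
- move=> S T NS NT; have [MS SE] := rhoP _ NS; have [MT TE] := rhoP _ NT.
  apply: uniq; [exact: commutantD|exact: commutantD|].
  by rewrite (star_iso_add hpi)// SE TE.
- move=> c S NS; have [MS SE] := rhoP _ NS.
  apply: uniq; [exact: commutantZ|exact: commutantZ|].
  by rewrite (star_iso_scale hpi)// SE.
- move=> S T NS NT; have [MS SE] := rhoP _ NS; have [MT TE] := rhoP _ NT.
  apply: uniq; [exact: commutant_comp|exact: commutant_comp|].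
  by rewrite (star_iso_comp hpi)// SE TE.
- move=> S T NS NT ST; have [MS SE] := rhoP _ NS; have [MT TE] := rhoP _ NT.
  have MS' := commutant_adj hA MS; have ss := adjP (commutant_bop MS).
  have := star_iso_adjoint hpi MS MS' ss; rewrite SE => /(adj_uniq ST) TE'.
  by rewrite (uniq T (adj (rho S))).
Qed.

End comparison.

(** A maximal orthonormal set is a basis. Two of its members are at distance
sqrt 2 > 1, so that they have different approximations, up to 1/2, in a countable
dense set. *)
Lemma separable_basis (R : realType) (H : hilbertType R) : separable_space H ->
  exists2 E : set H, orthonormal_basis E & countable E.
Proof.
move=> [D cD dD]; pose P (E : set H) := forall x y, E x -> E y -> hdot x y = (x == y)%:R.
have [F FP Ft x y [G FG Gx] [G' FG' Gy]|E [EP Emax]] := @Zorn_bigcup _ P.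
  have [GG'|G'G] := Ft _ _ FG FG'; first by apply: (FP _ FG') => //; exact: GG'.
  by apply: (FP _ FG) => //; exact: G'G.
have Eorth z : (forall e, E e -> hdot z e = 0) -> z = 0.
  move=> zE; have [//|z0] := eqVneq z 0; have n0 : 0 < hnorm z by rewrite hnorm_gt0.
  pose w := ((hnorm z)^-1)%:C *: z.
  have w1 : hdot w w = 1.
    by rewrite hdot_hnorm /w hnormZr ger0_norm ?invr_ge0 ?hnorm_ge0// mulVf ?gt_eqF// expr1n.
  have wE e : E e -> hdot w e = 0 by move=> Ee; rewrite dotZl zE// mulr0.
  have Ew : ~ E w by move=> Ew; have := wE _ Ew; rewrite w1 => /eqP; rewrite oner_eq0.
  case: (Emax (E `|` [set w])).
    split; first by move=> x Ex; left.
    by move=> /(_ w (or_intror erefl)).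
  move=> x y [Ex|->] [Ey|->]; first exact: EP.
  - by rewrite hdot_eq0C ?wE//; case: eqP => // xw; rewrite xw in Ex.
  - by rewrite wE//; case: eqP => // wy; rewrite -wy in Ey.
  - by rewrite eqxx w1.
exists E.
  split=> // O [x Ox] oO.
  have /nbhs_ballP[e /= e0 eO] := open_nbhs_nbhs (conj oO Ox).
  have eE : e = (complex.Re e)%:C.
    by rewrite [LHS]complexE (ger0_Im (ltW e0)) rmorph0 mulr0 addr0.
  have e1 : 0 < complex.Re e by rewrite -ltcR -eE.
  have sE : subsp (span E) by split; [exact: span0|move=> a u v; exact: span_lincomb].
  have Ed : forall z, nearby (span E) z.
    by apply: dense_of_orth => // z zE; apply: Eorth => u Eu; apply: zE; exact: span_mem.
  have [d sd xd] := Ed x (complex.Re e / 2) (divr_gt0 e1 (ltr0n _ 2)).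
  exists d; split.
    apply: eO; rewrite -ball_normE /= normE eE ltcR; apply: le_lt_trans xd _.
    by rewrite ltr_pdivrMr// ltr_pMr// ltr1n.
  elim: sd {xd} => [|a u v Eu _ [s sP <-]]; first by exists [::]; rewrite ?big_nil.
  exists ((a, u) :: s); last by rewrite big_cons.
  by move=> p; rewrite inE => /predU1P[->|/sP].
have [f fP] : {f : H -> H & forall x, E x -> D (f x) /\ hnorm (x - f x) <= 2^-1}.
  apply: (@choice _ _ (fun x d => E x -> D d /\ hnorm (x - d) <= 2^-1)) => x.
  have h0 : 0 < 2^-1 :> R by rewrite invr_gt0.
  have [d Dd xd] := dense_nearby x dD h0.
  by exists d.
have /countable_injP[k ki] := cD; apply/countable_injP; exists (k \o f) => x y.
rewrite !inE => Ex Ey /= /ki; have [Dx xf] := fP _ Ex; have [Dy yf] := fP _ Ey.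
rewrite !inE => /(_ Dx Dy) fxy; have [//|xy] := eqVneq x y.
have : hnorm (x - y) <= 1.
  have -> : x - y = (x - f x) - (y - f y) by rewrite fxy opprB addrA subrK.
  by apply: le_trans (ler_hnormB_le _ _) _; rewrite [leRHS](splitr 1) mul1r lerD.
rewrite -(@ler_pXn2r _ 2) ?nnegrE ?hnorm_ge0// expr1n hnorm_sqr /rdot.
rewrite dotBl !dotBr !EP// !eqxx (negPf xy) eq_sym (negPf xy) /=.
by rewrite subr0 sub0r opprK => h; exfalso; move: h => /=; lra.
Qed.

Local Close Scope complex_scope.
Local Open Scope card_scope.

Theorem theorem4p6 (R : realType) (K H : hilbertType R)
    (A : set (K -> K)) (B : set (H -> H)) (pi : (K -> K) -> (H -> H))
    (hA : von_neumann_algebra A) (hB : von_neumann_algebra B)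
    (hpi : star_isomorphism (commutant A) (commutant B) pi) :
  (forall (I : choiceType) (E : set H),
     infinite_set [set: I] -> orthonormal_basis E -> E #<= [set: I] ->
     (hyperreflexivity_constant (matrix_space I B)
        <= hyperreflexivity_constant (matrix_space I A))%E)
  /\
  (separable_space K -> separable_space H ->
     hyperreflexivity_constant (matrix_space nat B)
       = hyperreflexivity_constant (matrix_space nat A)).
Proof.
split=> [I E|sK sH]; first exact: (matrix_constant_le hA hB hpi).
have [pi' hpi'] := star_isomorphism_inverse hA hB hpi.
have [E bE cE] := separable_basis sH; have [F bF cF] := separable_basis sK.
apply/eqP; rewrite eq_le; apply/andP; split.
  exact: (matrix_constant_le hA hB hpi infinite_nat bE cE).
exact: (matrix_constant_le hB hA hpi' infinite_nat bF cF).
Qed.
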